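(* Let $p$ be a prime and $s,t\ge 1$, $m\ge 0$ integers. Let $F$ be a field containing a $C_m$ field $L$ and containing a primitive $p^t$-th root of unity, and let $A$ be a central simple $F$-algebra of exponent $p^t$ and degree $p^s$. Then the symbol length of $A$ is bounded by $\mathrm{len}(p^t,M)$ for some $C_r$ field $M$ with $r=m+\mathrm{ed}_L(A)+p^{s-t}-1$ (and $M$ containing a primitive $p^t$-th root of unity); that is, $\mathrm{len}(p^t,A)\le \mathrm{len}(p^t,M)$.
   Context: A field $F$ is called $C_m$ if every homogeneous polynomial equation $f(x_1,\dots,x_N)=0$ over $F$ of degree $d\geq 1$ with $N>d^m$ has a non-trivial solution in $F$. For a field $F$ containing a primitive $n$-th root of unity $\rho_n$ and $a,b\in F^\times$, the symbol algebra is $(a,b)_n=F[x,y\mid x^n=a,\ y^n=b,\ yx=\rho_n xy]$, a central simple $F$-algebra of degree $n$. The exponent of $A$ is its order in $\mathrm{Br}(F)$; the degree of $A$ is $\sqrt{\dim_F A}$. For a central simple algebra $A$ of exponent $n$ over $F$, $\mathrm{len}(n,A)$ is the minimal number of symbol algebras of degree $n$ over $F$ whose tensor product is Brauer equivalent to $A$, and for a field $M$ containing a primitive $n$-th root of unity $\mathrm{len}(n,M)$ is the smallest non-negative integer (or $\infty$) bounding $\mathrm{len}(n,B)$ for all $B\in\mathrm{Br}(M)$ of exponent $n$. The essential dimension of $A$ over $L$ is $$\mathrm{ed}_L(A)=\min\{\operatorname{trdeg}_L(K)\mid L\subseteq K\subseteq F \text{ a field},\ A\cong A'\otimes_K F \text{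 for some central simple } K\text{-algebra } A'\}.$$ *)

(* Defs.v *)
From HB Require Import structures.
From mathcomp Require Import all_boot all_algebra all_field.
From mathcomp Require Import boolp.
From mathcomp Require Import mpoly.

Set Implicit Arguments.
Unset Strict Implicit.
Unset Printing Implicit Defensive.

Import GRing.Theory.
Local Open Scope ring_scope.

(* Minima with values in nat extended by None = +oo. *)

Definition least (P : nat -> Prop) : option nat :=
  if pselect (exists n, `[< P n >]) is left exP then Some (ex_minn exP)
  else None.

Lemma least_SomeP (P : nat -> Prop) n :
  least P = Some n <-> P n /\ forall k, P k -> (n <= k)%N.
Proof.
rewrite /least; case: pselect => [exP|nexP]; last first.
  by split=> // -[Pn _]; case: nexP; exists n; apply/asboolP.
case: ex_minnP => k /asboolP Pk kmin; split=> [[<-]|[Pn nmin]].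
  by split=> // l Pl; apply: kmin; apply/asboolP.
congr Some; apply/eqP; rewrite eqn_leq nmin // andbT.
by apply: kmin; apply/asboolP.
Qed.

Lemma least_NoneP (P : nat -> Prop) : least P = None <-> forall n, ~ P n.
Proof.
rewrite /least; case: pselect => [exP|nexP].
  by split=> // nP; have [n /asboolP/nP] := exP.
by split=> // _ n Pn; apply: nexP; exists n; apply/asboolP.
Qed.

Definition ext_leq (x y : option nat) : bool :=
  match x, y with
  | _, None => true
  | None, Some _ => false
  | Some k, Some l => (k <= l)%N
  end.

Definition Cfield (m : nat) (F : fieldType) : Prop :=
  forall (d N : nat) (f : {mpoly F[N]}),
    (0 < d)%N -> (d ^ m < N)%N -> f \is d.-homog ->
    exists x : 'I_N -> F, (exists i, x i != 0) /\ f.@[x] = 0.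

Section TranscendenceDegree.

Variables (L K : fieldType) (i : {rmorphism L -> K}).

Definition alg_independent (d : nat) (x : d.-tuple K) : Prop :=
  forall p : {mpoly L[d]}, mmap i (tnth x) p = 0 -> p = 0.

Definition transcendence_basis (d : nat) (x : d.-tuple K) : Prop :=
  alg_independent x /\ forall y : K, ~ alg_independent [tuple of y :: x].

Definition has_trdeg (d : nat) : Prop :=
  exists x : d.-tuple K, transcendence_basis x.

End TranscendenceDegree.

(* The algebra on {ffun I -> F^o} given by structure constants: the product   *)
(* of the standard basis vectors i and j has coordinates st_mul i j.          *)

Definition stdbasis (F : fieldType) (I : finType) (i : I) : {ffun I -> F^o} :=
  [ffun k => (k == i)%:R].

Record structure_table (F : fieldType) (I : finType) := StructureTable {
  st_mul : I -> I -> {ffun I -> F^o};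
  st_one : {ffun I -> F^o};
  st_mulA : forall i j k,
    \sum_l st_mul i j l *: st_mul l k = \sum_l st_mul j k l *: st_mul i l;
  st_mul1l : forall i, \sum_l st_one l *: st_mul l i = stdbasis F i;
  st_mul1r : forall i, \sum_l st_one l *: st_mul i l = stdbasis F i;
  st_one_neq0 : st_one != 0
}.

Definition table_alg (F : fieldType) (I : finType)
  (c : structure_table F I) : Type := {ffun I -> F^o}.

Section TableAlgebra.

Variables (F : fieldType) (I : finType) (c : structure_table F I).

HB.instance Definition _ := Vector.copy (table_alg c) {ffun I -> F^o}.

Implicit Types x y z : table_alg c.

Definition table_mul x y : table_alg c :=
  \sum_i \sum_j (x i * y j) *: st_mul c i j.

Let tmulDl : left_distributive table_mul +%R.
Proof.
move=> x y z; rewrite /table_mul -big_split; apply: eq_bigr => i _.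
rewrite -big_split; apply: eq_bigr => j _.
by rewrite ffunE mulrDl scalerDl.
Qed.

Let tmulDr : right_distributive table_mul +%R.
Proof.
move=> x y z; rewrite /table_mul -big_split; apply: eq_bigr => i _.
rewrite -big_split; apply: eq_bigr => j _.
by rewrite ffunE mulrDr scalerDl.
Qed.

Let tscalel a x y : a *: table_mul x y = table_mul (a *: x) y.
Proof.
rewrite /table_mul scaler_sumr; apply: eq_bigr => i _.
rewrite scaler_sumr; apply: eq_bigr => j _.
by rewrite ffunE scalerA mulrA.
Qed.

Let tscaler a x y : a *: table_mul x y = table_mul x (a *: y).
Proof.
rewrite /table_mul scaler_sumr; apply: eq_bigr => i _.
rewrite scaler_sumr; apply: eq_bigr => j _.
by rewrite ffunE scalerA mulrCA.
Qed.

Let tmul_suml (J : finType) (f : J -> table_alg c) y :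
  table_mul (\sum_j f j) y = \sum_j table_mul (f j) y.
Proof.
apply: (big_morph (table_mul^~ y)) => [u v|]; first exact: tmulDl.
by have := tscalel 0 0 y; rewrite !scale0r.
Qed.

Let tmul_sumr (J : finType) (f : J -> table_alg c) x :
  table_mul x (\sum_j f j) = \sum_j table_mul x (f j).
Proof.
apply: (big_morph (table_mul x)) => [u v|]; first exact: tmulDr.
by have := tscaler 0 x 0; rewrite !scale0r.
Qed.

Let bs (i : I) : table_alg c := stdbasis F i.

Let bsE x : x = \sum_i x i *: bs i.
Proof.
apply/ffunP => k; rewrite sum_ffunE (bigD1 k) //= big1 => [|i ik].
  by rewrite !ffunE eqxx addr0 [RHS]mulr1.
by rewrite !ffunE eq_sym (negbTE ik) scaler0.
Qed.

Let tmul_bsr x k : table_mul x (bs k) = \sum_l x l *: st_mul c l k.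
Proof.
apply: eq_bigr => i _; rewrite (bigD1 k) //= big1 => [|j jk].
  by rewrite ffunE eqxx addr0 mulr1.
by rewrite ffunE (negbTE jk) mulr0 scale0r.
Qed.

Let tmul_bsl x k : table_mul (bs k) x = \sum_l x l *: st_mul c k l.
Proof.
rewrite /table_mul exchange_big; apply: eq_bigr => i _.
rewrite (bigD1 k) //= big1 => [|j jk].
  by rewrite ffunE eqxx addr0 mul1r.
by rewrite ffunE (negbTE jk) mul0r scale0r.
Qed.

Let tmul_bs i j : table_mul (bs i) (bs j) = st_mul c i j.
Proof.
rewrite tmul_bsr (bigD1 i) //= big1 => [|k ki].
  by rewrite ffunE eqxx scale1r addr0.
by rewrite ffunE (negbTE ki) scale0r.
Qed.

Let tmulEl x y : table_mul x y = \sum_i x i *: table_mul (bs i) y.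
Proof.
rewrite [x in LHS]bsE tmul_suml.
by apply: eq_bigr => i _; rewrite tscalel.
Qed.

Let tmulEr x y : table_mul x y = \sum_i y i *: table_mul x (bs i).
Proof.
rewrite [y in LHS]bsE tmul_sumr.
by apply: eq_bigr => i _; rewrite tscaler.
Qed.

Let tmulA : associative table_mul.
Proof.
have A1 i j z : table_mul (bs i) (table_mul (bs j) z)
              = table_mul (table_mul (bs i) (bs j)) z.
  rewrite (tmulEr (bs j) z) tmul_sumr [RHS]tmulEr; apply: eq_bigr => k _.
  by rewrite -tscaler !tmul_bs tmul_bsl tmul_bsr st_mulA.
have A2 i y z : table_mul (bs i) (table_mul y z)
              = table_mul (table_mul (bs i) y) z.
  rewrite (tmulEl y z) tmul_sumr (tmulEr (bs i) y) tmul_suml.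
  by apply: eq_bigr => j _; rewrite -tscaler -tscalel A1.
move=> x y z; rewrite (tmulEl x (table_mul y z)) (tmulEl x y) tmul_suml.
by apply: eq_bigr => i _; rewrite -tscalel A2.
Qed.

Let tmul1 : left_id (st_one c : table_alg c) table_mul.
Proof.
move=> x; rewrite [x in LHS]bsE tmul_sumr [RHS]bsE.
by apply: eq_bigr => i _; rewrite -tscaler tmul_bsr st_mul1l.
Qed.

Let tmulr1 : right_id (st_one c : table_alg c) table_mul.
Proof.
move=> x; rewrite [x in LHS]bsE tmul_suml [RHS]bsE.
by apply: eq_bigr => i _; rewrite -tscalel tmul_bsl st_mul1r.
Qed.

HB.instance Definition _ := GRing.Zmodule_isNzRing.Build (table_alg c)
  tmulA tmul1 tmulr1 tmulDl tmulDr (st_one_neq0 c).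
HB.instance Definition _ := GRing.Lmodule_isLalgebra.Build F (table_alg c)
  tscalel.
HB.instance Definition _ := GRing.Lalgebra_isAlgebra.Build F (table_alg c)
  tscaler.
HB.instance Definition _ := Algebra_isFalgebra.Build F (table_alg c).

Lemma table_mulE x y : x * y = \sum_i \sum_j (x i * y j) *: st_mul c i j.
Proof. by []. Qed.

End TableAlgebra.

Section Coordinates.

Variables (F : fieldType) (A : falgType F).

Definition bas (i : 'I_(\dim {:A})) : A := (vbasis {:A})`_i.
Definition crd (i : 'I_(\dim {:A})) (u : A) : F := coord (vbasis {:A}) i u.

Lemma crd_sum u : u = \sum_i crd i u *: bas i.
Proof. exact: coord_vbasis (memvf u). Qed.

Lemma crd_bas i k : crd k (bas i) = (k == i)%:R.
Proof. by rewrite /crd coord_free ?(basis_free (vbasisP _)) // eq_sym. Qed.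

Lemma crd_mull u w k : \sum_l crd l u * crd k (bas l * w) = crd k (u * w).
Proof.
rewrite [u in RHS]crd_sum mulr_suml /crd linear_sum /=.
by apply: eq_bigr => l _; rewrite -scalerAl linearZ.
Qed.

Lemma crd_mulr u w k : \sum_l crd l u * crd k (w * bas l) = crd k (w * u).
Proof.
rewrite [u in RHS]crd_sum mulr_sumr /crd linear_sum /=.
by apply: eq_bigr => l _; rewrite -scalerAr linearZ.
Qed.

Lemma crd1_neq0 : exists k, crd k 1 != 0.
Proof.
apply/existsP; apply: contraT; rewrite negb_exists => /forallP c0.
suff: (1 : A) == 0 by rewrite oner_eq0.
rewrite [1]crd_sum big1 // => i _.
by have := c0 i; rewrite negbK => /eqP->; rewrite scale0r.
Qed.

End Coordinates.

Section TensorProduct.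

Variables (F : fieldType) (A B : falgType F).

(* The coordinates of the pure tensor u (x) v in the product basis. *)
Definition tens (u : A) (v : B) :
    {ffun 'I_(\dim {:A}) * 'I_(\dim {:B}) -> F^o} :=
  [ffun k => crd k.1 u * crd k.2 v].

Let tmul (i j : 'I_(\dim {:A}) * 'I_(\dim {:B})) :=
  tens (bas i.1 * bas j.1) (bas i.2 * bas j.2).

Let sum2 (f : 'I_(\dim {:A}) -> F) (g : 'I_(\dim {:B}) -> F) :
  \sum_k f k.1 * g k.2 = (\sum_i f i) * (\sum_j g j).
Proof.
rewrite big_distrlr /=.
by rewrite (pair_bigA _ (fun i j => f i * g j)).
Qed.

Let tens_mulr u v i :
  \sum_l tens u v l *: tmul l i = tens (u * bas i.1) (v * bas i.2).
Proof.
apply/ffunP => k; rewrite sum_ffunE ffunE -!crd_mull -sum2.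
by apply: eq_bigr => l _; rewrite !ffunE [LHS]mulrACA.
Qed.

Let tens_mull u v i :
  \sum_l tens u v l *: tmul i l = tens (bas i.1 * u) (bas i.2 * v).
Proof.
apply/ffunP => k; rewrite sum_ffunE ffunE -!crd_mulr -sum2.
by apply: eq_bigr => l _; rewrite !ffunE [LHS]mulrACA.
Qed.

Let tens_bas i : tens (bas i.1) (bas i.2) = stdbasis F i.
Proof.
apply/ffunP => k; rewrite !ffunE !crd_bas -natrM mulnb -xpair_eqE.
by rewrite -!surjective_pairing.
Qed.

Let tens_mulA i j k :
  \sum_l tmul i j l *: tmul l k = \sum_l tmul j k l *: tmul i l.
Proof. by rewrite tens_mulr tens_mull !mulrA. Qed.

Let tens_mul1l i : \sum_l tens 1 1 l *: tmul l i = stdbasis F i.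
Proof. by rewrite tens_mulr !mul1r tens_bas. Qed.

Let tens_mul1r i : \sum_l tens 1 1 l *: tmul i l = stdbasis F i.
Proof. by rewrite tens_mull !mulr1 tens_bas. Qed.

Let tens1_neq0 : tens 1 1 != 0.
Proof.
have [[i ni] [j nj]] := (crd1_neq0 A, crd1_neq0 B).
apply/eqP => /ffunP/(_ (i, j)); rewrite !ffunE /= => /eqP.
by rewrite mulf_eq0 (negbTE ni) (negbTE nj).
Qed.

Definition tensor_table :=
  StructureTable tens_mulA tens_mul1l tens_mul1r tens1_neq0.

Definition tensor : falgType F := table_alg tensor_table.

Lemma tensM (u u' : A) (v v' : B) :
  (tens (u * u') (v * v') : tensor) = (tens u v : tensor) * tens u' v'.
Proof.
rewrite table_mulE exchange_big /=; apply/ffunP => k.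
rewrite ffunE sum_ffunE -!crd_mulr -sum2; apply: eq_bigr => l _.
under eq_bigr => i _ do rewrite mulrC -scalerA.
by rewrite -scaler_sumr tens_mulr !ffunE [LHS]mulrACA.
Qed.

End TensorProduct.

Section ScalarExtension.

Variables (K F : fieldType) (f : {rmorphism K -> F}) (A : falgType K).

(* The coordinates of u (x) 1 in A (x)_K F. *)
Definition ext (u : A) :
    {ffun 'I_(\dim {:A}) -> F^o} := [ffun k => f (crd k u)].

Let emul (i j : 'I_(\dim {:A})) := ext (bas i * bas j).

Let ext_mulr u i : \sum_l ext u l *: emul l i = ext (u * bas i).
Proof.
apply/ffunP => k; rewrite sum_ffunE ffunE -crd_mull rmorph_sum.
by apply: eq_bigr => l _; rewrite !ffunE rmorphM.
Qed.

Let ext_mull u i : \sum_l ext u l *: emul i l = ext (bas i * u).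
Proof.
apply/ffunP => k; rewrite sum_ffunE ffunE -crd_mulr rmorph_sum.
by apply: eq_bigr => l _; rewrite !ffunE rmorphM.
Qed.

Let ext_bas i : ext (bas i) = stdbasis F i.
Proof. by apply/ffunP => k; rewrite !ffunE crd_bas rmorph_nat. Qed.

Let ext_mulA i j k :
  \sum_l emul i j l *: emul l k = \sum_l emul j k l *: emul i l.
Proof. by rewrite ext_mulr ext_mull !mulrA. Qed.

Let ext_mul1l i : \sum_l ext 1 l *: emul l i = stdbasis F i.
Proof. by rewrite ext_mulr mul1r ext_bas. Qed.

Let ext_mul1r i : \sum_l ext 1 l *: emul i l = stdbasis F i.
Proof. by rewrite ext_mull mulr1 ext_bas. Qed.

Let ext1_neq0 : ext 1 != 0.
Proof.
have [i ni] := crd1_neq0 A.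
by apply/eqP => /ffunP/(_ i)/eqP; rewrite !ffunE fmorph_eq0 (negbTE ni).
Qed.

Definition ext_table :=
  StructureTable ext_mulA ext_mul1l ext_mul1r ext1_neq0.

Definition scalar_ext : falgType F := table_alg ext_table.

Lemma extM u v : (ext (u * v) : scalar_ext) = (ext u : scalar_ext) * ext v.
Proof.
rewrite table_mulE exchange_big /=; apply/ffunP => k.
rewrite ffunE sum_ffunE -crd_mulr rmorph_sum; apply: eq_bigr => l _.
under eq_bigr => i _ do rewrite mulrC -scalerA.
by rewrite -scaler_sumr ext_mulr !ffunE rmorphM.
Qed.

End ScalarExtension.

Definition alg_iso (F : fieldType) (A B : falgType F) : Prop :=
  exists f : {lrmorphism A -> B}, bijective f.

Section CentralSimple.

Variable F : fieldType.
Implicit Types A B S : falgType F.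

(* Two-sided ideals of a unital algebra are automatically subspaces. *)
Definition two_sided_ideal A (I : {vspace A}) : bool :=
  (({:A} * I)%VS <= I)%VS && ((I * {:A})%VS <= I)%VS.

Definition central_simple A : Prop :=
  'Z({:A})%VS = 1%VS /\
  forall I : {vspace A}, two_sided_ideal I -> I = 0%VS \/ I = fullv.

Definition has_degree A (d : nat) : Prop := \dim {:A} = (d ^ 2)%N.

Fixpoint tensor_pow A (n : nat) : falgType F :=
  if n is n'.+1 then tensor A (tensor_pow A n') else F^o.

Definition brauer_equiv A B : Prop :=
  exists k l : nat, alg_iso (tensor A 'M[F]_k.+1) (tensor B 'M[F]_l.+1).

Definition exponent A : option nat :=
  least (fun n => (0 < n)%N /\ brauer_equiv (tensor_pow A n) F^o).

Variables (n : nat) (rho : F).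

Definition symbol_relations (a b : F) (S : algType F) (x y : S) : Prop :=
  [/\ x ^+ n = a%:A, y ^+ n = b%:A & y * x = rho *: (x * y)].

(* S is presented by generators x, y and the relations above. *)
Definition is_symbol_algebra (a b : F) S : Prop :=
  exists x y : S,
    symbol_relations a b x y /\
    forall (T : algType F) (u v : T), symbol_relations a b u v ->
      (exists h : {lrmorphism S -> T}, h x = u /\ h y = v) /\
      (forall h h' : {lrmorphism S -> T},
         h x = h' x -> h y = h' y -> h =1 h').

Definition symbol S : Prop :=
  exists a b : F, [/\ a != 0, b != 0 & is_symbol_algebra a b S].

Inductive symbol_product : nat -> falgType F -> Prop :=
| SymbolProduct0 : symbol_product 0 F^o
| SymbolProductS k S T :
    symbol S -> symbol_product k T -> symbol_product k.+1 (tensor S T).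

Definition symbol_length A : option nat :=
  least (fun k => exists T, symbol_product k T /\ brauer_equiv T A).

Definition field_symbol_length : option nat :=
  least (fun l => forall B, central_simple B -> exponent B = Some n ->
    ext_leq (symbol_length B) (Some l)).

End CentralSimple.

Section EssentialDimension.

Variables (L F : fieldType) (iota : {rmorphism L -> F}).

Definition descends (K : fieldType) (j : {rmorphism K -> F})
    (A : falgType F) : Prop :=
  exists A' : falgType K, central_simple A' /\ alg_iso (scalar_ext j A') A.

(* The fields K with L <= K <= F are the factorizations of iota through a     *)
(* field.  The minimum exists (only finitely many structure constants are     *)
(* needed to define A), so the default value of odflt is irrelevant.          *)
Definition ess_dim (A : falgType F) : nat :=
  odflt 0%N (least (fun d =>
    exists (K : fieldType) (i : {rmorphism L -> K}) (j : {rmorphism K -> F}),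
      [/\ j \o i =1 iota, has_trdeg i d & descends j A])).

End EssentialDimension.

(* Main.v *)
(* Let K be a field between L and F that realizes the essential dimension, so    *)
(* that A = A' (x)_K F, and put q = p^t, N = (p^s)^q.  A field M between K and F *)
(* splits the q-th tensor power D of A' as soon as D has an N-dimensional        *)
(* representation over M; then A'_M has exponent exactly p^t, and any expression *)
(* of A'_M by symbols over M yields one of the same length for A over F.  So it  *)
(* suffices to find such an M, containing the roots of unity, of transcendence   *)
(* degree at most ed_L(A) + p^(s-t) - 1 over L and to apply Tsen-Lang.           *)
(*   Goldman's swap elements and the q-th symmetric power show that the index of *)
(* D divides 'C(p^t + p^s - 1, p^t), whose p-part is p^(s-t) when s >= t.  Hence *)
(* D has a representation R over K of dimension e * N with e <= p^(s-t).  Since  *)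
(* D splits over F, there is an N-dimensional representation V over F and an     *)
(* injective intertwiner from V to R.  M is generated over K by the entries of   *)
(* the intertwiner in normal form.  Over an algebraic extension of K that splits *)
(* A', the intertwiners to R form a space of dimension e, so up to scaling the   *)
(* chosen one depends on e - 1 parameters only.                                  *)

Require Import Defs.
From HB Require Import structures.
From mathcomp Require Import all_boot all_algebra all_field.
From mathcomp Require Import boolp mpoly zify perm fingroup.

Set Implicit Arguments.
Unset Strict Implicit.
Unset Printing Implicit Defensive.

Import GRing.Theory.

(** Let [K] realize the essential dimension, with [A] obtained from [A'] over [K] ([ess_dimP]), and
    let [D] be the [p ^ t]-th tensor power of [A'], of degree [N]. An intermediate field [M] will do
    as soon as it contains the root of unity and [D] has a representation of dimension [N] over [M].
    Such a representation splits [D] over [M] ([brauer_trivial_of_rep]), so the exponent of [A']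
    over [M] divides [p ^ t]; it cannot drop, because it is [p ^ t] over [F]. Symbols over [M]
    extend to symbols over [F], so [symbol_length_ext] bounds the length of [A] by a length over
    [M].

    [M] is the field of definition of a point of a Severi-Brauer variety. Over [K] the algebra [D]
    has a module of dimension [e * N], where [e] is its index, and after splitting the submodules of
    dimension [N] form a projective space of dimension [e - 1]. As [F] splits [D], there is such a
    submodule over [F]; the entries of its echelon form generate over [K] a field of transcendence
    degree at most [e - 1] ([field_of_definition]). The index is bounded in [small_rep]: Goldman
    elements act as swaps on tensor powers of a splitting module [V], and their common invariants in
    [D] form a right ideal that becomes Hom from the tensor power of [V] to its symmetric power.
    Counting dimensions shows that [e], a power of [p], divides a binomial coefficient whose p-part
    is found in [dvd_bin_prime_power].

    The module theory rests on [sandwich_crd], which yields the dimension formula [intertwines_dim]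
    over every extension field.

    The Tsen-Lang theorem ([Cfield_extension]) is proved for systems of forms of equal degree. A
    field with property C_m has the property for systems ([Cfield_sys_zero]): by Nagata's
    substitution into norm forms if the field is not algebraically closed, by a projective
    Nullstellensatz ([relevant_point]) if it is. The property passes to algebraic extensions
    ([sys_zero_algebraic]), and a transcendental element raises its level by one
    ([sys_zero_transcendental]). *)

(** * Binomial coefficients and powers of p *)

Lemma prime_dvd_bin_pow p k m i : prime p -> (p ^ k %| m)%N -> (0 < i < p ^ k)%N ->
  (p %| 'C(m, i))%N.
Proof.
move=> pp km /andP [i0 ik]; apply: contraT => pC.
case: i i0 ik pC => // i _ ik pC.
have : (p ^ k %| i.+1 * 'C(m, i.+1))%N by rewrite -mul_bin_diag dvdn_mulr.
rewrite Gauss_dvdl ?coprimeXl ?prime_coprime // => /dvdn_leq le.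
by move: ik; rewrite ltnNge le.
Qed.

(** By [prime_dvd_bin_pow] and Pascal's rule, consecutive entries of row [m] are opposite modulo
    [p], starting from 1. *)
Lemma bin_pred_pow_coprime p k m j : prime p -> (p ^ k %| m.+1)%N -> (j < p ^ k)%N ->
  ~~ (p %| 'C(m, j))%N.
Proof.
move=> pp km; elim: j => [|j IH] jk.
  by rewrite bin0 dvdn1 neq_ltn prime_gt1 ?orbT.
have : (p %| 'C(m.+1, j.+1))%N by apply: prime_dvd_bin_pow km _ => //; rewrite jk.
rewrite binS; apply: contraL => pC; rewrite dvdn_addr //.
by apply: IH; apply: ltnW.
Qed.

(** With [n.+1 = p ^ t + p ^ s] and [t <= s], the relation [p ^ t * 'C(n, p ^ t) = p ^ s * 'C(n, (p
    ^ t).-1)] isolates the p-part [p ^ (s - t)]. For [s < t] the coefficient equals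
    ['C(n, (p ^ s).-1)], which is prime to [p], so [e = 1], in accordance with the truncated
    difference [s - t]. *)
Lemma dvd_bin_prime_power p s t e : prime p -> (0 < s)%N -> (0 < t)%N ->
  (e %| 'C(p ^ t + (p ^ s).-1, p ^ t))%N -> (exists i, e = p ^ i)%N -> (e <= p ^ (s - t))%N.
Proof.
move=> pp s0 t0 eC [i eE].
have pg k : (0 < p ^ k)%N by rewrite expn_gt0 prime_gt0.
set n := (p ^ t + (p ^ s).-1)%N in eC.
have nE : n.+1 = (p ^ t + p ^ s)%N by rewrite /n -addnS prednK.
have [ts|st] := leqP t s.
  have H : (p ^ t * 'C(n, p ^ t) = p ^ s * 'C(n, (p ^ t).-1))%N.
    have := mul_bin_left n (p ^ t).-1; rewrite prednK // => ->.
    by congr (_ * _)%N; rewrite -subSS prednK // nE addKn.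
  have C' : ~~ (p %| 'C(n, (p ^ t).-1))%N.
    apply: (@bin_pred_pow_coprime p t) => //; last by rewrite prednK.
    by rewrite nE dvdn_add // dvdn_exp2l.
  have CE : 'C(n, p ^ t) = (p ^ (s - t) * 'C(n, (p ^ t).-1))%N.
    by apply/eqP; rewrite -(eqn_pmul2l (pg t)) H mulnA -expnD subnKC.
  move: eC; rewrite CE eE Gauss_dvdl; last by rewrite coprimeXl ?prime_coprime.
  by move/dvdn_leq; apply.
have sn : (p ^ t <= n)%N by rewrite leq_addr.
have C' : ~~ (p %| 'C(n, p ^ t))%N.
  rewrite -bin_sub //; have -> : (n - p ^ t = (p ^ s).-1)%N by rewrite addKn.
  apply: (@bin_pred_pow_coprime p s) => //; last by rewrite prednK.
  by rewrite nE dvdn_add // dvdn_exp2l // ltnW.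
move: eC; rewrite eE; case: i {eE} => [|i]; first by rewrite expn0.
by move=> H; case/negP: C'; apply: dvdn_trans H; rewrite expnS dvdn_mulr.
Qed.

Local Open Scope ring_scope.

(** * Sandwich operators *)

Section Sandwich.

Variables (K : fieldType) (A : falgType K).
Implicit Types (l : seq (A * A)) (x y : A).

(** The list [l] stands for the tensor with terms [p.1 (x) p.2] in A (x) A^op, which acts on [A] by
    left and right multiplication. *)
Definition sandwich l x := \sum_(p <- l) p.1 * x * p.2.

Lemma sandwichD l : {morph sandwich l : x y / x + y}.
Proof.
move=> x y; rewrite /sandwich -big_split /=.
by apply: eq_bigr => p _; rewrite mulrDr mulrDl.
Qed.

Lemma sandwichZ l c x : sandwich l (c *: x) = c *: sandwich l x.
Proof.
rewrite /sandwich scaler_sumr; apply: eq_bigr => p _.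
by rewrite -scalerAr -scalerAl.
Qed.

Lemma sandwichB l : {morph sandwich l : x y / x - y}.
Proof. by move=> x y; rewrite sandwichD -scaleN1r sandwichZ scaleN1r. Qed.

Lemma sandwich_cat l1 l2 x :
  sandwich (l1 ++ l2) x = sandwich l1 x + sandwich l2 x.
Proof. by rewrite /sandwich big_cat. Qed.

Definition lmul_pairs a l : seq (A * A) := [seq (a * p.1, p.2) | p <- l].
Definition rmul_pairs l a : seq (A * A) := [seq (p.1, p.2 * a) | p <- l].

Lemma sandwich_lmul a l x : sandwich (lmul_pairs a l) x = a * sandwich l x.
Proof.
rewrite /sandwich big_map mulr_sumr.
by apply: eq_bigr => p _; rewrite !mulrA.
Qed.

Lemma sandwich_rmul a l x : sandwich (rmul_pairs l a) x = sandwich l x * a.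
Proof.
rewrite /sandwich big_map mulr_suml.
by apply: eq_bigr => p _; rewrite !mulrA.
Qed.

Definition comp_pairs l1 l2 : seq (A * A) :=
  flatten [seq rmul_pairs (lmul_pairs p.1 l2) p.2 | p <- l1].

Lemma sandwich_comp l1 l2 x :
  sandwich (comp_pairs l1 l2) x = sandwich l1 (sandwich l2 x).
Proof.
rewrite /comp_pairs; elim: l1 => [|p l1 IH] /=; first by rewrite /sandwich !big_nil.
rewrite sandwich_cat IH sandwich_rmul sandwich_lmul.
by rewrite [in RHS]/sandwich big_cons.
Qed.

Hypothesis csA : central_simple A.

Lemma center_scalar y : (forall a, a * y = y * a) -> exists c, y = c *: 1.
Proof.
move=> yC; have : y \in 1%VS.
  rewrite -csA.1 memv_cap memvf /=; apply/centvP => a _; rewrite yC //.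
by case/vlineP => c ->; exists c.
Qed.

(** The products [bas i * w * bas j] span the two-sided ideal of [w], which by simplicity contains
    1. *)
Lemma sandwich_to1 w : w != 0 -> exists l, sandwich l w = 1.
Proof.
move=> w0.
pose X := [seq bas i * w * bas j | i <- enum 'I_(\dim {:A}), j <- enum 'I_(\dim {:A})].
have inX a b : a * w * b \in <<X>>%VS.
  rewrite [a]crd_sum [b]crd_sum !mulr_suml memv_suml // => i _.
  rewrite mulr_sumr memv_suml // => j _.
  rewrite -!scalerAl -scalerAr; do 2!apply: memvZ; apply: memv_span.
  by apply/allpairsP; exists (i, j); rewrite !mem_enum.
have memX z : z \in <<X>>%VS -> exists l, z = sandwich l w.
  rewrite -[X]/(tval (in_tuple X)) => /coord_span ->.
  have : forall i : 'I_(size X), exists l, X`_i = sandwich l w.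
    move=> i; have /allpairsP [[a b] /= [_ _ ->]] : X`_i \in X by exact: mem_nth.
    by exists [:: (bas a, bas b)]; rewrite /sandwich big_seq1.
  move=> /choice [f Hf].
  elim/big_ind: _ => [|x y [l1 ->] [l2 ->]|i _].
  - by exists [::]; rewrite /sandwich big_nil.
  - by exists (l1 ++ l2); rewrite sandwich_cat.
  - exists (lmul_pairs (coord (in_tuple X) i z)%:A (f i)).
    by rewrite sandwich_lmul -Hf -scalerAl mul1r.
have idX : two_sided_ideal <<X>>%VS.
  rewrite /two_sided_ideal; apply/andP; split; apply/prodvP => a b.
    move=> _ /memX [l ->]; rewrite -sandwich_lmul /sandwich memv_suml // => p _.
  move=> /memX [l ->] _; rewrite -sandwich_rmul /sandwich memv_suml // => p _.
case: (csA.2 _ idX) => HX.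
  have : w \in <<X>>%VS by rewrite -[w]mul1r -[1 * w]mulr1; apply: inX.
  by rewrite HX memv0 (negbTE w0).
have : 1 \in <<X>>%VS by rewrite HX memvf.
by move=> /memX [l ->]; exists l.
Qed.

(** A density argument by induction on the list: an operator [S] that isolates [x] from [X] is
    corrected by one that sends the new element [y] to 1 and kills [x] and [X]. How the latter is
    found depends on whether [sandwich S y] is central. *)
Lemma sandwich_separate x X : free (x :: X) ->
  exists l, sandwich l x = 1 /\ forall y, y \in X -> sandwich l y = 0.
Proof.
have [n] := ubnP (size X); elim: n x X => // n IH x [|y X] /= szX fX.
  have /sandwich_to1 [l Hl] : x != 0 by rewrite -seq1_free.
  by exists l.
rewrite ltnS in szX.
have fxX : free (x :: X).
  have P : perm_eq [:: x, y & X] [:: y, x & X].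
    exact: permEl (perm_catCA [:: x] [:: y] X).
  by move: fX; rewrite (perm_free P) free_cons => /andP [].
have [S [S1 S0]] := IH x X szX fxX.
suff [S' [S'y S'0]] : exists S', sandwich S' y = 1 /\
     forall z, z \in x :: X -> sandwich S' z = 0.
  exists (S ++ lmul_pairs (- sandwich S y) S'); split.
    by rewrite sandwich_cat sandwich_lmul S'0 ?mem_head // mulr0 addr0.
  move=> z; rewrite inE sandwich_cat sandwich_lmul => /orP [/eqP ->|zX].
    by rewrite S'y mulr1 subrr.
  by rewrite S0 // S'0 ?inE ?zX ?orbT // mulr0 addr0.
have [yC|] := pselect (forall a, a * sandwich S y = sandwich S y * a).
  (* Here [sandwich S y] is a scalar [c]. Induction applied to [y - c *: x] gives [S'], and
     subtracting [sandwich S' x] times [S] makes it kill [x]. *)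
  have [c yc] := center_scalar yC.
  have fy : free ((y - c *: x) :: X).
    have := fX; rewrite !free_cons span_cons.
    case/and3P => nx ny ->; rewrite andbT.
    apply: contra nx => H.
    have [c0|c0] := eqVneq c 0.
      by move: H ny; rewrite c0 scale0r subr0 => ->.
    have -> : x = c^-1 *: (y - (y - c *: x)).
      by rewrite opprB addrCA subrr addr0 scalerA mulVf // scale1r.
    apply: memvZ; apply: memv_add; first exact: memv_line.
    by rewrite memvN.
  have [S' [S'1 S'0]] := IH _ X szX fy.
  exists (S' ++ lmul_pairs (- sandwich S' x) S); split.
    rewrite sandwich_cat sandwich_lmul yc mulNr -scalerAr mulr1.
    by rewrite -[RHS]S'1 sandwichB sandwichZ.
  move=> z; rewrite inE sandwich_cat sandwich_lmul => /orP [/eqP ->|zX].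
    by rewrite S1 mulr1 subrr.
  by rewrite S0 // S'0 // mulr0 addr0.
move/existsNP => [a Ha].
(* The commutator of [a] with the values of [S] kills [X], and kills [x] because [sandwich S x = 1],
   but it does not kill [y]. *)
pose T := lmul_pairs a S ++ rmul_pairs S (- a).
have TE z : sandwich T z = a * sandwich S z - sandwich S z * a.
  by rewrite sandwich_cat sandwich_lmul sandwich_rmul mulrN.
have [U HU] : exists U, sandwich U (sandwich T y) = 1.
  by apply: sandwich_to1; rewrite TE subr_eq0; apply/eqP.
exists (comp_pairs U T); split; first by rewrite sandwich_comp.
have sw0 l : sandwich l 0 = 0.
  by have := sandwichZ l 0 0; rewrite !scale0r.
move=> z; rewrite inE sandwich_comp TE => /orP [/eqP ->|zX].
  by rewrite S1 mul1r mulr1 subrr.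
by rewrite S0 // mulr0 mul0r subrr.
Qed.

(** In other words A (x) A^op is all of End(A). Most arguments below use central simplicity in this
    form. *)
Lemma sandwich_crd i : exists l, forall x, sandwich l x = crd i x *: 1.
Proof.
have fb := basis_free (vbasisP {:A}).
have [l [l1 l0]] : exists l, sandwich l (bas i) = 1 /\
    forall j, j != i -> sandwich l (bas j) = 0.
  have isz : (i < size (vbasis {:A}))%N by rewrite size_tuple.
  have Hp := perm_to_rem (mem_nth 0 isz).
  have := fb; rewrite (perm_free Hp) => /sandwich_separate [l [l1 l0]].
  exists l; split=> // j ji; apply: l0.
  rewrite rem_filter ?(free_uniq fb) // mem_filter /= mem_nth ?size_tuple // andbT.
  by rewrite nth_uniq ?size_tuple ?(free_uniq fb).
exists l => x; rewrite [x in LHS]crd_sum.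
have sws : sandwich l (\sum_j crd j x *: bas j)
    = \sum_j crd j x *: sandwich l (bas j).
  rewrite /sandwich; under [RHS]eq_bigr do rewrite scaler_sumr.
  rewrite [RHS]exchange_big /=; apply: eq_bigr => p _.
  rewrite mulr_sumr mulr_suml; apply: eq_bigr => j _.
  by rewrite -scalerAr -scalerAl.
rewrite sws (bigD1 i) //= l1 big1 ?addr0 // => j ji.
by rewrite l0 // scaler0.
Qed.

(* The enveloping algebra A (x) A^op acts faithfully on A. *)
Lemma sandwich_inj (y : 'I_(\dim {:A}) -> A) :
  (forall x, \sum_c y c * x * bas c = 0) -> forall c, y c = 0.
Proof.
move=> H i; have [l Hl] := sandwich_crd i.
have : \sum_(p <- l) (\sum_c y c * p.1 * bas c) * p.2 = 0.
  by rewrite big1 // => p _; rewrite H mul0r.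
under eq_bigr do rewrite mulr_suml.
rewrite exchange_big /= (eq_bigr (fun c => y c * sandwich l (bas c))); last first.
  by move=> c _; rewrite /sandwich mulr_sumr; apply: eq_bigr => p _; rewrite !mulrA.
rewrite (bigD1 i) //= big1 ?addr0 => [|c ci].
  by rewrite Hl crd_bas eqxx scale1r mulr1.
by rewrite Hl crd_bas eq_sym (negbTE ci) scale0r mulr0.
Qed.

End Sandwich.

(** * Representations and intertwiners *)

Section Families.

Variables (E : fieldType) (V : lmodType E).

Definition free_fam (J : finType) (X : J -> V) : Prop :=
  forall c : J -> E, \sum_j c j *: X j = 0 -> forall j, c j = 0.

Definition spanned_by (J : finType) (X : J -> V) (y : V) : Prop :=
  exists c : J -> E, y = \sum_j c j *: X j.

Definition basis_fam (P : V -> Prop) (J : finType) (X : J -> V) : Prop :=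
  [/\ forall j, P (X j), forall y, P y -> spanned_by X y & free_fam X].

Lemma free_fam_le (J J' : finType) (X : J -> V) (X' : J' -> V) :
  free_fam X -> (forall j, spanned_by X' (X j)) -> (#|J| <= #|J'|)%N.
Proof.
move=> fX /choice [C HC]; rewrite leqNgt; apply/negP => lt.
pose M := \matrix_(i < #|J|, k < #|J'|) C (enum_val i) (enum_val k).
have nM : kermx M != 0.
  rewrite -mxrank_eq0 mxrank_ker -lt0n subn_gt0.
  exact: leq_ltn_trans (rank_leq_col M) lt.
have /rowV0Pn [v /sub_kermxP vM v0] := nM.
have S0 : \sum_j v 0 (enum_rank j) *: X j = 0.
  under eq_bigr do rewrite HC scaler_sumr.
  rewrite exchange_big big1 //= => k _.
  under eq_bigr do rewrite scalerA.
  rewrite -scaler_suml.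
  have /matrixP/(_ 0 (enum_rank k)) := vM.
  rewrite !mxE => Hk; rewrite [X in X *: _](_ : _ = 0) ?scale0r // -[RHS]Hk.
  rewrite [RHS](reindex (@enum_rank J)) /=; last first.
    by exists enum_val => x _; rewrite ?enum_rankK ?enum_valK.
  by apply: eq_bigr => j _; rewrite mxE !enum_rankK.
case/eqP: v0; apply/rowP => i; rewrite mxE.
by have := fX _ S0 (enum_val i); rewrite enum_valK.
Qed.

Lemma basis_fam_card (P : V -> Prop) (J J' : finType) (X : J -> V) (X' : J' -> V) :
  basis_fam P X -> basis_fam P X' -> #|J| = #|J'|.
Proof.
move=> [PX sX fX] [PX' sX' fX']; apply/eqP; rewrite eqn_leq.
by apply/andP; split; [apply: (free_fam_le fX (X' := X')) => j; apply: sX'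
  |apply: (free_fam_le fX' (X' := X)) => j; apply: sX].
Qed.

Definition lin_closed (P : V -> Prop) : Prop :=
  P 0 /\ forall a u v, P u -> P v -> P (a *: u + v).

Lemma free_fam_basis (P : V -> Prop) m (X : 'I_m -> V) :
  (forall j, P (X j)) -> free_fam X ->
  (forall X' : 'I_m.+1 -> V, (forall j, P (X' j)) -> ~ free_fam X') ->
  basis_fam P X.
Proof.
move=> PX fX max; split=> // y Py.
pose X' (i : 'I_m.+1) := if unlift ord0 i is Some j then X j else y.
have : ~ free_fam X'.
  by apply: max => j; rewrite /X'; case: unliftP.
move/existsNP => [c /not_implyP [cS /existsNP [i ci]]].
move: cS; rewrite big_ord_recl {1}/X' unlift_none.
under eq_bigr do rewrite /X' liftK.
have [c0|c0] := eqVneq (c ord0) 0.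
  rewrite c0 scale0r add0r => /fX cX; case: ci.
  by case: (unliftP ord0 i) => [j|] ->.
move=> /eqP; rewrite addr_eq0 => /eqP H.
exists (fun j => - (c ord0)^-1 * c (lift ord0 j)).
rewrite -[y]scale1r -(mulVf c0) -scalerA H scalerN -scaleNr scaler_sumr.
by apply: eq_bigr => j _; rewrite scalerA.
Qed.

Lemma lin_closed_basis (P : V -> Prop) (J : finType) (X0 : J -> V) :
  (forall y, P y -> spanned_by X0 y) ->
  exists m, exists X : 'I_m -> V, basis_fam P X.
Proof.
move=> s0.
pose Q m := `[< exists X : 'I_m -> V, (forall j, P (X j)) /\ free_fam X >].
have exQ : exists m, Q m.
  exists 0%N; apply/asboolP; exists (fun=> 0).
  by split => [|c _] [].
have bQ m : Q m -> (m <= #|J|)%N.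
  move=> /asboolP [X [PX fX]]; rewrite -[m]card_ord.
  by apply: (free_fam_le fX (X' := X0)) => j; apply: s0.
case: (ex_maxnP exQ bQ) => m /asboolP [X [PX fX]] max.
exists m, X; apply: free_fam_basis => // X' PX' fX'.
suff : (m.+1 <= m)%N by rewrite ltnn.
by apply: max; apply/asboolP; exists X'.
Qed.

End Families.

Lemma delta_basis (E : fieldType) k k' :
  basis_fam (fun _ : 'M[E]_(k, k') => True)
    (fun ij : 'I_k * 'I_k' => delta_mx ij.1 ij.2).
Proof.
have S (c : 'I_k * 'I_k' -> E) :
    \sum_ij c ij *: delta_mx ij.1 ij.2 = \matrix_(i, j) c (i, j).
  rewrite [RHS]matrix_sum_delta pair_bigA /=.
  by apply: eq_bigr => [[i j]] _; rewrite mxE.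
split=> // [y _|c].
  by exists (fun ij => y ij.1 ij.2); rewrite S; apply/matrixP => i j; rewrite mxE.
by rewrite S => /matrixP H [i j]; have := H i j; rewrite !mxE.
Qed.

Section FamExtension.

Variables (E E2 : fieldType) (psi : {rmorphism E -> E2}) (k k' m : nat).

(** Freeness is a condition on the rank of the matrix of entries, and ranks are unchanged by field
    extension. *)
Lemma free_fam_map (X : 'I_m -> 'M[E]_(k, k')) :
  free_fam X -> free_fam (fun j => map_mx psi (X j)).
Proof.
move=> fX; pose M := \matrix_j mxvec (X j).
have rM : row_free M.
  rewrite -kermx_eq0; apply/rowV0P => v /sub_kermxP vM.
  apply/rowP => j; rewrite mxE; apply: (fX (fun j => v 0 j)).
  apply: (can_inj mxvecK); rewrite linear0 -vM linear_sum /=.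
  by rewrite mulmx_sum_row; apply: eq_bigr => i _; rewrite linearZ rowK.
have rM' : row_free (map_mx psi M) by rewrite row_free_map.
move=> c cS j.
pose v := \row_j c j.
have : v *m map_mx psi M = 0.
  rewrite mulmx_sum_row; transitivity (mxvec (\sum_j c j *: map_mx psi (X j))).
    rewrite linear_sum /=; apply: eq_bigr => i _.
    rewrite linearZ -map_row rowK mxE /=; congr (_ *: _).
    by rewrite map_mxvec.
  by rewrite cS linear0.
rewrite -[RHS](mul0mx _ (map_mx psi M)) => /(row_free_inj rM') /rowP/(_ j).
by rewrite !mxE.
Qed.

End FamExtension.

Record is_rep (K E : fieldType) (phi : {rmorphism K -> E}) (A : falgType K)
    k (r : A -> 'M[E]_k) : Prop := IsRep {
  repD : {morph r : x y / x + y >-> x + y};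
  repZ : forall c x, r (c *: x) = phi c *: r x;
  rep1 : r 1 = 1%:M;
  repM : forall x y, r (x * y) = r x *m r y
}.

(* A representation of the q-th tensor power of A, given by the commuting
   actions of the q tensor factors. *)
Record is_qrep (K E : fieldType) (phi : {rmorphism K -> E}) (A : falgType K)
    q k (R : 'I_q -> A -> 'M[E]_k) : Prop := IsQrep {
  qrep_rep : forall a, is_rep phi (R a);
  qrep_comm : forall a b x y, a != b -> R a x *m R b y = R b y *m R a x
}.

(** Only the tensor factors of index below [j] are taken into account, so that the conditions can be
    imposed one factor at a time. *)
Definition intertwines (E : fieldType) (A : Type) q k k'
    (R : 'I_q -> A -> 'M[E]_k) (R' : 'I_q -> A -> 'M[E]_k') j
    (Y : 'M[E]_(k, k')) : Prop :=
  forall a : 'I_q, (a < j)%N -> forall x, R a x *m Y = Y *m R' a x.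

Section RepTheory.

Variables (K E : fieldType) (phi : {rmorphism K -> E}) (A : falgType K).

Lemma rep0 k (r : A -> 'M[E]_k) : is_rep phi r -> r 0 = 0.
Proof. by move=> rr; rewrite -(scale0r 0) (repZ rr) rmorph0 scale0r. Qed.

Lemma rep_sum k (r : A -> 'M[E]_k) (I : Type) (s : seq I) (P : pred I) F :
  is_rep phi r -> r (\sum_(i <- s | P i) F i) = \sum_(i <- s | P i) r (F i).
Proof.
by move=> rr; apply: (big_morph r); [exact: (repD rr)|exact: (rep0 rr)].
Qed.

Lemma repB k (r : A -> 'M[E]_k) x y : is_rep phi r -> r (x - y) = r x - r y.
Proof.
by move=> rr; rewrite (repD rr) -scaleN1r (repZ rr) rmorphN1 scaleN1r.
Qed.

Section SandwichMx.

Variables (k k' : nat) (r : A -> 'M[E]_k) (r' : A -> 'M[E]_k').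

Definition sandwich_mx (l : seq (A * A)) (Y : 'M[E]_(k, k')) :=
  \sum_(p <- l) r p.1 *m Y *m r' p.2.

Hypotheses (rr : is_rep phi r) (rr' : is_rep phi r') (csA : central_simple A).

(** By [sandwich_inj] a list acting as zero on [A] is the zero tensor, so it acts as zero on every
    bimodule. Identities between sandwich operators on [A] thereby transfer to matrices. *)
Lemma sandwich_mx_eq0 l : sandwich l =1 (fun=> 0) ->
  forall Y, sandwich_mx l Y = 0.
Proof.
move=> l0 Y; pose y c := \sum_(p <- l) crd c p.2 *: p.1.
have y0 c : y c = 0.
  apply: (sandwich_inj csA) c => x; rewrite -[RHS](l0 x) /sandwich /y.
  under eq_bigr do rewrite !mulr_suml.
  rewrite exchange_big /=; apply: eq_bigr => p _.
  rewrite [p.2 in RHS]crd_sum mulr_sumr; apply: eq_bigr => c _.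
  by rewrite -scalerAr -!scalerAl.
transitivity (\sum_c r (y c) *m Y *m r' (bas c)); last first.
  by rewrite big1 // => c _; rewrite y0 (rep0 rr) !mul0mx.
under eq_bigr do rewrite /y (rep_sum _ _ _ rr) !mulmx_suml.
rewrite exchange_big /=; apply: eq_bigr => p _.
rewrite [p.2 in LHS]crd_sum (rep_sum _ _ _ rr') mulmx_sumr.
by apply: eq_bigr => c _; rewrite (repZ rr) (repZ rr') -scalemxAr -!scalemxAl.
Qed.

Lemma sandwich_mx_cat l1 l2 Y :
  sandwich_mx (l1 ++ l2) Y = sandwich_mx l1 Y + sandwich_mx l2 Y.
Proof. by rewrite /sandwich_mx big_cat. Qed.

Lemma sandwich_mx_lmul a l Y :
  sandwich_mx (lmul_pairs a l) Y = r a *m sandwich_mx l Y.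
Proof.
rewrite /sandwich_mx big_map mulmx_sumr.
by apply: eq_bigr => p _; rewrite (repM rr) !mulmxA.
Qed.

Lemma sandwich_mx_rmul a l Y :
  sandwich_mx (rmul_pairs l a) Y = sandwich_mx l Y *m r' a.
Proof.
rewrite /sandwich_mx big_map mulmx_suml.
by apply: eq_bigr => p _; rewrite (repM rr') !mulmxA.
Qed.

Lemma sandwich_mx_transfer l1 l2 : sandwich l1 =1 sandwich l2 ->
  forall Y, sandwich_mx l1 Y = sandwich_mx l2 Y.
Proof.
move=> l12 Y; apply/eqP; rewrite -subr_eq0; apply/eqP.
have := @sandwich_mx_eq0 (l1 ++ lmul_pairs (-1) l2) _ Y.
rewrite sandwich_mx_cat sandwich_mx_lmul => <-.
  by rewrite -[-1]sub0r (repB _ _ rr) (rep0 rr) sub0r (rep1 rr) mulNmx mul1mx.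
by move=> x; rewrite sandwich_cat sandwich_lmul l12 mulN1r subrr.
Qed.

Variable S : 'I_(\dim {:A}) -> seq (A * A).
Hypothesis HS : forall i x, sandwich (S i) x = crd i x *: 1.

(** The operator of [S i] has scalar values on [A], so left and right multiplication of its values
    agree; this identity transfers to matrices. *)
Lemma sandwich_mx_inter i x Y :
  r x *m sandwich_mx (S i) Y = sandwich_mx (S i) Y *m r' x.
Proof.
rewrite -sandwich_mx_lmul -sandwich_mx_rmul; apply: sandwich_mx_transfer => y.
by rewrite sandwich_lmul sandwich_rmul HS -scalerAr -scalerAl mulr1 mul1r.
Qed.

(** Transfer of the identity [x = \sum_i crd i x *: bas i] to matrices. *)
Lemma sandwich_mx_dec Y : Y = \sum_i r (bas i) *m sandwich_mx (S i) Y.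
Proof.
pose l := flatten [seq lmul_pairs (bas i) (S i) | i <- enum 'I_(\dim {:A})].
transitivity (sandwich_mx l Y); last first.
  rewrite /sandwich_mx big_flatten /= big_map big_enum.
  by apply: eq_bigr => i _; rewrite -sandwich_mx_lmul.
transitivity (sandwich_mx [:: (1, 1)] Y).
  by rewrite /sandwich_mx big_seq1 (rep1 rr) (rep1 rr') mul1mx mulmx1.
apply: sandwich_mx_transfer => x.
rewrite [LHS]/sandwich big_seq1 mulr1 mul1r.
rewrite /sandwich big_flatten /= big_map big_enum [LHS]crd_sum.
apply: eq_bigr => i _; rewrite [RHS]/=.
rewrite -[RHS]/(sandwich (lmul_pairs (bas i) (S i)) x) sandwich_lmul HS.
by rewrite -scalerAr mulr1.
Qed.

Lemma sandwich_mx_coef i a Z : (forall x, r x *m Z = Z *m r' x) ->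
  sandwich_mx (S i) (r a *m Z) = phi (crd i a) *: Z.
Proof.
move=> HZ; rewrite -[RHS]mul1mx -scalemxAr scalemxAl -(rep1 rr) -(repZ rr) -HS.
rewrite /sandwich_mx (rep_sum _ _ _ rr) mulmx_suml; apply: eq_bigr => p _.
by rewrite !(repM rr) -!mulmxA HZ.
Qed.

Lemma sandwich_mx_comm l T T' Y : (forall x, T *m r x = r x *m T) ->
    (forall x, T' *m r' x = r' x *m T') -> T *m Y = Y *m T' ->
  T *m sandwich_mx l Y = sandwich_mx l Y *m T'.
Proof.
move=> HT HT' TY; rewrite /sandwich_mx mulmx_sumr mulmx_suml.
apply: eq_bigr => p _.
by rewrite !mulmxA HT -!mulmxA -HT' (mulmxA T) TY -!mulmxA.
Qed.

End SandwichMx.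

Section QRep.

Variables (q k k' : nat) (R : 'I_q -> A -> 'M[E]_k) (R' : 'I_q -> A -> 'M[E]_k').
Hypotheses (csA : central_simple A) (qR : is_qrep phi R) (qR' : is_qrep phi R').

Lemma intertwinesS (j : 'I_q) Y : intertwines R R' j.+1 Y <->
  intertwines R R' j Y /\ forall x, R j x *m Y = Y *m R' j x.
Proof.
split=> [H|[H Hj] a]; first by split=> [a aj|]; apply: H => //; apply: ltnW.
rewrite ltnS leq_eqVlt => /orP [/eqP/val_inj -> //|]; exact: H.
Qed.

Lemma sandwich_mx_intertwines (j : 'I_q) l Y : intertwines R R' j Y ->
  intertwines R R' j (sandwich_mx (R j) (R' j) l Y).
Proof.
move=> HY a aj x; apply: sandwich_mx_comm => [y|y|]; last exact: HY.
  by apply: (qrep_comm qR); rewrite -val_eqE /= ltn_eqF.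
by apply: (qrep_comm qR'); rewrite -val_eqE /= ltn_eqF.
Qed.

(** If all components [sandwich_mx (R a) (R' a) (S i) Y] vanished, [sandwich_mx_dec] would give
    [Y = 0]. The factors already treated are undisturbed, since distinct factors commute. *)
Lemma intertwines_neq0 j : (j <= q)%N -> (0 < k)%N -> (0 < k')%N ->
  exists2 Y, Y != 0 & intertwines R R' j Y.
Proof.
move=> jq k0 k'0; elim: j jq => [_|j IH jq].
  exists (const_mx 1) => //; apply/eqP => /matrixP/(_ (Ordinal k0) (Ordinal k'0)).
  by rewrite !mxE => /eqP; rewrite oner_eq0.
have [Y Y0 HY] := IH (ltnW jq); pose a := Ordinal jq.
have /choice [S HS] : forall i, exists l, forall x : A, sandwich l x = crd i x *: 1.
  exact: sandwich_crd.
have rr := qrep_rep qR a; have rr' := qrep_rep qR' a.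
have : exists i, sandwich_mx (R a) (R' a) (S i) Y != 0.
  apply/not_existsP => H; case/eqP: Y0.
  rewrite (sandwich_mx_dec rr rr' csA HS Y) big1 // => i _.
  by have /negP := H i; rewrite negbK => /eqP ->; rewrite mulmx0.
move=> [i Hi]; exists (sandwich_mx (R a) (R' a) (S i) Y) => //.
apply/(intertwinesS a); split; first exact: sandwich_mx_intertwines.
by move=> x; apply: (sandwich_mx_inter rr rr' csA HS).
Qed.

(** A matrix commuting with the first [j] factors decomposes uniquely as a sum of products
    [R j (bas i) *m Z_i], where each [Z_i] commutes with factor [j] as well. *)
Lemma intertwines_basis_step (j : 'I_q) (J : finType) (X : J -> 'M[E]_(k, k')) :
  basis_fam (intertwines R R' j.+1) X ->
  basis_fam (intertwines R R' j)
    (fun iu : 'I_(\dim {:A}) * J => R j (bas iu.1) *m X iu.2).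
Proof.
have /choice [S HS] : forall i, exists l, forall x : A, sandwich l x = crd i x *: 1.
  exact: sandwich_crd.
have rr := qrep_rep qR j; have rr' := qrep_rep qR' j.
move=> [PX sX fX]; split.
- move=> [i u] a aj x /=; have /(intertwinesS j) [Hu _] := PX u.
  rewrite mulmxA (qrep_comm qR) -?mulmxA ?Hu //.
  by rewrite -val_eqE /= ltn_eqF.
- move=> y Hy.
  have /choice [c Hc] : forall i, spanned_by X (sandwich_mx (R j) (R' j) (S i) y).
    move=> i; apply: sX; apply/intertwinesS; split.
      exact: sandwich_mx_intertwines.
    by move=> x; apply: (sandwich_mx_inter rr rr' csA HS).
  exists (fun iu => c iu.1 iu.2).
  rewrite [LHS](sandwich_mx_dec rr rr' csA HS).
  rewrite (eq_bigr (fun i => \sum_u c i u *: (R j (bas i) *m X u))).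
    by rewrite pair_bigA.
  by move=> i _; rewrite Hc mulmx_sumr; apply: eq_bigr => u _; rewrite -scalemxAr.
- move=> c cS [i u].
  apply: (fX (fun u => c (i, u))).
  have Hint (v : J -> E) x : R j x *m (\sum_u v u *: X u) = (\sum_u v u *: X u) *m R' j x.
    rewrite mulmx_sumr mulmx_suml; apply: eq_bigr => w _.
    by have /(intertwinesS j) [_ Hw] := PX w; rewrite -scalemxAr -scalemxAl Hw.
  have s0 : sandwich_mx (R j) (R' j) (S i) 0 = 0.
    by rewrite /sandwich_mx big1 // => p _; rewrite mulmx0 mul0mx.
  have {}s0 := etrans (congr1 (sandwich_mx (R j) (R' j) (S i)) cS) s0.
  rewrite -[RHS]s0.
  transitivity (\sum_l sandwich_mx (R j) (R' j) (S i)
      (R j (bas l) *m (\sum_w c (l, w) *: X w))).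
    rewrite (bigD1 i) //= (sandwich_mx_coef rr HS) ?crd_bas ?eqxx ?rmorph1 ?scale1r //.
    rewrite [X in _ + X]big1 ?addr0 // => l li.
    by rewrite (sandwich_mx_coef rr HS) // crd_bas eq_sym (negbTE li) rmorph0 scale0r.
  rewrite /sandwich_mx exchange_big /=; apply: eq_bigr => p _.
  rewrite -mulmx_suml -mulmx_sumr; congr (_ *m _ *m _).
  rewrite (eq_bigr (fun l => \sum_w c (l, w) *: (R j (bas l) *m X w))).
    by rewrite pair_bigA; apply: eq_bigr => [[? ?]] _.
  by move=> l _; rewrite mulmx_sumr; apply: eq_bigr => w _; rewrite -scalemxAr.
Qed.

(** Starting from all [k * k'] dimensions of the matrix space, each of the [q] factors divides the
    dimension by that of [A]. The dimension of a space of intertwiners is thus known from [k] and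
    [k'] alone, over every field. *)
Lemma intertwines_dim (J : finType) (X : J -> 'M[E]_(k, k')) :
  basis_fam (intertwines R R' q) X -> ((\dim {:A}) ^ q * #|J| = k * k')%N.
Proof.
suff H : forall j, (j <= q)%N ->
    forall (J : finType) (X : J -> 'M[E]_(k, k')), basis_fam (intertwines R R' j) X ->
    ((\dim {:A}) ^ j * #|J| = k * k')%N by apply: H.
elim=> [_|j IH jq] {}J {}X HX.
  rewrite expn0 mul1n.
  have HX' : basis_fam (fun _ => True) X.
    by case: HX => _ sX fX; split=> // y _; apply: sX.
  by rewrite (basis_fam_card HX' (delta_basis E k k')) card_prod !card_ord.
have := intertwines_basis_step (j := Ordinal jq) HX.
by move/(IH (ltnW jq)); rewrite card_prod card_ord expnSr mulnA.
Qed.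

Lemma intertwines_basis :
  exists m (X : 'I_m -> 'M[E]_(k, k')), basis_fam (intertwines R R' q) X.
Proof.
apply: lin_closed_basis => y _; have [_ sX _] := delta_basis E k k'; exact: sX.
Qed.

End QRep.

End RepTheory.

Lemma rep_qrep1 (K E : fieldType) (phi : {rmorphism K -> E}) (B : falgType K) k
  (r : B -> 'M[E]_k) : is_rep phi r -> is_qrep phi (fun _ : 'I_1 => r).
Proof. by move=> rr; split=> // a b x y; rewrite (ord1 a) (ord1 b) eqxx. Qed.

Lemma dim_alg_gt0 (K : fieldType) (A : falgType K) : (0 < \dim {:A})%N.
Proof.
rewrite lt0n dimv_eq0; apply/eqP => H.
by have := memvf (1 : A); rewrite H memv0 oner_eq0.
Qed.

Section RepMap.

Variables (K E E2 : fieldType) (phi : {rmorphism K -> E}).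
Variables (psi : {rmorphism E -> E2}) (phi2 : {rmorphism K -> E2}).
Variable (A : falgType K).
Hypothesis phi2E : forall x, phi2 x = psi (phi x).

Lemma is_rep_map k (r : A -> 'M[E]_k) : is_rep phi r ->
  is_rep phi2 (fun x => map_mx psi (r x)).
Proof.
move=> rr; split=> [x y|c x||x y].
- by rewrite (repD rr) map_mxD.
- by rewrite (repZ rr) map_mxZ phi2E.
- by rewrite (rep1 rr) map_mx1.
- by rewrite (repM rr) map_mxM.
Qed.

Lemma is_qrep_map q k (R : 'I_q -> A -> 'M[E]_k) : is_qrep phi R ->
  is_qrep phi2 (fun a x => map_mx psi (R a x)).
Proof.
move=> qR; split=> [a|a b x y ab]; first exact: is_rep_map (qrep_rep qR a).
by rewrite -!map_mxM (qrep_comm qR).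
Qed.

Lemma intertwines_map q k k' (R : 'I_q -> A -> 'M[E]_k)
    (R' : 'I_q -> A -> 'M[E]_k') Y : intertwines R R' q Y ->
  intertwines (fun a x => map_mx psi (R a x)) (fun a x => map_mx psi (R' a x)) q
    (map_mx psi Y).
Proof. by move=> HY a aj x; rewrite -!map_mxM HY. Qed.

(* Both sides have the dimension prescribed by intertwines_dim. *)
Lemma intertwines_basis_map q k k' m (R : 'I_q -> A -> 'M[E]_k)
    (R' : 'I_q -> A -> 'M[E]_k') (X : 'I_m -> 'M[E]_(k, k')) :
  central_simple A -> is_qrep phi R -> is_qrep phi R' ->
  basis_fam (intertwines R R' q) X ->
  basis_fam (intertwines (fun a x => map_mx psi (R a x))
     (fun a x => map_mx psi (R' a x)) q) (fun j => map_mx psi (X j)).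
Proof.
move=> csA qR qR' bX; have [PX sX fX] := bX.
have qR2 := is_qrep_map qR; have qR2' := is_qrep_map qR'.
have [m' [X' bX']] := intertwines_basis
  (fun a x => map_mx psi (R a x)) (fun a x => map_mx psi (R' a x)).
have d := intertwines_dim csA qR qR' bX.
have d' := intertwines_dim csA qR2 qR2' bX'.
have dA : (0 < \dim {:A} ^ q)%N.
  by rewrite expn_gt0 dim_alg_gt0.
have mm : m' = m.
  by apply/eqP; rewrite -(eqn_pmul2l dA) -{1}[m']card_ord d' -d card_ord.
subst m'; apply: free_fam_basis => [j||X2 PX2 fX2].
- exact: intertwines_map (PX j).
- exact: free_fam_map.
have [_ sX' _] := bX'.
have := free_fam_le fX2 (fun j => sX' _ (PX2 j)).
by rewrite !card_ord ltnn.
Qed.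

End RepMap.

(** * Submodules, quotients and divisibility of dimensions *)

Section SubQuotient.

Variables (K E : fieldType) (phi : {rmorphism K -> E}) (A : falgType K).
Variable q : nat.

Lemma subrep k r (R : 'I_q -> A -> 'M[E]_k) (B : 'M[E]_(r, k))
    (T : 'I_q -> A -> 'M[E]_r) : is_qrep phi R -> row_free B ->
  (forall a x, B *m R a x = T a x *m B) -> is_qrep phi T.
Proof.
move=> qR fB HB; split=> [a|a b x y ab].
  have rr := qrep_rep qR a; split=> [x y|c x||x y]; apply: (row_free_inj fB).
  - by rewrite -HB (repD rr) mulmxDr !HB mulmxDl.
  - by rewrite -HB (repZ rr) -scalemxAr HB scalemxAl.
  - by rewrite -HB (rep1 rr) mulmx1 mul1mx.
  - by rewrite -HB (repM rr) mulmxA HB -!mulmxA HB.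
apply: (row_free_inj fB).
by rewrite -!mulmxA -!HB !mulmxA -!HB -!mulmxA (qrep_comm qR).
Qed.

Lemma subrep_exists k r (R : 'I_q -> A -> 'M[E]_k) (B : 'M[E]_(r, k)) :
  is_qrep phi R -> row_free B -> (forall a x, (B *m R a x <= B)%MS) ->
  exists T : 'I_q -> A -> 'M[E]_r, is_qrep phi T.
Proof.
move=> qR fB HB; exists (fun a x => B *m R a x *m pinvmx B).
by apply: (subrep qR fB) => a x; rewrite mulmxKpV.
Qed.

Lemma quorep k r (R : 'I_q -> A -> 'M[E]_k) (C : 'M[E]_(k, r))
    (T : 'I_q -> A -> 'M[E]_r) : is_qrep phi R -> row_free C^T ->
  (forall a x, R a x *m C = C *m T a x) -> is_qrep phi T.
Proof.
move=> qR fC HC.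
have injC s (X Y : 'M[E]_(r, s)) : C *m X = C *m Y -> X = Y.
  move=> /(congr1 trmx); rewrite !trmx_mul => /(row_free_inj fC).
  exact: trmx_inj.
split=> [a|a b x y ab].
  have rr := qrep_rep qR a; split=> [x y|c x||x y]; apply: injC.
  - by rewrite -HC (repD rr) mulmxDl !HC mulmxDr.
  - by rewrite -HC (repZ rr) -scalemxAl HC scalemxAr.
  - by rewrite -HC (rep1 rr) mulmx1 mul1mx.
  - by rewrite -HC (repM rr) -mulmxA HC !mulmxA HC.
apply: injC.
by rewrite !mulmxA -!HC -!mulmxA -!HC !mulmxA (qrep_comm qR).
Qed.

Lemma kernel_rep k k' (R : 'I_q -> A -> 'M[E]_k) (R' : 'I_q -> A -> 'M[E]_k') Y :
  is_qrep phi R -> intertwines R R' q Y ->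
  exists T : 'I_q -> A -> 'M[E]_(k - \rank Y), is_qrep phi T.
Proof.
move=> qR HY; rewrite -mxrank_ker.
apply: (subrep_exists qR (row_base_free (kermx Y))) => a x.
rewrite !eq_row_base (submx_trans (submxMr _ (_ : _ <= kermx Y)%MS)) ?eq_row_base //.
by apply/sub_kermxP; rewrite -mulmxA HY // mulmxA mulmx_ker mul0mx.
Qed.

Lemma coker_rep k k' (R : 'I_q -> A -> 'M[E]_k) (R' : 'I_q -> A -> 'M[E]_k') Y :
  is_qrep phi R' -> intertwines R R' q Y ->
  exists T : 'I_q -> A -> 'M[E]_(k' - \rank Y), is_qrep phi T.
Proof.
move=> qR' HY; rewrite -mxrank_tr -mxrank_ker.
pose B := row_base (kermx Y^T).
have fB : row_free (B^T)^T by rewrite trmxK row_base_free.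
exists (fun a x => (B *m (R' a x)^T *m pinvmx B)^T).
apply: (quorep qR' fB) => a x.
apply: trmx_inj; rewrite !trmx_mul !trmxK mulmxKpV //.
rewrite !eq_row_base (submx_trans (submxMr _ (_ : _ <= kermx Y^T)%MS)) ?eq_row_base //.
apply/sub_kermxP; rewrite -mulmxA -trmx_mul -HY // trmx_mul mulmxA.
by rewrite mulmx_ker mul0mx.
Qed.

Hypothesis csA : central_simple A.

(** A nonzero intertwiner from a module of least dimension is injective, its kernel being a smaller
    module; its cokernel has dimension [k - k0], and induction applies. *)
Lemma min_rep_dvd k0 (R0 : 'I_q -> A -> 'M[E]_k0) : (0 < k0)%N ->
  is_qrep phi R0 ->
  (forall k (R : 'I_q -> A -> 'M[E]_k), (0 < k)%N -> is_qrep phi R -> (k0 <= k)%N) ->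
  forall k (R : 'I_q -> A -> 'M[E]_k), is_qrep phi R -> (k0 %| k)%N.
Proof.
move=> k0_gt0 qR0 min k; have [n] := ubnP k; elim: n k => // n IH k kn R qR.
have [->|k_gt0] := posnP k; first exact: dvdn0.
have [Y Y0 HY] := intertwines_neq0 csA qR0 qR (leqnn q) k0_gt0 k_gt0.
have rY : \rank Y = k0.
  apply/eqP; rewrite eqn_leq rank_leq_row leqNgt; apply/negP => lt.
  have [T qT] := kernel_rep qR0 HY.
  have := min _ T; rewrite subn_gt0 => /(_ lt qT).
  by rewrite leqNgt ltn_subrL k0_gt0 lt0n mxrank_eq0 Y0.
have [T qT] : exists T : 'I_q -> A -> 'M[E]_(k - k0), is_qrep phi T.
  by rewrite -rY; apply: coker_rep qR HY.
have k0k : (k0 <= k)%N by apply: min qR.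
have lt : (k - k0 < n)%N.
  by apply: leq_trans (_ : (k <= n)%N); rewrite ?ltn_subrL ?k0_gt0 ?k_gt0 // -ltnS.
by have := IH _ lt T qT; rewrite -{2}(subnK k0k) dvdn_addl.
Qed.

Variable n : nat.
Hypothesis dA : has_degree A n.

(** The space of endomorphisms has a dimension [m] with [(n ^ q) ^ 2 * m = k ^ 2]. *)
Lemma rep_dim_dvd k (R : 'I_q -> A -> 'M[E]_k) : is_qrep phi R -> (n ^ q %| k)%N.
Proof.
move=> qR; have [m [X bX]] := intertwines_basis R R.
have := intertwines_dim csA qR qR bX; rewrite dA card_ord => H.
rewrite -(@dvdn_pexp2r _ _ 2) // -expnM mulnC expnM.
by rewrite -[(k ^ 2)%N]mulnn -H dvdn_mulr.
Qed.

(** The kernel is a module of dimension less than [n ^ q], hence zero by [rep_dim_dvd]. *)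
Lemma intertwines_row_free k (V : 'I_q -> A -> 'M[E]_(n ^ q))
    (R : 'I_q -> A -> 'M[E]_k) Y : is_qrep phi V -> intertwines V R q Y ->
  Y != 0 -> row_free Y.
Proof.
move=> qV HY Y0; have [T qT] := kernel_rep qV HY.
have := rep_dim_dvd qT; have [r0|/dvdn_leq H /H] := posnP (n ^ q - \rank Y).
  move=> _; rewrite /row_free eqn_leq rank_leq_row /=.
  by move/eqP: r0; rewrite subn_eq0.
rewrite leqNgt ltn_subrL lt0n mxrank_eq0 Y0 /= -eqn0Ngt => /eqP N0.
have : (\rank Y <= 0)%N by apply: leq_trans (rank_leq_row Y) _; rewrite N0.
by rewrite leqn0 mxrank_eq0 (negbTE Y0).
Qed.

End SubQuotient.

(** * Generated subfields and transcendence bases *)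

Section GeneratedSubfield.

Variables (F : fieldType) (S : F -> Prop).

(** The subfield generated by [S]; division is total, with [x / 0 = 0]. *)
Inductive genfield : F -> Prop :=
| genfield_mem x : S x -> genfield x
| genfield1 : genfield 1
| genfieldB x y : genfield x -> genfield y -> genfield (x - y)
| genfield_div x y : genfield x -> genfield y -> genfield (x / y).

Definition genfield_pred : {pred F} := fun x => `[< genfield x >].

Lemma genfieldP x : reflect (genfield x) (x \in genfield_pred).
Proof. exact: asboolP. Qed.

Fact genfield_divring_closed : divring_closed genfield_pred.
Proof.
split=> [|x y /genfieldP Hx /genfieldP Hy|x y /genfieldP Hx /genfieldP Hy].
- exact/genfieldP/genfield1.
- exact/genfieldP/genfieldB.
- exact/genfieldP/genfield_div.
Qed.

HB.instance Definition _ :=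
  GRing.isDivringClosed.Build F genfield_pred genfield_divring_closed.

Record gfield := GField { gval : F; gvalP : gval \in genfield_pred }.

HB.instance Definition _ := [isSub for gval].
HB.instance Definition _ := [Choice of gfield by <:].
HB.instance Definition _ := [SubChoice_isSubIntegralDomain of gfield by <:].
HB.instance Definition _ := [SubIntegralDomain_isSubField of gfield by <:].

Fact gval_zmod_morphism : zmod_morphism gval.
Proof. by []. Qed.

Fact gval_monoid_morphism : monoid_morphism gval.
Proof. by []. Qed.

HB.instance Definition _ :=
  GRing.isZmodMorphism.Build gfield F gval gval_zmod_morphism.
HB.instance Definition _ :=
  GRing.isMonoidMorphism.Build gfield F gval gval_monoid_morphism.

End GeneratedSubfield.

Section Corestriction.

Variables (L F : fieldType) (i : {rmorphism L -> F}) (S : F -> Prop).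
Hypothesis iS : forall x, genfield S (i x).

Definition corestrict (x : L) : gfield S := GField (introT (genfieldP S (i x)) (iS x)).

Fact corestrict_zmod_morphism : zmod_morphism corestrict.
Proof. by move=> x y; apply: val_inj; rewrite /= rmorphB. Qed.

Fact corestrict_monoid_morphism : monoid_morphism corestrict.
Proof. by split=> [|x y]; apply: val_inj; rewrite /= ?rmorph1 ?rmorphM. Qed.

HB.instance Definition _ :=
  GRing.isZmodMorphism.Build L (gfield S) corestrict corestrict_zmod_morphism.
HB.instance Definition _ :=
  GRing.isMonoidMorphism.Build L (gfield S) corestrict corestrict_monoid_morphism.

End Corestriction.

(** * Algebraic dependence and Steinitz exchange *)

Section AlgebraicClosure.

Variable F : fieldType.
Implicit Types (S T : F -> Prop) (x y z : F).

(** Algebraicity over the subfield generated by [S], with [S] an arbitrary subset so that generators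
    can be added and exchanged. *)
Definition acl S : F -> Prop := algebraicOver (@gval F S).

Definition adjoin S y : F -> Prop := fun z => S z \/ z = y.

Definition adjoin_seq S (ys : seq F) : F -> Prop := fun z => S z \/ z \in ys.

Lemma genfield_acl S x : genfield S x -> acl S x.
Proof.
move=> /genfieldP Hx; exact: (algebraic_id (@gval F S) (GField Hx)).
Qed.

Lemma acl_mem S x : S x -> acl S x.
Proof. by move=> Sx; apply/genfield_acl/genfield_mem. Qed.

Lemma genfield_sub_acl S T x :
  (forall z, T z -> acl S z) -> genfield T x -> acl S x.
Proof.
move=> TS; elim=> {x} [x /TS//||x y _ Hx _ Hy|x y _ Hx _ Hy].
- exact/genfield_acl/genfield1.
- exact: algebraic_sub.
- exact: algebraic_div.
Qed.

Lemma acl_root S (p : {poly F}) y : p != 0 -> (forall i, acl S p`_i) ->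
  root p y -> acl S y.
Proof.
move=> p0 pS py; apply/integral_algebraic; apply: integral_root p0 py _.
by move=> _ /(nthP 0) [i _ <-]; apply/integral_algebraic/pS.
Qed.

Lemma acl_trans S T y : (forall z, T z -> acl S z) -> acl T y -> acl S y.
Proof.
move=> TS [p p0 py]; apply: acl_root py; first by rewrite map_poly_eq0.
by move=> i; rewrite coef_map /=; apply: genfield_sub_acl TS _; apply/genfieldP/gvalP.
Qed.

Lemma genfield_sub S T x : (forall z, S z -> genfield T z) ->
  genfield S x -> genfield T x.
Proof.
move=> ST; elim=> {x} [x /ST//||x y _ Hx _ Hy|x y _ Hx _ Hy].
- exact: genfield1.
- exact: genfieldB.
- exact: genfield_div.
Qed.

Lemma acl_sub S T y : (forall z, T z -> S z) -> acl T y -> acl S y.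
Proof. by move=> TS; apply: acl_trans => z /TS; apply: acl_mem. Qed.

Lemma genfield_frac S x z : genfield (adjoin S x) z ->
  exists a b, [/\ a \is a polyOver (genfield_pred S),
    b \is a polyOver (genfield_pred S), b.[x] != 0 & z = a.[x] / b.[x]].
Proof.
elim=> {z} [z [Sz|->]||z w _ [a [b [Ha Hb b0 ->]]] _ [c [d [Hc Hd d0 ->]]]
  |z w _ [a [b [Ha Hb b0 ->]]] _ [c [d [Hc Hd d0 ->]]]].
- exists z%:P, 1; split; rewrite ?rpred1 ?hornerE ?oner_eq0 ?divr1 //.
  by rewrite polyOverC; apply/genfieldP/genfield_mem.
- by exists 'X, 1; split; rewrite ?polyOverX ?rpred1 ?hornerE ?oner_eq0 ?divr1.
- by exists 1, 1; split; rewrite ?rpred1 ?hornerE ?oner_eq0 ?invr1.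
- exists (a * d - c * b), (b * d); split.
  + by rewrite rpredB ?rpredM.
  + by rewrite rpredM.
  + by rewrite hornerM mulf_neq0.
  + by rewrite -mulNr addf_div // hornerD hornerN !hornerM mulNr.
- have [c0|c0] := eqVneq c.[x] 0.
    exists 0, 1; split; rewrite ?rpred0 ?rpred1 ?hornerE ?oner_eq0 //.
    by rewrite c0 mul0r invr0 mulr0.
  exists (a * d), (b * c); split; rewrite ?rpredM ?hornerM ?mulf_neq0 //.
  by rewrite invf_div mulf_div.
Qed.

Lemma genfield_common_denom S x (p : {poly F}) :
  (forall i, genfield (adjoin S x) p`_i) ->
  exists (P : {poly {poly F}}) (C : {poly F}),
   [/\ forall i, P`_i \is a polyOver (genfield_pred S),
       C \is a polyOver (genfield_pred S), C.[x] != 0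
     & forall i, (P`_i).[x] = C.[x] * p`_i].
Proof.
elim/poly_ind: p => [|p c IH] H.
  exists 0, 1; split; rewrite ?rpred1 ?hornerE ?oner_eq0 //.
    by move=> i; rewrite coef0 rpred0.
  by move=> i; rewrite !coef0 horner0 mulr0.
have Hp i : genfield (adjoin S x) p`_i.
  by have := H i.+1; rewrite coefD coefMX coefC addr0.
have {IH} [P [C [HP HC C0 E]]] := IH Hp.
have := H 0%N; rewrite coefD coefMX coefC add0r /=.
move=> /genfield_frac [a [b [Ha Hb b0 ce]]].
exists (P * b%:P * 'X + (C * a)%:P), (C * b); split.
- by case=> [|i]; rewrite coefD coefMX coefC /= ?add0r ?addr0 ?coefMC rpredM.
- by rewrite rpredM.
- by rewrite hornerM mulf_neq0.
case=> [|i]; rewrite !coefD !coefMX !coefC /= ?add0r ?addr0.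
  by rewrite !hornerM ce -mulrA; congr (_ * _); rewrite mulrCA divff // mulr1.
by rewrite coefMC !hornerM E mulrAC.
Qed.

Lemma acl_polyOver S (p : {poly F}) y : p != 0 ->
  p \is a polyOver (genfield_pred S) -> root p y -> acl S y.
Proof.
move=> p0 /polyOverP pS; apply: acl_root => // i.
exact/genfield_acl/genfieldP.
Qed.

(** After clearing denominators, the equation of [y] over [S(x)] is a bivariate relation over [S],
    which is then read as an equation of [x] over [S(y)]. It remains nontrivial: otherwise the
    leading coefficient of [swapXY P] would be an equation of [y] over [S]. *)
Lemma acl_exchange S x y : acl (adjoin S x) y -> ~ acl S y -> acl (adjoin S y) x.
Proof.
move=> [p p0 py] yS.
have [i|P [C [HP HC C0 E]]] := @genfield_common_denom S x (map_poly (@gval F _) p).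
  by rewrite coef_map; apply/genfieldP/gvalP.
pose Q := map_poly (horner_eval y) (swapXY P).
have QE i : Q`_i = ((swapXY P)`_i).[y] by rewrite coef_map_id0 //= /horner_eval horner0.
have HQi i : (swapXY P)`_i \is a polyOver (genfield_pred S).
  by apply/polyOverP => j; rewrite coef_swapXY; apply/polyOverP.
apply: (@acl_polyOver _ Q).
- have P0 : swapXY P != 0.
    rewrite swapXY_eq0; apply: contraNneq p0 => P0.
    apply/eqP/polyP => i; apply: (fmorph_inj (@gval F _)).
    have := E i; rewrite P0 coef0 horner0 coef_map => /esym/eqP.
    by rewrite mulf_eq0 (negbTE C0) /= => /eqP ->; rewrite coef0 rmorph0.
  apply: contra_notN yS => /eqP Q0.
  apply: (@acl_polyOver _ (lead_coef (swapXY P))); rewrite ?lead_coef_eq0 //.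
    exact: HQi.
  by rewrite /root lead_coefE -QE Q0 coef0.
- apply/polyOverP => i; rewrite QE; apply: rpred_horner.
    apply: polyOverS (HQi i) => z /genfieldP Hz; apply/genfieldP.
    by apply: genfield_sub Hz => w Sw; apply: genfield_mem; left.
  by apply/genfieldP/genfield_mem; right.
- have -> : Q = P.[y%:P] by rewrite /Q -horner_swapXY swapXYK.
  have sz : (size P <= maxn (size P) (size p))%N by rewrite leq_maxl.
  have sp : (size (map_poly (@gval F _) p) <= maxn (size P) (size p))%N.
    by rewrite size_map_poly leq_maxr.
  rewrite /root (horner_coef_wide _ sz) horner_sum.
  move/rootP: py; rewrite (horner_coef_wide _ sp) => py.
  apply/eqP; rewrite -[RHS](mulr0 C.[x]) -[X in _ * X]py mulr_sumr.
  by apply: eq_bigr => i _; rewrite hornerM E -rmorphXn hornerC mulrA.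
Qed.

End AlgebraicClosure.

Section AclMap.

Variables (F F' : fieldType) (b : {rmorphism F -> F'}).
Variables (S : F -> Prop) (T : F' -> Prop).

Lemma acl_map x : (forall z, S z -> acl T (b z)) -> acl S x -> acl T (b x).
Proof.
move=> ST [p p0 px]; apply: (@acl_root _ _ (map_poly b (map_poly (@gval F S) p))).
- by rewrite !map_poly_eq0.
- move=> i; rewrite !coef_map /=; have /genfieldP := gvalP p`_i.
  elim=> {x px} [x /ST//||x y _ Hx _ Hy|x y _ Hx _ Hy].
  + by rewrite rmorph1; apply/genfield_acl/genfield1.
  + by rewrite rmorphB; apply: algebraic_sub.
  + by rewrite fmorph_div; apply: algebraic_div.
- by rewrite fmorph_root.
Qed.

End AclMap.

Section Steinitz.

Variable F : fieldType.
Implicit Types (S T : F -> Prop) (x y z : F) (xs ys ws : seq F).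

Fixpoint independent S ys : Prop :=
  if ys is y :: ys' then ~ acl S y /\ independent (adjoin S y) ys' else True.

Lemma independent_sub S T ys : (forall z, T z -> acl S z) ->
  independent S ys -> independent T ys.
Proof.
elim: ys S T => //= y ys IH S T TS [Sy iS]; split.
  by move=> Ty; apply: Sy; apply: acl_trans TS Ty.
apply: IH iS => z [/TS Sz| ->]; last by apply: acl_mem; right.
by apply: acl_sub Sz => w Sw; left.
Qed.

(** The first [y] that becomes algebraic once [w] is adjoined is dropped. By exchange [w] is then
    algebraic over [S] and [y], so the elements after [y] stay independent. *)
Lemma independent_exchange S w ys : independent S ys ->
  exists ys', [/\ independent (adjoin S w) ys', {subset ys' <= ys} &
                  (size ys <= (size ys').+1)%N].
Proof.
elim: ys S => [|y ys IH] S /=; first by exists [::].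
move=> [Sy iS]; have [Ty|Ty] := pselect (acl (adjoin S w) y).
  exists ys; split=> //; last by move=> z; rewrite inE orbC => ->.
  apply: independent_sub iS => z [Sz|->]; first by apply: acl_mem; left.
  exact: acl_exchange Ty Sy.
have [ys' [iy sy szy]] := IH _ iS; exists (y :: ys'); split=> //=.
  split=> //; apply: independent_sub iy => z Hz; apply: acl_mem.
  by case: Hz => [[Sz|->]|->]; [left; left|right|left; right].
by move=> z; rewrite !inE => /orP [-> //|/sy ->]; rewrite orbT.
Qed.

Lemma steinitz ws S ys : independent S ys ->
  (forall y, y \in ys -> acl (adjoin_seq S ws) y) -> (size ys <= size ws)%N.
Proof.
elim: ws S ys => [|w ws IH] S ys iS cS.
  case: ys iS cS => //= y ys [Sy _] /(_ y (mem_head _ _)) H; case: Sy.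
  by apply: acl_sub H => z [].
have [ys' [iy sy szy]] := independent_exchange w iS.
apply: leq_trans szy _; rewrite /= ltnS; apply: IH iy _ => y /sy /cS.
apply: acl_sub => z [Sz|]; first by left; left.
by rewrite inE => /orP [/eqP ->|zw]; [left; right|right].
Qed.

Lemma independent_rcons S ys y : independent S ys -> ~ acl (adjoin_seq S ys) y ->
  independent S (rcons ys y).
Proof.
elim: ys S => [|z ys IH] S /=.
  by move=> _ Hy; split=> // Sy; apply: Hy; apply: acl_sub Sy => z Sz; left.
move=> [Sz iS] Hy; split=> //; apply: IH => // H; apply: Hy; apply: acl_sub H.
move=> w [[Sw|->]|wy]; [by left|by right; rewrite mem_head|].
by right; rewrite inE wy orbT.
Qed.

(** A maximal independent sequence inside [M] does it, its length being bounded by [steinitz]. This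
    trades generators outside [M] for elements of [M]. *)
Lemma generating_subseq S ws (M : F -> Prop) :
  (forall y, M y -> acl (adjoin_seq S ws) y) ->
  exists ys, [/\ (size ys <= size ws)%N, forall y, y \in ys -> M y
               & forall z, M z -> acl (adjoin_seq S ys) z].
Proof.
move=> MS.
pose Q h := `[< exists ys, [/\ size ys = h, independent S ys
                             & forall y, y \in ys -> M y] >].
have exQ : exists h, Q h by exists 0%N; apply/asboolP; exists [::].
have bQ h : Q h -> (h <= size ws)%N.
  by move=> /asboolP [ys [<- iy My]]; apply: steinitz iy _ => y /My /MS.
case: (ex_maxnP exQ bQ) => h /asboolP [ys [szy iy My]] max.
exists ys; split=> // [|z Mz]; first by rewrite szy bQ //; apply/asboolP; exists ys.
apply: contrapT => Hz; suff : (h.+1 <= h)%N by rewrite ltnn.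
apply: max; apply/asboolP; exists (rcons ys z).
rewrite size_rcons szy; split=> //; first exact: independent_rcons.
by move=> y; rewrite mem_rcons inE => /orP [/eqP ->//|/My].
Qed.

End Steinitz.

(** * Algebraic independence expressed by multivariate polynomials *)

Section MpolyLink.

Variables (L K : fieldType) (i : {rmorphism L -> K}).

Definition im (z : K) : Prop := exists a, z = i a.

Lemma mmap_genfield d (x : d.-tuple K) (p : {mpoly L[d]}) :
  genfield (adjoin_seq im x) (mmap i (tnth x) p).
Proof.
apply/genfieldP; rewrite /mmap; apply: rpred_sum => m _; apply: rpredM.
  by apply/genfieldP/genfield_mem; left; exists (p@_m).
apply: rpred_prod => j _; apply: rpredX.
by apply/genfieldP/genfield_mem; right; apply: mem_tnth.
Qed.

Lemma genfield_mmap_frac d (x : d.-tuple K) z : genfield (adjoin_seq im x) z ->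
  exists a b, mmap i (tnth x) b != 0 /\ z = mmap i (tnth x) a / mmap i (tnth x) b.
Proof.
set ev := mmap i (tnth x).
elim=> {z} [z [[a ->]|/tnthP [j ->]]||z w _ [a [b [b0 ->]]] _ [c [e [d0 ->]]]
  |z w _ [a [b [b0 ->]]] _ [c [e [d0 ->]]]].
- by exists a%:MP, 1%:MP; rewrite /ev !mmapC /= rmorph1 divr1 oner_eq0.
- by exists 'X_j, 1%:MP; rewrite /ev mmapX mmap1U mmapC /= rmorph1 divr1 oner_eq0.
- by exists 1%:MP, 1%:MP; rewrite /ev !mmapC /= rmorph1 divr1 oner_eq0.
- exists (a * e - c * b), (b * e); rewrite /ev rmorphM rmorphB !rmorphM /=.
  by rewrite mulf_neq0 // -[- (_ / _)]mulNr addf_div // mulNr.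
- have [c0|c0] := eqVneq (ev c) 0.
    exists 0%:MP, 1%:MP.
    by rewrite c0 mul0r invr0 mulr0 /ev !mmapC /= rmorph1 oner_eq0 rmorph0 mul0r.
  exists (a * e), (b * c); rewrite /ev !rmorphM mulf_neq0 //.
  by rewrite invf_div mulf_div.
Qed.

Lemma genfield_mmap_denom d (x : d.-tuple K) (p : {poly K}) :
  (forall j, genfield (adjoin_seq im x) p`_j) ->
  exists (P : {poly {mpoly L[d]}}) (c : {mpoly L[d]}),
    mmap i (tnth x) c != 0 /\
    forall j, mmap i (tnth x) P`_j = mmap i (tnth x) c * p`_j.
Proof.
set ev := mmap i (tnth x).
elim/poly_ind: p => [|p c IH] H.
  exists 0, 1%:MP; rewrite /ev mmapC /= rmorph1 oner_eq0; split=> // j.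
  by rewrite !coef0 rmorph0 mulr0.
have Hp j : genfield (adjoin_seq im x) p`_j.
  by have := H j.+1; rewrite coefD coefMX coefC addr0.
have {IH} [P [C [C0 E]]] := IH Hp.
have := H 0%N; rewrite coefD coefMX coefC add0r /=.
move=> /genfield_mmap_frac [a [b [b0 ce]]].
exists (P * b%:P * 'X + (C * a)%:P), (C * b); split.
  by rewrite /ev rmorphM mulf_neq0.
case=> [|j]; rewrite !coefD !coefMX !coefC /= ?add0r ?addr0.
  by rewrite /ev !rmorphM ce /= -mulrA; congr (_ * _); rewrite mulrCA divff // mulr1.
by rewrite coefMC /ev !rmorphM /= -/ev E mulrAC.
Qed.

Section Cons.

Variables (d : nat) (x : d.-tuple K) (y : K).

(** The isomorphism from L[X_0, ..., X_d] to L[X_1, ..., X_d][X_0]. *)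
Definition first_var (p : {mpoly L[d.+1]}) : {poly {mpoly L[d]}} :=
  mmap (polyC \o @mpolyC d L)
    (fun j => if unlift ord0 j is Some k then ('X_k)%:P else 'X) p.

Definition first_var_inv (P : {poly {mpoly L[d]}}) : {mpoly L[d.+1]} :=
  (map_poly (mmap (@mpolyC d.+1 L) (fun j => 'X_(lift ord0 j))) P).['X_ord0].

Lemma first_varK : cancel first_var first_var_inv.
Proof.
move=> p; rewrite [in RHS](mpolyE p) /first_var /mmap /first_var_inv.
rewrite rmorph_sum horner_sum; apply: eq_bigr => m _ /=.
rewrite rmorphM hornerM /= map_polyC hornerC /= mmapC /= mul_mpolyC; congr (_ *: _).
rewrite /mmap1 rmorph_prod horner_prod [RHS]mpolyXE_id; apply: eq_bigr => j _.
rewrite rmorphXn horner_exp; congr (_ ^+ _).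
case: (unliftP ord0 j) => [k|] -> /=.
  by rewrite map_polyC hornerC /= mmapX mmap1U.
by rewrite map_polyX hornerX.
Qed.

Lemma first_var_invK : cancel first_var_inv first_var.
Proof.
move=> P; rewrite /first_var_inv /first_var -horner_map /= mmapX mmap1U.
rewrite unlift_none -map_poly_comp -[RHS]comp_polyXr /comp_poly.
congr (_.['X]); apply: eq_map_poly => p /=.
rewrite [in RHS](mpolyE p) [X in mmap _ _ X]/mmap !rmorph_sum /=.
apply: eq_bigr => m _; rewrite rmorphM /= mmapC /= -mul_mpolyC polyCM; congr (_ * _).
rewrite /mmap1 mpolyXE_id !rmorph_prod; apply: eq_bigr => j _.
by rewrite !rmorphXn /= mmapX mmap1U liftK.
Qed.

Lemma tnth_cons_lift k : tnth [tuple of y :: x] (lift ord0 k) = tnth x k.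
Proof. by rewrite (tnth_nth 0) /= -tnth_nth. Qed.

Lemma mmap_first_var p : mmap i (tnth [tuple of y :: x]) p =
  (map_poly (mmap i (tnth x)) (first_var p)).[y].
Proof.
rewrite /first_var [in LHS]/mmap [mmap (polyC \o _) _ _]/mmap rmorph_sum horner_sum.
apply: eq_bigr => m _ /=.
rewrite rmorphM hornerM /= map_polyC hornerC /= mmapC /=; congr (_ * _).
rewrite /mmap1 rmorph_prod horner_prod; apply: eq_bigr => j _.
rewrite rmorphXn horner_exp; congr (_ ^+ _).
case: (unliftP ord0 j) => [k|] -> /=.
  by rewrite map_polyC hornerC /= mmapX mmap1U tnth_cons_lift.
by rewrite map_polyX hornerX.
Qed.

Lemma mmap_first_var_inv (P : {poly {mpoly L[d]}}) :
  mmap i (tnth [tuple of y :: x]) (first_var_inv P)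
  = (map_poly (mmap i (tnth x)) P).[y].
Proof.
rewrite /first_var_inv -horner_map /= mmapX mmap1U tnth0 -map_poly_comp.
congr (_.[y]); apply: eq_map_poly => p /=.
rewrite [X in mmap _ _ X]/mmap rmorph_sum [RHS]/mmap; apply: eq_bigr => m _ /=.
rewrite rmorphM /= mmapC /=; congr (_ * _).
rewrite /mmap1 rmorph_prod; apply: eq_bigr => j _.
by rewrite rmorphXn /= mmapX mmap1U tnth_cons_lift.
Qed.

(** With the first variable singled out, a relation on [y :: x] is a polynomial equation of [y]
    whose coefficients are polynomials in [x]; conversely denominators are cleared in an equation
    over the subfield generated by [x]. *)
Lemma alg_independent_cons : alg_independent i [tuple of y :: x] <->
  alg_independent i x /\ ~ acl (adjoin_seq im x) y.
Proof.
split=> [H|[Hx Hy] p].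
- have inj P : first_var_inv P = 0 -> P = 0.
    by move=> P0; rewrite -[P]first_var_invK P0 /first_var mmap0.
  split=> [p p0|[p p0 py]].
    have /H/inj/polyP/(_ 0%N) : mmap i (tnth [tuple of y :: x]) (first_var_inv p%:P) = 0.
      by rewrite mmap_first_var_inv map_polyC hornerC.
    by rewrite coefC coef0.
  have [j|P [c [c0 E]]] := @genfield_mmap_denom d x (map_poly (@gval _ _) p).
    by rewrite coef_map; apply/genfieldP/gvalP.
  have P0 : first_var_inv P = 0.
    apply: H; rewrite mmap_first_var_inv.
    have -> : map_poly (mmap i (tnth x)) P =
       mmap i (tnth x) c *: map_poly (@gval _ _) p.
      by apply/polyP => j; rewrite coef_map /= E coefZ.
    by rewrite hornerZ (rootP py) mulr0.
  case/eqP: p0; apply/polyP => j; apply: (fmorph_inj (@gval K _)).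
  have := E j; rewrite (inj _ P0) coef0 rmorph0 coef_map => /esym/eqP.
  by rewrite mulf_eq0 (negbTE c0) /= => /eqP ->; rewrite coef0 rmorph0.
- rewrite mmap_first_var => H; rewrite -[p]first_varK.
  suff -> : first_var p = 0 by rewrite /first_var_inv rmorph0 horner0.
  apply/polyP => j; rewrite coef0; apply: Hx.
  have P0 : map_poly (mmap i (tnth x)) (first_var p) = 0.
    apply/eqP; apply: contra_notT Hy => P0.
    apply: (acl_root P0); last by apply/rootP.
    by move=> k; rewrite coef_map; apply/genfield_acl/mmap_genfield.
  by have := congr1 (fun q : {poly K} => q`_j) P0; rewrite coef_map coef0.
Qed.

End Cons.
End MpolyLink.

Section TrdegExists.

Variables (L K : fieldType) (i : {rmorphism L -> K}).

Lemma transcendence_basis_acl d (x : d.-tuple K) : transcendence_basis i x ->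
  forall z, acl (adjoin_seq (im i) x) z.
Proof.
move=> [Hx max] z; apply: contrapT => Hz.
by apply: (max z); apply/alg_independent_cons.
Qed.

Lemma alg_independent_nil (x : 0.-tuple K) : alg_independent i x.
Proof.
move=> p; have m0 (m : 'X_{1..0}) : m = 0%MM by apply/mnmP => - [].
have -> : p = (p@_0)%:MP.
  by apply/mpolyP => m; rewrite (m0 m) mcoeffC eqxx mulr1.
by rewrite mmapC /= => /eqP; rewrite fmorph_eq0 => /eqP ->; rewrite mpolyC0.
Qed.

(** The order is reversed because [alg_independent_cons] compares the head with the tail, whereas
    [independent] compares each entry with the preceding ones. *)
Lemma alg_independent_rev d (x : d.-tuple K) : alg_independent i x ->
  independent (im i) (rev x).
Proof.
elim: d x => [|d IH] x; first by rewrite tuple0.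
case/tupleP: x => y x /alg_independent_cons [Hx Hy] /=.
rewrite rev_cons; apply: independent_rcons; first exact: IH.
by move=> H; apply: Hy; apply: acl_sub H => z [Sz|]; [left|rewrite mem_rev; right].
Qed.

Lemma has_trdeg_exists ws : (forall z, acl (adjoin_seq (im i) ws) z) ->
  exists d, has_trdeg i d.
Proof.
move=> Hws.
pose Q d := `[< exists x : d.-tuple K, alg_independent i x >].
have exQ : exists d, Q d.
  by exists 0%N; apply/asboolP; exists [tuple]; exact: alg_independent_nil.
have bQ d : Q d -> (d <= size ws)%N.
  move=> /asboolP [x /alg_independent_rev Hx].
  by rewrite -(size_tuple x) -size_rev; apply: steinitz Hx _ => y _.
case: (ex_maxnP exQ bQ) => d /asboolP [x Hx] max.
exists d, x; split=> // y Hy; suff : (d.+1 <= d)%N by rewrite ltnn.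
by apply: max; apply/asboolP; exists [tuple of y :: x].
Qed.

End TrdegExists.

(** * The Tsen-Lang theorem *)

(** Forms are treated as functions on an arbitrary finite set of unknowns, so that substituting and
    renaming unknowns become composition. *)
Definition hform (E : fieldType) (I : finType) (d : nat) (f : (I -> E) -> E) :=
  exists2 p : {mpoly E[#|I|]}, p \is d.-homog &
    forall x, f x = p.@[fun k => x (enum_val k)].

Section HForm.

Variable E : fieldType.
Implicit Types (I J : finType).

Lemma hform_eq I d (f g : (I -> E) -> E) : f =1 g -> hform d f -> hform d g.
Proof. by move=> fg [p hp Hp]; exists p => // x; rewrite -fg. Qed.

Lemma hform_var I (i : I) : hform 1 (fun x : I -> E => x i).
Proof.
exists 'X_(enum_rank i); first by rewrite dhomogX /= mdeg1.
by move=> x; rewrite mevalXU enum_rankK.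
Qed.

Lemma hform_cst I c : hform 0 (fun _ : I -> E => c).
Proof.
exists c%:MP; last by move=> x; rewrite mevalC.
by rewrite -[c%:MP]mulr1 mul_mpolyC; apply: dhomogZ; apply: dhomog1.
Qed.

Lemma hform0 I d : hform d (fun _ : I -> E => 0).
Proof. by exists 0; [exact: dhomog0|move=> x; rewrite meval0]. Qed.

Lemma hformD I d (f g : (I -> E) -> E) : hform d f -> hform d g ->
  hform d (fun x => f x + g x).
Proof.
move=> [p hp Hp] [q hq Hq]; exists (p + q); first exact: dhomogD.
by move=> x; rewrite mevalD Hp Hq.
Qed.

Lemma hformM I d e (f g : (I -> E) -> E) : hform d f -> hform e g ->
  hform (d + e) (fun x => f x * g x).
Proof.
move=> [p hp Hp] [q hq Hq]; exists (p * q); first exact: dhomogM.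
by move=> x; rewrite mevalM Hp Hq.
Qed.

Lemma hformZ I d c (f : (I -> E) -> E) : hform d f -> hform d (fun x => c * f x).
Proof. exact: (hformM (hform_cst I c)). Qed.

Lemma hform_sum I d (T : Type) (s : seq T) (P : pred T) (f : T -> (I -> E) -> E) :
  (forall j, P j -> hform d (f j)) -> hform d (fun x => \sum_(j <- s | P j) f j x).
Proof.
move=> Hf; elim: s => [|j s IH].
  by apply: hform_eq (hform0 I d) => x; rewrite big_nil.
have [Pj|Pj] := boolP (P j).
  by apply: hform_eq (hformD (Hf _ Pj) IH) => x; rewrite big_cons Pj.
by apply: hform_eq IH => x; rewrite big_cons (negbTE Pj).
Qed.

Lemma hform_prod I (T : Type) (s : seq T) (d : T -> nat) (f : T -> (I -> E) -> E) :
  (forall j, hform (d j) (f j)) ->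
  hform (\sum_(j <- s) d j) (fun x => \prod_(j <- s) f j x).
Proof.
move=> Hf; elim: s => [|j s IH].
  by rewrite big_nil; apply: hform_eq (hform_cst I 1) => x; rewrite big_nil.
by rewrite big_cons; apply: hform_eq (hformM (Hf j) IH) => x; rewrite big_cons.
Qed.

Lemma hformX I d n (f : (I -> E) -> E) : hform d f -> hform (n * d) (fun x => f x ^+ n).
Proof.
move=> Hf; have := hform_prod (index_iota 0 n) (fun _ => Hf).
rewrite sum_nat_const_nat subn0; apply: hform_eq => x.
by rewrite prodr_const_nat subn0.
Qed.

Lemma hform_meval I n D d (p : {mpoly E[n]}) (f : 'I_n -> (I -> E) -> E) :
  p \is D.-homog -> (forall j, hform d (f j)) ->
  hform (D * d) (fun x => p.@[fun k => f k x]).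
Proof.
move=> hp Hf.
apply: (@hform_eq _ _ (fun x => \sum_(m <- msupp p | mdeg m == D)
    p@_m * \prod_k f k x ^+ m k)).
  move=> x; rewrite mevalE -big_filter; congr (\sum_(m <- _) _).
  by apply/all_filterP/allP => m /(dhomog_mf hp) ->.
apply: hform_sum => m /eqP mD; apply: hformZ.
have := hform_prod (index_enum 'I_n) (fun k => hformX (m k) (Hf k)).
by rewrite -big_distrl /= -mdegE mD.
Qed.

Lemma hform_comp I J D d (h : (J -> E) -> E) (f : J -> (I -> E) -> E) :
  hform D h -> (forall j, hform d (f j)) -> hform (D * d) (fun x => h (fun j => f j x)).
Proof.
move=> [p hp Hp] Hf; have := hform_meval hp (fun k => Hf (enum_val k)).
by apply: hform_eq => x; rewrite Hp.
Qed.

Lemma hform_reindex I J d (f : (I -> E) -> E) (s : I -> J) : hform d f ->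
  hform d (fun x : J -> E => f (fun i => x (s i))).
Proof.
by move=> Hf; rewrite -[d]muln1; apply: hform_comp Hf _ => i; apply: hform_var.
Qed.

End HForm.

(** Property C_m for systems of [r] forms of equal degree. This is the version suited to restriction
    of scalars, which turns one equation into several. *)
Definition sys_zero (m : nat) (E : fieldType) : Prop :=
  forall (d r : nat) (I : finType) (f : 'I_r -> (I -> E) -> E),
    (0 < d)%N -> (forall a, hform d (f a)) -> (r * d ^ m < #|I|)%N ->
    exists x, (exists i, x i != 0) /\ forall a, f a x = 0.

Lemma sys_zero_le m n E : (m <= n)%N -> sys_zero m E -> sys_zero n E.
Proof.
move=> mn Hm d r I f d0 Hf lt; apply: Hm Hf _ => //.
by apply: leq_ltn_trans lt; rewrite leq_mul2l leq_pexp2l ?orbT.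
Qed.

Lemma sys_zero_Cfield m E : sys_zero m E -> Cfield m E.
Proof.
move=> Hm d N p d0 lt hp.
have Hf (a : 'I_1) : hform d (fun x : 'I_N -> E => p.@[x]).
  by rewrite -[d]muln1; apply: hform_meval hp _ => k; apply: hform_var.
have [|x [[i xi] Hx]] := Hm d 1%N _ _ d0 Hf; first by rewrite mul1n card_ord.
by exists x; split; [exists i|rewrite (Hx ord0)].
Qed.

(** * Nagata's passage from single forms to systems *)

Section Nagata.

Variable E : fieldType.

Definition aniso (I : finType) (D : nat) : Prop :=
  exists2 h : (I -> E) -> E, hform D h & forall x, h x = 0 -> forall i, x i = 0.

Lemma Cfield_aniso m (I : finType) D : Cfield m E -> (0 < D)%N -> aniso I D ->
  (#|I| <= D ^ m)%N.
Proof.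
move=> Cm D0 [h [p hp Hp] Hh]; rewrite leqNgt; apply/negP => lt.
have [x [[i xi] Hx]] := Cm _ _ p D0 lt hp.
case/eqP: xi; have := Hh (fun j => x (enum_rank j)) _ (enum_val i).
rewrite enum_valK; apply; rewrite Hp -[RHS]Hx.
by apply: meval_eq => k; rewrite enum_valK.
Qed.

(** The values of [b] copies of the system, in disjoint unknowns, are substituted injectively for
    arguments of the form on [J], the remaining arguments being 0. The degree is multiplied by [d],
    and there are [b * #|I|] unknowns. *)
Lemma nagata_step (I J : finType) D d r b (f : 'I_r -> (I -> E) -> E) :
  aniso J D -> (forall a, hform d (f a)) ->
  (forall x, (forall a, f a x = 0) -> forall i, x i = 0) ->
  (b * r <= #|J|)%N -> aniso ('I_b * I)%type (D * d).
Proof.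
move=> [h hh Hh] Hf Hx le.
have cle : (#|{: 'I_b * 'I_r}| <= #|J|)%N by rewrite card_prod !card_ord.
pose g (u : 'I_b * 'I_r) : J := enum_val (widen_ord cle (enum_rank u)).
have ginj : injective g.
  by move=> u v /enum_val_inj /(congr1 val) /= /val_inj /enum_rank_inj.
pose F (s : J) (y : 'I_b * I -> E) : E :=
  \sum_(u | g u == s) f u.2 (fun i => y (u.1, i)).
exists (fun y => h (fun s => F s y)).
  apply: hform_comp hh _ => s; apply: hform_sum => u _.
  exact: (hform_reindex (fun i => (u.1, i)) (Hf u.2)).
move=> y /Hh H [u i]; apply: (Hx (fun i => y (u, i))) => a.
rewrite -[RHS](H (g (u, a))) /F (big_pred1 (u, a)) // => v.
by rewrite (inj_eq ginj).
Qed.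

Lemma aniso_large e : (1 < e)%N -> aniso 'I_e e ->
  forall k, exists J : finType, #|J| = (e ^ k)%N /\ aniso J (e ^ k).
Proof.
move=> e1 [h hh Hh]; elim=> [|k [J [cJ aJ]]].
  exists 'I_1; rewrite card_ord; split=> //.
  exists (fun x => x ord0); first exact: hform_var.
  by move=> x x0 i; rewrite (ord1 i).
exists ('I_(e ^ k) * 'I_e)%type; rewrite card_prod !card_ord expnSr; split=> //.
apply: (@nagata_step _ J _ _ 1 _ (fun=> h)) => //.
  by move=> x /(_ ord0) /Hh.
by rewrite muln1 cJ.
Qed.

(** A step with [n %/ r] copies multiplies the number [n] of unknowns by at least
    [(4 * r * q + 1) / (4 * r)], which exceeds [q]. The lower bound on [n] absorbs the rounding in
    [n %/ r]. *)
Lemma nagata_growth r q N n : (0 < r)%N -> (0 < q)%N -> (r * q < N)%N ->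
  (r * (4 * r * q + 1) <= n)%N ->
  ((4 * r * q + 1) * n <= 4 * r * (N * (n %/ r)))%N.
Proof.
move=> r0 q0 lt len; set u := (n %/ r)%N.
have nu : (n < r * (u + 1))%N by rewrite mulnC addn1 ltn_ceil.
have uge : (4 * r * q + 1 <= u)%N by rewrite leq_divRL // mulnC.
have : ((r * q + 1) * u <= N * u)%N by rewrite leq_mul2r addn1 lt orbT.
nia.
Qed.

Lemma bernoulli_gt c B : (0 < c)%N -> exists k, (c ^ k * B < (c + 1) ^ k)%N.
Proof.
move=> c0; exists (c * B)%N.
have H k : (c ^ k * (c + k) <= c * (c + 1) ^ k)%N.
  elim: k => [|k IH]; first by rewrite !expn0; lia.
  rewrite !expnS; move: IH; set x := (c ^ k)%N; set y := ((c + 1) ^ k)%N; nia.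
have := H (c * B)%N; have : (0 < c ^ (c * B))%N by rewrite expn_gt0 c0.
set x := (c ^ _)%N; set y := ((c + 1) ^ _)%N; nia.
Qed.

(** If the system had only the trivial zero, iterating [nagata_step] would give anisotropic forms of
    degree [e ^ k0 * d ^ k] in at least [((c + 1) / (4 * r)) ^ k] unknowns, where
    [c = 4 * r * d ^ m]. Property C_m allows at most [(e ^ k0 * d ^ k) ^ m] of them, which grows
    only like [(c / (4 * r)) ^ k]. *)
Lemma nagata_sys_zero m e : Cfield m E -> (1 < e)%N -> aniso 'I_e e ->
  sys_zero m E.
Proof.
move=> Cm e1 ae d r I f d0 Hf lt; apply: contrapT => Hno.
have Hx x : (forall a, f a x = 0) -> forall i, x i = 0.
  move=> fx i; apply/eqP; apply: contrapT => /negP xi; apply: Hno.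
  by exists x; split=> //; exists i.
have r0 : (0 < r)%N.
  case: r f Hf lt Hno Hx => // f Hf lt _ Hx.
  have /card_gt0P [i _] : (0 < #|I|)%N by apply: leq_ltn_trans lt.
  have H1 : forall a : 'I_0, f a (fun=> 1) = 0 by case.
  by have /eqP := Hx _ H1 i; rewrite oner_eq0.
pose q := (d ^ m)%N; have q0 : (0 < q)%N by rewrite expn_gt0 d0.
pose c := (4 * r * q)%N.
(* The exponent [k0] makes the initial form large enough for [nagata_growth]. *)
have [k0 k0P] : exists k0, (r * (c + 1) <= e ^ k0)%N.
  by exists (r * (c + 1))%N; apply: ltnW; apply: ltn_expl.
have [J0 [cJ0 aJ0]] := aniso_large e1 ae k0.
have Hk k : exists J : finType, aniso J (e ^ k0 * d ^ k) /\
   (r * (c + 1) <= #|J|)%N /\ ((c + 1) ^ k <= (4 * r) ^ k * #|J|)%N.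
  elim: k => [|k [J [aJ [gJ lJ]]]].
    exists J0; rewrite muln1 cJ0 !expn0 mul1n; split=> //; split=> //.
    by rewrite expn_gt0 (ltnW e1).
  have := @nagata_step _ _ _ _ _ (#|J| %/ r) _ aJ Hf Hx (leq_divM _ _).
  rewrite -mulnA -expnSr => aJ'.
  have gr := nagata_growth r0 q0 lt gJ.
  exists ('I_(#|J| %/ r) * I)%type; rewrite card_prod card_ord (mulnC (_ %/ _)%N).
  split=> //; split.
    apply: leq_trans gJ _.
    have : (4 * r * #|J| <= 4 * r * (#|I| * (#|J| %/ r)))%N.
      apply: leq_trans gr; rewrite leq_mul2r; apply/orP; right.
      by rewrite -{1}[(4 * r)%N]muln1; apply: leq_trans (leq_addr _ _); rewrite leq_mul2l q0 orbT.
    by rewrite leq_pmul2l // muln_gt0 r0.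
  rewrite !expnS -mulnA.
  apply: leq_trans (_ : (c + 1) * ((4 * r) ^ k * #|J|) <= _)%N.
    by rewrite leq_mul2l lJ orbT.
  rewrite mulnCA [X in (_ <= X)%N]mulnCA leq_mul2l; apply/orP; right.
  by rewrite -/c in gr *.
have c0 : (0 < c)%N by rewrite !muln_gt0 r0 q0.
have [k kP] := bernoulli_gt ((e ^ k0) ^ m) c0.
have [J [aJ [_ lJ]]] := Hk k.
have := Cfield_aniso Cm _ aJ; rewrite muln_gt0 !expn_gt0 d0 (ltnW e1) => /(_ isT) cJ.
have : ((c + 1) ^ k <= (4 * r) ^ k * ((e ^ k0 * d ^ k) ^ m))%N.
  by apply: leq_trans lJ _; rewrite leq_mul2l cJ orbT.
have -> : ((4 * r) ^ k * (e ^ k0 * d ^ k) ^ m = c ^ k * (e ^ k0) ^ m)%N.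
  rewrite /c /q (expnMn (4 * r)) -mulnA; congr (_ * _)%N.
  by rewrite expnMn -!expnM mulnC (mulnC k).
by rewrite leqNgt kP.
Qed.

End Nagata.

(** The norm of [E1] over [E] is the determinant of multiplication in a basis; it vanishes only at 0
    because [E1] is a field. *)
Lemma norm_form (E : fieldType) (E1 : fieldExtType E) : aniso E 'I_(\dim {:E1}) (\dim {:E1}).
Proof.
set e := \dim {:E1}.
pose M (x : 'I_e -> E) := \matrix_(k < e, l < e)
   \sum_i x i * crd l (bas k * bas i : E1).
exists (fun x => \det (M x)).
  apply: (@hform_eq _ _ _ (fun x => \sum_(s : 'S_e) (-1) ^+ s * \prod_i M x i (s i))) => //.
  apply: hform_sum => s _; apply: hformZ.
  have := @hform_prod _ _ _ (index_enum 'I_e) (fun=> 1%N) (fun i x => M x i (s i)).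
  rewrite sum1_card card_ord; apply=> i.
  apply: (@hform_eq _ _ _ (fun x => \sum_j crd (s i) (bas i * bas j : E1) * x j)).
    by move=> x; rewrite mxE; apply: eq_bigr => j _; rewrite mulrC.
  by apply: hform_sum => j _; apply: hformZ; apply: hform_var.
move=> x /eqP/det0P [v v0 vM] i.
pose u : E1 := \sum_k v 0 k *: bas k; pose w : E1 := \sum_i x i *: bas i.
have uw : u * w = 0.
  rewrite [u * w]crd_sum big1 // => l _.
  suff -> : crd l (u * w) = (v *m M x) 0 l by rewrite vM mxE scale0r.
  rewrite mxE /u /w mulr_suml /crd linear_sum; apply: eq_bigr => k _ /=.
  rewrite mxE mulr_sumr linear_sum mulr_sumr; apply: eq_bigr => j _ /=.
  by rewrite -scalerAl -scalerAr !linearZ /=.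
have crdE (y : 'I_e -> E) j : crd j (\sum_k y k *: bas k : E1) = y j.
  rewrite /crd linear_sum (bigD1 j) //= big1 ?addr0 => [|k kj].
    by rewrite linearZ /= -/(crd j _) crd_bas eqxx mulr1.
  by rewrite linearZ /= -/(crd j _) crd_bas eq_sym (negbTE kj) mulr0.
have u0 : u != 0.
  apply: contraNneq v0 => u0; apply/eqP/rowP => k.
  by rewrite -(crdE (fun k => v 0 k)) -/u u0 /crd linear0 mxE.
have /eqP w0 : w == 0 by move/eqP: uw; rewrite mulf_eq0 (negbTE u0).
by rewrite -(crdE x) -/w w0 /crd linear0.
Qed.

(** A nonconstant polynomial of least degree without root is irreducible, since a proper factor
    would be a smaller example. It defines an extension of degree at least 2, and the norm form of
    that extension is taken. *)
Lemma no_root_aniso (E : fieldType) (p : {poly E}) : (1 < size p)%N ->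
  (forall z, ~~ root p z) -> exists2 e, (1 < e)%N & aniso E 'I_e e.
Proof.
move=> p1 pr.
pose Q n := `[< exists q : {poly E}, [/\ size q = n, (1 < size q)%N & forall z, ~~ root q z] >].
have exQ : exists n, Q n by exists (size p); apply/asboolP; exists p.
case: (ex_minnP exQ) => n /asboolP [q [<- q1 qr]] min.
have q0 : q != 0 by rewrite -size_poly_eq0 -lt0n; apply: ltnW.
have irr : irreducible_poly q.
  split=> // r r1 rq; rewrite -dvdp_size_eqp // eqn_leq dvdp_leq //=.
  apply: min; apply/asboolP; exists r; split=> //; last first.
    by move=> z; apply: contra (qr z) => rz; case/dvdpP: rq => c ->; rewrite rootM rz orbT.
  rewrite ltn_neqAle eq_sym r1 lt0n size_poly_eq0.
  by apply: contraNneq q0 => r0; move: rq; rewrite r0 dvd0p.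
have [E1 dE _] := irredp_FAdjoin irr.
exists (\dim {:E1}); last exact: norm_form.
rewrite dE; case: (ltngtP (size q) 2) => [|q2|q2].
- by rewrite ltnS leqNgt q1.
- by rewrite -ltnS prednK // ltnW.
by have [z zr] := poly2_root q2; have := qr z; rewrite zr.
Qed.

Lemma simple_alg_ext (E E' : fieldType) (phi : {rmorphism E -> E'}) z :
  algebraicOver phi z -> exists (E1 : fieldExtType E) (psi : {rmorphism E1 -> E'}),
    (forall c, psi c%:A = phi c) /\ exists z1, psi z1 = z.
Proof.
move=> [p0 p00 p0z].
pose Q n := `[< exists p : {poly E}, [/\ size p = n, p != 0 & root (map_poly phi p) z] >].
have exQ : exists n, Q n by exists (size p0); apply/asboolP; exists p0.
case: (ex_minnP exQ) => n /asboolP [p [<- p_neq0 pz]] min.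
have irr : irreducible_poly p.
  by apply/(subfx_irreducibleP pz p_neq0) => q qz q0; apply: min; apply/asboolP; exists q.
exists (SubFieldExtType pz irr), (@subfx_inj _ _ phi z p); split.
  by move=> c; exact: (subfx_inj_base pz p_neq0).
by exists (@subfx_root _ _ phi z p); exact: (subfx_inj_root pz p_neq0).
Qed.

(* Functions (I -> E) -> E' whose expansion has degree d forms over E as
   coefficients of elements of W. *)
Definition hexp (E E' : fieldType) (phi : {rmorphism E -> E'}) (W : E' -> Prop)
    (I : finType) (d : nat) (G : (I -> E) -> E') : Prop :=
  exists n (u : 'I_n -> E') (g : 'I_n -> (I -> E) -> E),
    [/\ forall l, W (u l), forall l, hform d (g l) &
        forall y, G y = \sum_l u l * phi (g l y)].

Section HExp.

Variables (E E' : fieldType) (phi : {rmorphism E -> E'}).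
Implicit Types (W : E' -> Prop) (I : finType).

Lemma hexp_eq W I d (G H : (I -> E) -> E') : G =1 H -> hexp phi W d G -> hexp phi W d H.
Proof. by move=> GH [n [u [g [? ? Hg]]]]; exists n, u, g; split=> // y; rewrite -GH. Qed.

Lemma hexp_hform W I d (f : (I -> E) -> E) w : W w -> hform d f ->
  hexp phi W d (fun y => w * phi (f y)).
Proof.
move=> Ww hf; exists 1%N, (fun=> w), (fun=> f).
by split=> // y; rewrite big_ord1.
Qed.

Lemma hexp0 W I d : hexp phi W d (fun _ : I -> E => 0).
Proof.
exists 0%N, (fun=> 0), (fun=> fun=> 0); split=> [[]//|[]//|y].
by rewrite big_ord0.
Qed.

Lemma hexpD W I d (G H : (I -> E) -> E') : hexp phi W d G -> hexp phi W d H ->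
  hexp phi W d (fun y => G y + H y).
Proof.
move=> [n [u [g [Wu hg Hg]]]] [n' [u' [g' [Wu' hg' Hg']]]].
exists (n + n')%N, (fun l => match split l with inl a => u a | inr a => u' a end),
  (fun l => match split l with inl a => g a | inr a => g' a end); split.
- by move=> l; case: splitP.
- by move=> l; case: splitP.
move=> y; rewrite Hg Hg' big_split_ord /=; congr (_ + _); apply: eq_bigr => l _.
  by rewrite -[lshift _ _]/(unsplit (inl l)) unsplitK.
by rewrite -[rshift _ _]/(unsplit (inr l)) unsplitK.
Qed.

Lemma hexp_sum W I d (T : Type) (s : seq T) (P : pred T) (G : T -> (I -> E) -> E') :
  (forall j, P j -> hexp phi W d (G j)) ->
  hexp phi W d (fun y => \sum_(j <- s | P j) G j y).
Proof.
move=> HG; elim: s => [|j s IH].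
  by apply: hexp_eq (hexp0 W I d) => y; rewrite big_nil.
have [Pj|Pj] := boolP (P j).
  by apply: hexp_eq (hexpD (HG _ Pj) IH) => y; rewrite big_cons Pj.
by apply: hexp_eq IH => y; rewrite big_cons (negbTE Pj).
Qed.

Lemma hexpM W1 W2 W I d e (G H : (I -> E) -> E') :
  (forall a b, W1 a -> W2 b -> W (a * b)) ->
  hexp phi W1 d G -> hexp phi W2 e H -> hexp phi W (d + e) (fun y => G y * H y).
Proof.
move=> WW [n [u [g [Wu hg Hg]]]] [n' [u' [g' [Wu' hg' Hg']]]].
apply: (@hexp_eq _ _ _ (fun y => \sum_l \sum_l' (u l * u' l') * phi (g l y * g' l' y))).
  move=> y; rewrite Hg Hg' mulr_suml; apply: eq_bigr => l _.
  rewrite mulr_sumr; apply: eq_bigr => l' _.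
  by rewrite rmorphM mulrACA.
apply: hexp_sum => l _; apply: hexp_sum => l' _; apply: hexp_hform; first exact: WW.
exact: hformM.
Qed.

Section Graded.

Variable W : nat -> E' -> Prop.
Hypothesis W1 : W 0 1.
Hypothesis WM : forall a b x y, W a x -> W b y -> W (a + b) (x * y).

Lemma hexp_prod I (T : Type) (s : seq T) b (d : T -> nat) (G : T -> (I -> E) -> E') :
  (forall j, hexp phi (W (b * d j)) (d j) (G j)) ->
  hexp phi (W (b * \sum_(j <- s) d j)) (\sum_(j <- s) d j) (fun y => \prod_(j <- s) G j y).
Proof.
move=> HG; elim: s => [|j s IH].
  rewrite !big_nil muln0; apply: hexp_eq (hexp_hform W1 (hform_cst I 1)) => y.
  by rewrite big_nil mul1r rmorph1.
rewrite !big_cons mulnDr; apply: hexp_eq (hexpM (WM (a := _) (b := _)) (HG j) IH) => y.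
by rewrite big_cons.
Qed.

Lemma hexpX I b d n (G : (I -> E) -> E') : hexp phi (W (b * d)) d G ->
  hexp phi (W (b * (n * d))) (n * d) (fun y => G y ^+ n).
Proof.
move=> HG; have := @hexp_prod _ _ (index_iota 0 n) b (fun=> d) (fun _ => G) (fun=> HG).
rewrite sum_nat_const_nat subn0; apply: hexp_eq => y.
by rewrite prodr_const_nat subn0.
Qed.

(** Bookkeeping of degrees: for a transcendental generator, [W b] consists of the polynomial values
    of degree at most [b]. For finite extensions [W] is taken to be trivial. *)
Lemma hexp_meval I n b c d (p : {mpoly E'[n]}) (G : 'I_n -> (I -> E) -> E') :
  p \is d.-homog -> (forall m, W c p@_m) -> (forall k, hexp phi (W b) 1 (G k)) ->
  hexp phi (W (c + b * d)) d (fun y => p.@[fun k => G k y]).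
Proof.
move=> hp Wp HG.
apply: (@hexp_eq _ _ _ (fun y => \sum_(m <- msupp p | mdeg m == d)
    p@_m * \prod_k G k y ^+ m k)).
  move=> x; rewrite mevalE -big_filter; congr (\sum_(m <- _) _).
  by apply/all_filterP/allP => m /(dhomog_mf hp) ->.
apply: hexp_sum => m /eqP md.
have HX k : hexp phi (W (b * m k)) (m k) (fun y => G k y ^+ m k).
  by rewrite -[X in W (b * X)]muln1 -[X in hexp _ _ X]muln1; apply: hexpX; rewrite muln1.
have := hexp_prod (index_enum 'I_n) HX; rewrite -mdegE md => H.
have Hc : hexp phi (W c) 0 (fun _ : I -> E => p@_m).
  apply: hexp_eq (hexp_hform (Wp m) (hform_cst I 1)) => y.
  by rewrite rmorph1 mulr1.
by have := hexpM (WM (a := c) (b := b * d)) Hc H.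
Qed.

End Graded.

Definition spans t (w : 'I_t -> E') (x : E') : Prop :=
  exists c : 'I_t -> E, x = \sum_k w k * phi (c k).

Lemma hexp_spans W I d t (w : 'I_t -> E') (G : (I -> E) -> E') :
  (forall x, W x -> spans w x) -> hexp phi W d G ->
  exists2 g : 'I_t -> (I -> E) -> E, forall k, hform d (g k) &
    forall y, G y = \sum_k w k * phi (g k y).
Proof.
move=> Ww [n [u [g [Wu hg Hg]]]].
have /choice [c Hc] : forall l, spans w (u l) by move=> l; apply: Ww.
exists (fun k y => \sum_l c l k * g l y).
  by move=> k; apply: hform_sum => l _; apply: hformZ.
move=> y; rewrite Hg.
transitivity (\sum_l \sum_k w k * phi (c l k * g l y)).
  apply: eq_bigr => l _; rewrite {1}Hc mulr_suml; apply: eq_bigr => k _.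
  by rewrite rmorphM mulrA.
rewrite exchange_big; apply: eq_bigr => k _ /=.
by rewrite rmorph_sum mulr_sumr.
Qed.

(* Restriction of scalars: unknowns are replaced by combinations of the
   independent elements v, values are expanded along the family w. *)
Lemma sys_zero_expand m d r t s (I : finType) (f : 'I_r -> (I -> E') -> E')
    (v : 'I_s -> E') (w : 'I_t -> E') : sys_zero m E -> (0 < d)%N ->
  (forall a, hform d (f a)) ->
  (forall c : 'I_s -> E, \sum_j v j * phi (c j) = 0 -> forall j, c j = 0) ->
  (forall a, exists2 g : 'I_t -> (I * 'I_s -> E) -> E, forall k, hform d (g k) &
    forall y, f a (fun i => \sum_j v j * phi (y (i, j))) = \sum_k w k * phi (g k y)) ->
  (r * t * d ^ m < #|I| * s)%N ->
  exists x, (exists i, x i != 0) /\ forall a, f a x = 0.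
Proof.
move=> Sm d0 Hf fv H lt.
have /choice [g Hg] : forall a, exists g : 'I_t -> (I * 'I_s -> E) -> E,
    (forall k, hform d (g k)) /\
    forall y, f a (fun i => \sum_j v j * phi (y (i, j))) = \sum_k w k * phi (g k y).
  by move=> a; have [g ? ?] := H a; exists g.
pose h (e : 'I_#|{: 'I_r * 'I_t}|) := g (enum_val e).1 (enum_val e).2.
have hh e : hform d (h e) by exact: (Hg (enum_val e).1).1.
have [|y [[[i j] yij] Hy]] := Sm d _ _ h d0 hh.
  by rewrite !card_prod !card_ord.
exists (fun i => \sum_j v j * phi (y (i, j))); split.
  exists i; apply: contraNneq yij => /fv vy; apply/eqP; exact: vy.
move=> a; have [_ ->] := Hg a; rewrite big1 // => k _.
have := Hy (enum_rank (a, k)); rewrite /h enum_rankK /= => ->.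
by rewrite rmorph0 mulr0.
Qed.

End HExp.

(** Unknowns and values are expanded in a basis of [E1], so the numbers of equations and of unknowns
    are multiplied by the same degree. *)
Lemma sys_zero_finite_ext m (E : fieldType) (E1 : fieldExtType E) :
  sys_zero m E -> sys_zero m E1.
Proof.
move=> Sm d r I f d0 Hf lt.
pose phi : {rmorphism E -> E1} := in_alg E1.
pose v (j : 'I_(\dim {:E1})) : E1 := bas j.
have vE (c : 'I_(\dim {:E1}) -> E) : \sum_j v j * phi (c j) = \sum_j c j *: v j.
  by apply: eq_bigr => j _; rewrite /phi /= -scalerAr mulr1.
apply: (@sys_zero_expand E E1 phi m d r (\dim {:E1}) (\dim {:E1}) I f v v Sm d0 Hf).
- move=> c; rewrite vE => cS j.
  have := congr1 (crd j) cS; rewrite {1}/crd linear_sum (bigD1 j) //= big1.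
    by rewrite addr0 linearZ /= -/(crd j _) crd_bas eqxx mulr1 /crd linear0.
  by move=> k kj; rewrite linearZ /= -/(crd j _) crd_bas eq_sym (negbTE kj) mulr0.
- move=> a; have [p hp Hp] := Hf a.
  have HG (k : 'I_#|I|) : hexp phi (fun=> True) 1
      (fun y : I * 'I_(\dim {:E1}) -> E => \sum_j v j * phi (y (enum_val k, j))).
    by apply: hexp_sum => j _; apply: hexp_hform => //; apply: hform_var.
  have H := @hexp_meval _ _ phi (fun _ _ => True) Logic.I
    (fun _ _ _ _ _ _ => Logic.I) _ _ 0%N 0%N d p _ hp (fun=> Logic.I) HG.
  have Hw x : True -> spans phi v x.
    by move=> _; exists (fun k => crd k x); rewrite vE -crd_sum.
  have [g hg gE] := hexp_spans Hw H.
  by exists g => // y; rewrite Hp gE.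
- by rewrite mulnAC ltn_pmul2r // lt0n dimv_eq0; apply/eqP => E0;
  have := memvf (1 : E1); rewrite E0 memv0 oner_eq0.
Qed.

Lemma sys_zero_alg_coefs m (E E' : fieldType) (phi : {rmorphism E -> E'})
    (zs : seq E') : sys_zero m E -> (forall z, z \in zs -> algebraicOver phi z) ->
  exists (E1 : fieldType) (psi : {rmorphism E1 -> E'}), sys_zero m E1 /\
    (forall c, exists c1, psi c1 = phi c) /\ forall z, z \in zs -> exists c, psi c = z.
Proof.
elim: zs E phi => [|z zs IH] E phi Sm Hzs.
  by exists E, phi; split=> //; split=> // c; exists c.
have [E1 [psi [psiE [z1 z1E]]]] := simple_alg_ext (Hzs z (mem_head _ _)).
have [|w wz|E2 [psi2 [S2 [H2 Hz]]]] := IH E1 psi.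
- exact: sys_zero_finite_ext.
- have [|p p0 pw] := Hzs w; first by rewrite inE wz orbT.
  exists (map_poly (in_alg E1) p); first by rewrite map_poly_eq0.
  rewrite -map_poly_comp (@eq_map_poly _ _ (psi \o in_alg E1) phi) //.
exists E2, psi2; split=> //; split=> [c|w].
  by have [c2 c2E] := H2 c%:A; exists c2; rewrite c2E psiE.
rewrite inE => /orP [/eqP ->|/Hz //].
by have [c2 c2E] := H2 z1; exists c2; rewrite c2E z1E.
Qed.

(** The finitely many coefficients of the system come from a tower of simple algebraic extensions,
    built in [sys_zero_alg_coefs]. *)
Lemma sys_zero_algebraic m (E E' : fieldType) (phi : {rmorphism E -> E'}) :
  sys_zero m E -> (forall z, algebraicOver phi z) -> sys_zero m E'.
Proof.
move=> Sm alg d r I f d0 Hf lt.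
have /choice [p Hp] : forall a, exists p : {mpoly E'[#|I|]}, p \is d.-homog /\
    forall x, f a x = p.@[fun k => x (enum_val k)].
  by move=> a; have [p ? ?] := Hf a; exists p.
pose zs := [seq (p a)@_m | a <- enum 'I_r, m <- msupp (p a)].
have [E1 [psi [S1 [_ Hz]]]] := sys_zero_alg_coefs (zs := zs) Sm (fun z _ => alg z).
have /choice [q Hq] : forall a, exists q : {mpoly E1[#|I|]}, q \is d.-homog /\
    forall x, (p a).@[fun k => psi (x k)] = psi q.@[x].
  move=> a; have [hp _] := Hp a.
  have /choice [c Hc] : forall n, exists c, n \in msupp (p a) -> psi c = (p a)@_n.
    move=> n; have [np|_] := boolP (n \in msupp (p a)); last by exists 0.
    have [|c Hc] := Hz (p a)@_n; last by exists c.
    by apply/allpairsPdep; exists a, n; rewrite mem_enum.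
  exists (\sum_(m <- msupp (p a)) c m *: 'X_[m]); split.
    rewrite big_seq; apply: rpred_sum => n np; apply: rpredZ.
    by rewrite dhomogX /= (dhomog_mf hp np).
  move=> x; rewrite mevalE (raddf_sum (meval x)) (raddf_sum psi) big_seq [RHS]big_seq.
  apply: eq_bigr => n np /=; rewrite mevalZ rmorphM Hc //; congr (_ * _).
  by rewrite mevalX rmorph_prod; apply: eq_bigr => k _; rewrite rmorphXn.
have hq a : hform d (fun x : I -> E1 => (q a).@[fun k => x (enum_val k)]).
  by exists (q a) => //; have [] := Hq a.
have [x [[i xi] Hx]] := S1 d r I _ d0 hq lt.
exists (fun j => psi (x j)); split; first by exists i; rewrite fmorph_eq0.
move=> a; have [_ ->] := Hp a; have [_ H] := Hq a.
by rewrite (H (fun k => x (enum_val k))) Hx rmorph0.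
Qed.

(** * Simple transcendental extensions *)

Section PurelyTranscendental.

Variables (E E' : fieldType) (phi : {rmorphism E -> E'}) (x : E').

Let ev (p : {poly E}) := (map_poly phi p).[x].

Let evM p q : ev (p * q) = ev p * ev q.
Proof. by rewrite /ev rmorphM hornerM. Qed.

Let ev_deg b z := exists2 p : {poly E}, (size p <= b.+1)%N & z = ev p.

Hypothesis trx : forall p, p != 0 -> ev p != 0.
Hypothesis gen : forall z, exists a b, ev b != 0 /\ z = ev a / ev b.

Lemma common_denominator (zs : seq E') : exists q B, ev q != 0 /\
  forall z, z \in zs -> ev_deg B (ev q * z).
Proof.
elim: zs => [|z zs [q [B [q0 Hq]]]].
  by exists 1, 0%N; rewrite /ev rmorph1 hornerE oner_eq0.
have [a [b [b0 zE]]] := gen z.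
exists (q * b), (maxn (size (q * a)) (B + size b)); split.
  by rewrite evM mulf_neq0.
move=> w; rewrite inE => /orP [/eqP ->|/Hq [p szp pE]].
  exists (q * a); first by rewrite leqW // leq_maxl.
  by rewrite !evM zE -mulrA; congr (_ * _); rewrite mulrC divfK.
exists (p * b); last by rewrite !evM mulrAC pE.
apply: leq_trans (size_polyMleq _ _) _; apply: leqW; apply: leq_trans (leq_maxr _ _).
by rewrite -subn1 leq_subLR addnA leq_add2r add1n.
Qed.

(** Lang's count. The unknowns are sought as polynomials of degree at most [s] in [x]; after
    multiplication by a common denominator the values have degree at most [B + s * d]. This gives
    [r * (B + s * d + 1)] forms of degree [d] in [#|I| * (s + 1)] unknowns over [E], and for large
    [s] the bound [#|I| > r * d ^ m.+1] provides enough unknowns. *)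
Lemma sys_zero_transcendental m : sys_zero m E -> sys_zero m.+1 E'.
Proof.
move=> Sm d r I f d0 Hf lt.
have /choice [p Hp] : forall a, exists p : {mpoly E'[#|I|]}, p \is d.-homog /\
    forall x, f a x = p.@[fun k => x (enum_val k)].
  by move=> a; have [p ? ?] := Hf a; exists p.
pose zs := [seq (p a)@_m | a <- enum 'I_r, m <- msupp (p a)].
have [q [B [q0 Hq]]] := common_denominator zs.
(* With [h = r * d ^ m.+1], this choice reduces the required inequality to
   [s + h * s < (h + 1) * (s + 1)]. *)
pose s := (r * B.+1 * d ^ m)%N.
suff [y [yn Hy]] : exists y, (exists i, y i != 0) /\ forall a, ev q * f a y = 0.
  exists y; split=> // a; have /eqP := Hy a.
  by rewrite mulf_eq0 (negbTE q0) => /eqP.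
have W1 : ev_deg 0 1.
  by exists 1; rewrite ?size_poly1 // /ev rmorph1 hornerE.
have WM a b y z : ev_deg a y -> ev_deg b z -> ev_deg (a + b) (y * z).
  move=> [u su ->] [w sw ->]; exists (u * w); last by rewrite evM.
  apply: leq_trans (size_polyMleq _ _) _.
  by rewrite -subn1 leq_subLR; apply: leq_trans (leq_add su sw) _; rewrite addnS.
have evX j : ev 'X^j = x ^+ j by rewrite /ev rmorphXn /= map_polyX hornerXn.
apply: (@sys_zero_expand E E' phi m d r (B + s * d).+1 s.+1 I
    (fun a y => ev q * f a y) (fun j => x ^+ j) (fun k => x ^+ k) Sm d0).
- by move=> a; apply: hformZ.
- move=> c cS; pose P := \poly_(j < s.+1) c (inord j).
  have P0 : ev P = 0.
    rewrite /ev (horner_coef_wide _ (n := s.+1)); last first.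
      by rewrite size_map_poly size_poly.
    rewrite -[RHS]cS; apply: eq_bigr => j _.
    by rewrite coef_map coef_poly ltn_ord inord_val mulrC.
  move=> j; have /polyP/(_ j) : P = 0 by apply/eqP/contraT => /trx; rewrite P0 eqxx.
  by rewrite coef_poly ltn_ord inord_val coef0.
- move=> a; have [hp fE] := Hp a.
  have HG (k : 'I_#|I|) : hexp phi (ev_deg s) 1
      (fun y : I * 'I_s.+1 -> E => \sum_(j < s.+1) x ^+ j * phi (y (enum_val k, j))).
    apply: (@hexp_sum _ _ _ _ _ _ 'I_s.+1) => j _.
    apply: hexp_hform; last exact: hform_var.
    by exists 'X^j; rewrite ?evX // size_polyXn ltn_ord.
  have Wc m' : ev_deg B (ev q *: p a)@_m'.
    rewrite mcoeffZ; have [mp|mp] := boolP (m' \in msupp (p a)).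
      by apply: Hq; apply/allpairsPdep; exists a, m'; rewrite mem_enum.
    exists 0; first by rewrite size_poly0.
    by rewrite (memN_msupp_eq0 mp) mulr0 /ev rmorph0 horner0.
  have hq : ev q *: p a \is d.-homog by apply: rpredZ.
  have H := hexp_meval (W := ev_deg) W1 WM hq Wc HG.
  have Hw z : ev_deg (B + s * d) z -> spans phi (fun k : 'I_(B + s * d).+1 => x ^+ k) z.
    move=> [P sP ->]; exists (fun k => P`_k); rewrite /ev (horner_coef_wide _ (n := (B + s * d).+1)).
      by apply: eq_bigr => k _; rewrite coef_map mulrC.
    by rewrite size_map_poly.
  have [g hg gE] := hexp_spans Hw H.
  by exists g => // y; rewrite fE -gE mevalZ.
have H : (r * d ^ m.+1 * s.+1 + s.+1 <= #|I| * s.+1)%N.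
  by rewrite -mulSnr leq_mul2r lt orbT.
apply: leq_trans H; rewrite expnS /s; set u := (d ^ m)%N.
have -> : (r * (B + r * B.+1 * u * d).+1 * u = r * B.+1 * u + (r * (d * u)) * (r * B.+1 * u))%N.
  by rewrite -addSn; set b := B.+1; lia.
set z := (r * B.+1 * u)%N; rewrite mulnS.
lia.
Qed.

End PurelyTranscendental.

Section Spanned.

Variables (E : fieldType) (V : lmodType E) (J : finType) (X : J -> V).

Lemma spanned_lin_closed : lin_closed (spanned_by X).
Proof.
split=> [|a u v [c ->] [e ->]].
  by exists (fun=> 0); rewrite big1 // => j _; rewrite scale0r.
exists (fun j => a * c j + e j); rewrite scaler_sumr -big_split /=.
by apply: eq_bigr => j _; rewrite scalerDl scalerA.
Qed.

Lemma spanned_mem j : spanned_by X (X j).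
Proof.
exists (fun k => (k == j)%:R); rewrite (bigD1 j) //= eqxx scale1r big1 ?addr0 //.
by move=> k /negbTE ->; rewrite scale0r.
Qed.

Lemma spannedZ a u : spanned_by X u -> spanned_by X (a *: u).
Proof.
move=> Su; rewrite -[a *: u]addr0; apply: (spanned_lin_closed.2) => //.
exact: spanned_lin_closed.1.
Qed.

Lemma spanned_sum (T : Type) (s : seq T) (P : pred T) (F : T -> V) :
  (forall i, P i -> spanned_by X (F i)) ->
  spanned_by X (\sum_(i <- s | P i) F i).
Proof.
move=> H; elim/big_ind: _ => //; first exact: spanned_lin_closed.1.
by move=> u v Hu Hv; rewrite -[u]scale1r; apply: spanned_lin_closed.2.
Qed.

End Spanned.

(** * A projective Nullstellensatz for fewer forms than unknowns *)

Section ProjectiveNullstellensatz.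

Variables (E : fieldType) (n : nat).
Local Notation R := {mpoly E[n]}.
Implicit Types (I : R -> Prop) (f g h u v l : R).

Definition is_ideal I : Prop :=
  [/\ I 0, forall f g, I f -> I g -> I (f + g) & forall f g, I g -> I (f * g)].

Definition graded I : Prop := forall d f, I f -> I (pihomog mdeg d f).

Definition contains_power I k : Prop :=
  forall m : 'X_{1..n}, mdeg m = k -> I 'X_[m].

(* I does not contain any power of the irrelevant ideal. *)
Definition relevant I : Prop := forall k, ~ contains_power I k.

Definition add_gen I l : R -> Prop := fun f => exists g h, I g /\ f = g + h * l.

Lemma idealZ I c f : is_ideal I -> I f -> I (c *: f).
Proof. by move=> [_ _ IM] If; rewrite -mul_mpolyC; apply: IM. Qed.

Lemma idealB I f g : is_ideal I -> I f -> I g -> I (f - g).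
Proof. by move=> iI If Ig; have [_ ID _] := iI; apply: ID; rewrite // -scaleN1r; apply: idealZ. Qed.

Lemma ideal_sum I (T : Type) (s : seq T) (P : pred T) (F : T -> R) :
  is_ideal I -> (forall i, P i -> I (F i)) -> I (\sum_(i <- s | P i) F i).
Proof. by move=> [I0 ID _] H; elim/big_ind: _. Qed.

Lemma add_gen_ideal I l : is_ideal I -> is_ideal (add_gen I l).
Proof.
move=> iI; have [I0 ID IM] := iI; split=> [|f g [a [b [Ia ->]]] [c [e [Ic ->]]]|f g [a [b [Ia ->]]]].
- by exists 0, 0; rewrite mul0r addr0.
- by exists (a + c), (b + e); rewrite mulrDl addrACA; split=> //; apply: ID.
- by exists (f * a), (f * b); rewrite mulrDr mulrA; split=> //; apply: IM.
Qed.

Lemma add_gen_sub I l f : I f -> add_gen I l f.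
Proof. by move=> If; exists f, 0; rewrite mul0r addr0. Qed.

Lemma add_gen_mem I l : is_ideal I -> add_gen I l l.
Proof. by move=> [I0 _ _]; exists 0, 1; rewrite mul1r add0r. Qed.

Lemma pihomog_mul e l k h : l \is e.-homog ->
  pihomog mdeg k (h * l) = if (e <= k)%N then pihomog mdeg (k - e) h * l else 0.
Proof.
move=> hl; rewrite {1}(@pihomog_partitionE _ _ mdeg (msize h) h) // mulr_suml raddf_sum /=.
have H (i : nat) : pihomog mdeg k (pihomog mdeg i h * l) =
    if (i + e == k)%N then pihomog mdeg i h * l else 0.
  have hi : pihomog mdeg i h * l \is (i + e).-homog by apply: dhomogM => //; apply: pihomogP.
  case: ifP => [/eqP <-|/negbT ik]; first exact: pihomog_dE.
  by rewrite (pihomog_ne0 _ hi) // eq_sym.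
under eq_bigr do rewrite H.
case: leqP => ek; last first.
  by apply: big1 => i _; case: eqP => // ik; move: ek; rewrite -ik ltnNge leq_addl.
have [lt|ge] := ltnP (k - e) (msize h).
  rewrite (bigD1 (Ordinal lt)) //= subnK // eqxx big1 ?addr0 // => i Hi.
  case: eqP => // ik; case/eqP: Hi; apply: val_inj => /=.
  by rewrite -ik addnK.
rewrite big1 => [|i _]; last first.
  case: eqP => // ik; move: (ltn_ord i); rewrite ltnNge.
  by move: ge; rewrite -ik addnK => ->.
suff -> : pihomog mdeg (k - e) h = 0 by rewrite mul0r.
rewrite pihomogE big1_seq // => m /andP [/eqP mk /msize_mdeg_lt].
by rewrite mk ltnNge ge.
Qed.

Lemma add_gen_graded I e l : graded I -> is_ideal I -> l \is e.-homog -> graded (add_gen I l).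
Proof.
move=> gI [I0 _ _] hl d f [g [h [Ig ->]]].
exists (pihomog mdeg d g), (if (e <= d)%N then pihomog mdeg (d - e) h else 0).
split; first exact: gI.
by rewrite raddfD /= (pihomog_mul _ _ hl); case: ifP; rewrite // mul0r.
Qed.

Lemma contains_power_homog I k f : is_ideal I -> contains_power I k ->
  f \is k.-homog -> I f.
Proof.
move=> iI Ik hf; rewrite [f]mpolyE big_seq; apply: ideal_sum => // m mf.
by apply: idealZ => //; apply: Ik; apply: (dhomog_mf hf).
Qed.

Lemma contains_powerS I k : is_ideal I -> contains_power I k -> contains_power I k.+1.
Proof.
move=> iI Ik m mk.
have [i mi] : exists i, (0 < m i)%N.
  apply/existsP; apply: contraT; rewrite negb_exists => /forallP H.
  suff : mdeg m = 0%N by rewrite mk.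
  by rewrite mdegE big1 // => i _; apply/eqP; have := H i; rewrite lt0n negbK.
have mE : m = (U_(i) + (m - U_(i)))%MM.
  by rewrite addmC submK //; apply/mnm_lepP => j; rewrite mnm1E; case: eqP => // <-.
rewrite mE mpolyXD; have [_ _ IM] := iI; apply: IM; apply: Ik.
by apply/eqP; rewrite -eqSS -mk {2}mE mdegD mdeg1.
Qed.

Lemma contains_powerD I k j : is_ideal I -> contains_power I k -> contains_power I (k + j).
Proof.
by move=> iI Ik; elim: j => [|j IH]; rewrite ?addn0 // addnS; apply: contains_powerS.
Qed.

(** If [I + (l)] contains all monomials of degree [a] and [I + (g)] all those of degree [b], the
    products of these monomials lie in [I + (l * g)], which is [I]. *)
Lemma relevant_mul I l g : is_ideal I -> relevant I -> I (l * g) ->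
  relevant (add_gen I l) \/ relevant (add_gen I g).
Proof.
move=> iI rI Ilg; apply: contrapT => /not_orP [/existsNP [a /contrapT Ha] /existsNP [b /contrapT Hb]].
have [_ ID IM] := iI.
have Hab x y : add_gen I l x -> add_gen I g y -> I (x * y).
  move=> [x1 [x2 [Ix ->]]] [y1 [y2 [Iy ->]]].
  rewrite mulrDl; apply: (ID).
    by rewrite mulrC; apply: IM.
  rewrite mulrDr; apply: (ID); first exact: IM.
  by rewrite mulrACA; apply: IM.
apply: (rI (a + b)%N) => m mab.
have [m1 [m2 [mE m1a m2b]]] : exists m1 m2 : 'X_{1..n}, [/\ m = (m1 + m2)%MM, mdeg m1 = a & mdeg m2 = b].
  elim: a m mab {Ha} => [|a IH] m mab.
    by exists 0%MM, m; rewrite add0m mdeg0.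
  have [i mi] : exists i, (0 < m i)%N.
    apply/existsP; apply: contraT; rewrite negb_exists => /forallP H.
    suff : mdeg m = 0%N by rewrite mab addSn.
    by rewrite mdegE big1 // => i _; apply/eqP; have := H i; rewrite lt0n negbK.
  have mE : m = (U_(i) + (m - U_(i)))%MM.
    by rewrite addmC submK //; apply/mnm_lepP => j; rewrite mnm1E; case: eqP => // <-.
  have [|m1 [m2 [E1 E2 E3]]] := IH (m - U_(i))%MM.
    by apply/eqP; rewrite -eqSS -addSn -mab {2}mE mdegD mdeg1.
  by exists (U_(i) + m1)%MM, m2; rewrite {1}mE E1 addmA mdegD mdeg1 E2.
by rewrite mE mpolyXD; apply: Hab; [apply: Ha|apply: Hb].
Qed.

Lemma relevant_sub I I' : (forall f, I f -> I' f) -> relevant I' -> relevant I.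
Proof. by move=> II rI k Hk; apply: (rI k) => m /Hk /II. Qed.

(** Formally [v ^ T * P(u / v)], where the degree [T] may exceed that of [P]. *)
Definition homogenize (u v : R) T (P : {poly E}) : R :=
  \sum_(a < T.+1) P`_a *: (u ^+ a * v ^+ (T - a)).

Lemma homogenize_mulX u v T z (Q : {poly E}) : (size Q <= T.+1)%N ->
  homogenize u v T.+1 (('X - z%:P) * Q) = (u - z *: v) * homogenize u v T Q.
Proof.
move=> sQ; rewrite /homogenize [RHS]mulrBl.
transitivity (\sum_(a < T.+2) ('X * Q)`_a *: (u ^+ a * v ^+ (T.+1 - a))
   - \sum_(a < T.+2) (z%:P * Q)`_a *: (u ^+ a * v ^+ (T.+1 - a))).
  by rewrite -sumrB; apply: eq_bigr => a _; rewrite mulrBl coefB scalerBl.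
congr (_ - _).
  rewrite big_ord_recl coefXM scale0r add0r mulr_sumr; apply: eq_bigr => a _.
  by rewrite lift0 coefXM /= subSS exprS -mulrA scalerAr.
rewrite big_ord_recr /= coefCM (nth_default 0 sQ) mulr0 scale0r addr0 mulr_sumr.
apply: eq_bigr => a _; rewrite coefCM (subSn (leq_ord a)) exprS mulrCA -scalerA.
by rewrite -scalerAl -scalerAr.
Qed.

Lemma homogenize_small u v T (P : {poly E}) : (size P <= T.+1)%N ->
  homogenize u v T.+1 P = v * homogenize u v T P.
Proof.
move=> sP; rewrite /homogenize big_ord_recr /= (nth_default 0 sP) scale0r addr0 mulr_sumr.
by apply: eq_bigr => a _; rewrite (subSn (leq_ord a)) exprS mulrCA scalerAr.
Qed.

Hypothesis closedE : forall p : {poly E}, (1 < size p)%N -> exists z, root p z.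

(** Over an algebraically closed field the binary form splits into linear factors [u - z *: v] and
    [v], the latter coming from a drop in degree. By [relevant_mul] one of the factors can be added
    to [I]. *)
Lemma relevant_homogenize u v T (P : {poly E}) I : is_ideal I -> relevant I ->
  P != 0 -> (size P <= T.+1)%N -> I (homogenize u v T P) ->
  exists al be : E, (al, be) != (0, 0) /\ relevant (add_gen I (al *: u + be *: v)).
Proof.
elim: T P I => [|T IH] P I iI rI P0 sP IP.
  case: (rI 0%N) => m /eqP; rewrite mdeg_eq0 => /eqP ->.
  move: IP; rewrite /homogenize big_ord1 !expr0 mulr1.
  move=> /(idealZ (P`_0)^-1 iI); rewrite scalerA mulVf ?scale1r ?mpolyX0 //.
  apply: contraNneq P0 => P00; rewrite -size_poly_eq0.
  by rewrite (size1_polyC sP) P00 size_poly0.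
have rec (Q : {poly E}) l : Q != 0 -> (size Q <= T.+1)%N -> (exists al be, (al, be) != (0, 0) /\ l = al *: u + be *: v) ->
    I (l * homogenize u v T Q) ->
    exists al be : E, (al, be) != (0, 0) /\ relevant (add_gen I (al *: u + be *: v)).
  move=> Q0 sQ [al [be [ab lE]]] Il; have [r|r] := relevant_mul iI rI Il.
    by exists al, be; rewrite -lE.
  have [] := IH Q _ (add_gen_ideal _ iI) r Q0 sQ (add_gen_mem _ iI).
  move=> al' [be' [ab' r']]; exists al', be'; split=> //.
  apply: relevant_sub r' => f [g [h [Ig ->]]].
  by exists g, h; split=> //; apply: add_gen_sub.
have [sP'|sP'] := leqP (size P) T.+1.
  apply: (rec P v) => //; last by rewrite -homogenize_small.
  exists 0, 1; rewrite scale0r scale1r add0r; split=> //.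
  by rewrite xpair_eqE eqxx oner_eq0.
have [|z /factor_theorem [Q PE]] := closedE (p := P); first by apply: leq_ltn_trans sP'.
have Q0 : Q != 0 by apply: contraNneq P0 => Q0; rewrite PE Q0 mul0r.
have sQ : (size Q <= T.+1)%N.
  by move: sP; rewrite PE size_Mmonic ?monicXsubC // size_XsubC addn2.
apply: (rec Q (u - z *: v)) => //; last by rewrite -homogenize_mulX // mulrC -PE.
exists 1, (- z); rewrite scale1r scaleNr; split=> //.
by rewrite xpair_eqE oner_eq0.
Qed.

(** Modulo [I] a form of degree above [k] is a multiple of [v]; passing to homogeneous components,
    one factor [v] is extracted at a time. *)
Lemma power_reduction I v k D f : is_ideal I -> graded I -> v \is 1.-homog ->
  contains_power (add_gen I v) k.+1 -> f \is (k + D).-homog ->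
  exists2 w, w \is k.-homog & I (f - v ^+ D * w).
Proof.
move=> iI gI hv Hk; have [I0 ID IM] := iI; elim: D f => [|D IH] f hf.
  by exists f; rewrite ?addn0 // in hf *; rewrite expr0 mul1r subrr.
have [g [h [Ig fE]]] : add_gen I v f.
  apply: contains_power_homog hf; first exact: add_gen_ideal.
  by rewrite addnS -addSn; apply: contains_powerD => //; apply: add_gen_ideal.
have [w hw Hw] := IH (pihomog mdeg (k + D) h) (pihomogP _ _ _).
exists w => //.
have fE' : f = pihomog mdeg (k + D.+1) g + pihomog mdeg (k + D) h * v.
  rewrite -[LHS](pihomog_dE hf) {1}fE raddfD /= (pihomog_mul _ _ hv).
  by rewrite addnS /= subn1.
rewrite fE' -addrA; apply: (ID); first exact: gI.
by rewrite exprS mulrC -mulrA -mulrBr; apply: IM.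
Qed.

(** If [v] itself cannot be added, each [u ^+ a * v ^+ (T - a)] equals [v ^+ D * w a] modulo [I],
    with [w a] of degree [k]. There are more of the [w a] than monomials of degree at most [k], and
    a linear relation among them puts a nonzero binary form in [u] and [v] into [I]. *)
Lemma relevant_pair I u v : is_ideal I -> graded I -> relevant I ->
  u \is 1.-homog -> v \is 1.-homog ->
  exists al be : E, (al, be) != (0, 0) /\ relevant (add_gen I (al *: u + be *: v)).
Proof.
move=> iI gI rI hu hv; have [rv|] := pselect (relevant (add_gen I v)).
  exists 0, 1; rewrite scale0r scale1r add0r; split=> //.
  by rewrite xpair_eqE eqxx oner_eq0.
move=> /existsNP [k0 /contrapT /(contains_powerS (add_gen_ideal _ iI)) Hk].
move: k0 Hk => k Hk; have [I0 ID IM] := iI.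
pose J := 'X_{1..n < k.+1}; pose D := #|{: J}|; pose T := (k + D)%N.
have hT (a : 'I_D.+1) : u ^+ a * v ^+ (T - a) \is (k + D).-homog.
  have -> : (k + D = 1 * a + 1 * (T - a))%N.
    by rewrite !mul1n subnKC // /T; apply: leq_trans (leq_addl _ _); rewrite -ltnS.
  by apply: dhomogM; apply: dhomogMn.
have /choice [w Hw] : forall a : 'I_D.+1, exists w : R,
    w \is k.-homog /\ I (u ^+ a * v ^+ (T - a) - v ^+ D * w).
  by move=> a; have [w hw Iw] := power_reduction iI gI hv Hk (hT a); exists w.
have : ~ free_fam w.
  move=> fw; have := free_fam_le fw (X' := fun m : J => 'X_[m]).
  rewrite card_ord -/D ltnn => H; suff : false by [].
  apply: H => a; have [hw _] := Hw a.
  exists (fun m : J => (w a)@_m); apply: mpolywE.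
  rewrite msizeE; apply/bigmax_leqP_seq => m mw _.
  by rewrite (dhomog_mf hw mw).
move=> /existsNP [c /not_implyP [cS /existsNP [i0 ci0]]].
pose P := \poly_(a < D.+1) c (inord a).
have PE (a : 'I_D.+1) : P`_a = c a by rewrite coef_poly ltn_ord inord_val.
have DT : (D.+1 <= T.+1)%N by rewrite ltnS leq_addl.
apply: (@relevant_homogenize u v T P I) => //.
- by apply/eqP => P0; apply: ci0; rewrite -PE P0 coef0.
- exact: leq_trans (size_poly _ _) DT.
have -> : homogenize u v T P = \sum_(a < D.+1) c a *: (u ^+ a * v ^+ (T - a) - v ^+ D * w a).
  transitivity (\sum_(a < D.+1) c a *: (u ^+ a * v ^+ (T - a))).
    pose F (a : nat) := P`_a *: (u ^+ a * v ^+ (T - a)).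
    transitivity (\sum_(a < D.+1) F a); last by apply: eq_bigr => a _; rewrite /F PE.
    rewrite (big_ord_widen _ F DT) [RHS]big_mkcond; apply: eq_bigr => a _.
    by case: ifP => // aD; rewrite coef_poly aD scale0r.
  under [RHS]eq_bigr do rewrite scalerBr.
  rewrite sumrB [X in _ - X](_ : _ = 0) ?subr0 //.
  under eq_bigr do rewrite scalerAr.
  by rewrite -mulr_sumr cS mulr0.
apply: ideal_sum => // a _; apply: idealZ => //.
by have [] := Hw a.
Qed.

Section Point.

Variable I0 : R -> Prop.
Hypotheses (iI0 : is_ideal I0) (gI0 : graded I0) (rI0 : relevant I0).

(** Linear forms are added until, modulo [I], each variable treated is a multiple of the pivot
    ['X_i0]. If a new relation does not involve the new variable ['X_k], it kills the pivot and with
    it all earlier variables, and ['X_k] becomes the pivot. *)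
Lemma relevant_ratios j : (j < n)%N -> exists I (i0 : 'I_n) (a : 'I_n -> E),
  [/\ is_ideal I, graded I, relevant I, forall f, I0 f -> I f &
     [/\ (i0 <= j)%N, a i0 = 1 & forall i : 'I_n, (i <= j)%N -> I ('X_i - a i *: 'X_i0)]].
Proof.
elim: j => [|j IH] jn.
  exists I0, (Ordinal jn), (fun=> 1); split=> //; split=> // i.
  rewrite leqn0 => i0; have -> : i = Ordinal jn by apply/val_inj/eqP.
  by rewrite scale1r subrr; case: iI0.
have [I [i0 [a [iI gI rI sI [i0j ai0 Ha]]]]] := IH (ltnW jn).
pose k := Ordinal jn.
have h1 (i : 'I_n) : ('X_i : R) \is 1.-homog by rewrite dhomogX /= mdeg1.
have [al [be [ab rI']]] := relevant_pair iI gI rI (h1 k) (h1 i0).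
set l := al *: 'X_k + be *: 'X_i0 in rI'.
have iI' := add_gen_ideal l iI.
have gI' : graded (add_gen I l).
  by apply: (@add_gen_graded _ 1) => //; apply: rpredD; apply: rpredZ; apply: h1.
have sI' f : I f -> add_gen I l f by apply: add_gen_sub.
have lI' : add_gen I l l by apply: add_gen_mem.
have [_ ID IM] := iI'.
have [al0|al0] := eqVneq al 0.
  have be0 : be != 0 by apply: contraNneq ab => ->; rewrite al0.
  have Hi0 : add_gen I l 'X_i0.
    have := idealZ be^-1 iI' lI'.
    by rewrite /l al0 scale0r add0r scalerA mulVf // scale1r.
  exists (add_gen I l), k, (fun i => (i == k)%:R); split=> //; first by move=> f /sI /sI'.
  rewrite eqxx; split=> // i; rewrite leq_eqVlt => /orP [/eqP ik|ij].
    have -> : i = k by apply: val_inj.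
    by rewrite eqxx scale1r subrr; case: iI'.
  have /negbTE -> : i != k by rewrite -val_eqE /= ltn_eqF.
  rewrite scale0r subr0 -['X_i](subrK (a i *: 'X_i0)); apply: ID.
    by apply/sI'/Ha; rewrite -ltnS.
  exact: idealZ.
exists (add_gen I l), i0, (fun i => if i == k then - be / al else a i); split=> //.
  by move=> f /sI /sI'.
have i0k : i0 != k by rewrite -val_eqE /= ltn_eqF.
split; first exact: leqW.
  by rewrite (negbTE i0k).
move=> i; rewrite leq_eqVlt => /orP [/eqP ik|ij].
  have -> : i = k by apply: val_inj.
  rewrite eqxx; have := idealZ al^-1 iI' lI'.
  by rewrite /l scalerDr !scalerA mulVf // scale1r mulNr scaleNr opprK (mulrC be).
have /negbTE -> : i != k by rewrite -val_eqE /= ltn_eqF.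
by apply/sI'/Ha; rewrite -ltnS.
Qed.

(** Modulo [I], a form [f] of degree [d] is [f.@[a] *: 'X_i0 ^+ d]. If [f] is in [I] and [f.@[a]] is
    nonzero, then ['X_i0 ^+ d] is in [I], hence so are all monomials of degree [d], against
    relevance. *)
Lemma relevant_point : (0 < n)%N -> exists a : 'I_n -> E, (exists i, a i != 0) /\
  forall d f, f \is d.-homog -> I0 f -> f.@[a] = 0.
Proof.
move=> n0; have [|I [i0 [a [iI gI rI sI [_ ai0 Ha]]]]] := @relevant_ratios n.-1.
  by rewrite prednK.
have [I00 ID IM] := iI.
exists a; split; first by exists i0; rewrite ai0 oner_eq0.
have Hm (m : 'X_{1..n}) : I ('X_[m] - (\prod_i a i ^+ m i) *: 'X_i0 ^+ mdeg m).
  have cM x y z w : I (x - y) -> I (z - w) -> I (x * z - y * w).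
    move=> Hxy Hzw; have -> : x * z - y * w = z * (x - y) + y * (z - w).
      by rewrite !mulrBr (mulrC z) (mulrC z y) addrA subrK.
    by apply: ID; apply: IM.
  have cX x y k : I (x - y) -> I (x ^+ k - y ^+ k).
    move=> Hxy; elim: k => [|k IH]; first by rewrite !expr0 subrr.
    by rewrite !exprS; apply: cM.
  rewrite mpolyXE_id mdegE -prodrXr.
  rewrite (_ : _ *: _ = \prod_i (a i *: 'X_i0) ^+ m i); last first.
    under [RHS]eq_bigr do rewrite exprZn.
    by rewrite scaler_prod.
  elim/big_rec2: _ => [|i x y _ Hxy]; first by rewrite subrr.
  by apply: cM => //; apply: cX; apply: Ha; rewrite -ltnS prednK.
move=> d f hf /sI If; apply/eqP; apply: contraT => fa; exfalso.
have fX : I (f - f.@[a] *: 'X_i0 ^+ d).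
  rewrite {1}[f]mpolyE mevalE scaler_suml -sumrB big_seq.
  apply: ideal_sum => // m mf; rewrite -scalerA -scalerBr; apply: idealZ => //.
  by rewrite -(dhomog_mf hf mf); apply: Hm.
have X0 : I ('X_i0 ^+ d).
  have := idealB iI If fX; rewrite opprB addrCA subrr addr0.
  by move/(idealZ (f.@[a])^-1 iI); rewrite scalerA mulVf // scale1r.
apply: (rI d) => m md; rewrite -['X_[m]](subrK ((\prod_i a i ^+ m i) *: 'X_i0 ^+ mdeg m)).
by apply: ID; [exact: Hm|rewrite md; apply: idealZ].
Qed.

End Point.

Section Counting.

Variables (d r : nat) (p : 'I_r -> R).
Hypotheses (d0 : (0 < d)%N) (hp : forall a, p a \is d.-homog).

Definition gen_ideal : R -> Prop := fun f => exists h : 'I_r -> R, f = \sum_a h a * p a.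

Lemma gen_ideal_ideal : is_ideal gen_ideal.
Proof.
split=> [|f g [h ->] [k ->]|f g [h ->]].
- by exists (fun=> 0); rewrite big1 // => a _; rewrite mul0r.
- exists (fun a => h a + k a); rewrite -big_split /=.
  by apply: eq_bigr => a _; rewrite mulrDl.
- exists (fun a => f * h a); rewrite mulr_sumr.
  by apply: eq_bigr => a _; rewrite mulrA.
Qed.

Lemma gen_ideal_graded : graded gen_ideal.
Proof.
move=> k f [h ->]; exists (fun a => if (d <= k)%N then pihomog mdeg (k - d) (h a) else 0).
rewrite raddf_sum /=; apply: eq_bigr => a _; rewrite (pihomog_mul _ _ (hp a)).
by case: ifP; rewrite ?mul0r.
Qed.

Lemma gen_ideal_mem a : gen_ideal (p a).
Proof.
exists (fun b => (b == a)%:R); rewrite (bigD1 a) //= eqxx mul1r big1 ?addr0 //.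
by move=> b /negbTE ->; rewrite mul0r.
Qed.

(* If the ideal contained all monomials of degree k, polynomials would be
   combinations of the monomials of degree < k over the subalgebra generated
   by the p a, which grows too slowly. *)
Lemma gen_ideal_relevant : (r < n)%N -> relevant gen_ideal.
Proof.
move=> rn k Hk; pose J := 'X_{1..n < k}.
pose G T (x : {ffun 'I_r -> 'I_T.+1} * J) : R :=
  (\prod_a p a ^+ x.1 a) * 'X_[x.2].
have span T D (al : 'I_r -> nat) f : (\sum_a al a + D <= T)%N -> f \is D.-homog ->
    spanned_by (@G T) ((\prod_a p a ^+ al a) * f).
  have [D'] := ubnP D; elim: D' => // D' IH in D al f *; rewrite ltnS => DD' aT hf.
  have [Dk|kD] := ltnP D k.
    rewrite [f]mpolyE mulr_sumr big_seq; apply: spanned_sum => m mf.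
    rewrite -scalerAr; apply: spannedZ.
    have mk : (mdeg m < k)%N by rewrite (dhomog_mf hf mf).
    have alT a : (al a < T.+1)%N.
      rewrite ltnS; apply: leq_trans aT; apply: leq_trans (leq_addr _ _).
      by rewrite (bigD1 a) //= leq_addr.
    have := spanned_mem (@G T) ([ffun a => Ordinal (alT a)], BMultinom mk).
    rewrite /G /=; congr (spanned_by _ (_ * _)).
    by apply: eq_bigr => a _; rewrite ffunE.
  have [h fE] : gen_ideal f.
    apply: contains_power_homog hf; first exact: gen_ideal_ideal.
    by rewrite -(subnKC kD); apply: contains_powerD => //; apply: gen_ideal_ideal.
  have {}fE : f = \sum_a (if (d <= D)%N then pihomog mdeg (D - d) (h a) else 0) * p a.
    rewrite -[LHS](pihomog_dE hf) fE raddf_sum /=; apply: eq_bigr => a _.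
    by rewrite (pihomog_mul _ _ (hp a)); case: ifP; rewrite ?mul0r.
  rewrite fE mulr_sumr; apply: spanned_sum => a _.
  case: leqP => dD; last by rewrite mul0r mulr0; apply: (spanned_lin_closed _).1.
  have -> : (\prod_b p b ^+ al b) * (pihomog mdeg (D - d) (h a) * p a) =
      (\prod_b p b ^+ (al b + (b == a))) * pihomog mdeg (D - d) (h a).
    rewrite -[RHS]mulrC -[LHS]mulrC -mulrA; congr (_ * _).
    rewrite (bigD1 a) //= [RHS](bigD1 a) //= eqxx addn1 exprS -mulrA; congr (_ * (_ * _)).
    by apply: eq_bigr => b /negbTE ->; rewrite addn0.
  apply: IH (pihomogP _ _ _).
    by apply: leq_trans DD'; rewrite ltn_subrL d0 (leq_trans d0 dD).
  have S1 : (\sum_(b < r) (b == a) = 1)%N.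
    by rewrite (bigD1 a) //= eqxx big1 // => b /negbTE ->.
  rewrite big_split /= S1 -addnA; apply: leq_trans aT.
  by rewrite leq_add2l addnBA // leq_subLR leq_add2r.
(* The choice of [u] gives [(n * u.+1) ^ r * C0 = u * u.+1 ^ r], which is less than the number
   [u.+1 ^ n] of monomials with exponents at most [u]. *)
pose C0 := #|{: J}|; pose u := (n ^ r * C0)%N; pose T := (n * u)%N.
pose X (x : {ffun 'I_n -> 'I_u.+1}) : R := 'X_[[multinom (x i : nat) | i < n]].
have fX : free_fam X.
  move=> c cS x; have := congr1 (mcoeff [multinom (x i : nat) | i < n]) cS.
  rewrite mcoeff0 raddf_sum (bigD1 x) //= big1 => [|y yx].
    by rewrite addr0 mcoeffZ mcoeffX eqxx mulr1.
  rewrite mcoeffZ mcoeffX; case: eqP => [/mnmP xy|_]; last by rewrite mulr0.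
  by case/eqP: yx; apply/ffunP => i; apply: val_inj; have := xy i; rewrite !mnmE.
have sX x : spanned_by (@G T) (X x).
  have := span T (mdeg [multinom (x i : nat) | i < n]) (fun=> 0%N) (X x).
  rewrite big1 // add0n (eq_bigr (fun=> 1)) ?big1 ?mul1r //; apply; last by rewrite dhomogX.
  rewrite mdegE /T -[n in (n * _)%N](card_ord n) -sum_nat_const; apply: leq_sum => i _.
  by rewrite mnmE -ltnS.
have := free_fam_le fX sX.
rewrite card_prod !card_ffun !card_ord -/C0.
have T1 : (T.+1 <= n * u.+1)%N by rewrite /T mulnS -addn1 addnC leq_add2r (leq_trans _ rn).
have n0 : (0 < n)%N by apply: leq_trans rn.
have H1 : (T.+1 ^ r <= (n * u.+1) ^ r)%N.
  by case: (posnP r) => [->|r0]; rewrite ?expn0 // leq_exp2r.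
have H2 : (u.+1 ^ r.+1 <= u.+1 ^ n)%N by rewrite leq_pexp2l.
move=> H3; have : (u.+1 * u.+1 ^ r <= u * u.+1 ^ r)%N.
  rewrite -expnS; apply: leq_trans H2 _; apply: leq_trans H3 _.
  apply: leq_trans (_ : (n * u.+1) ^ r * C0 <= _)%N; first by rewrite leq_mul2r H1 orbT.
  by rewrite expnMn /u mulnAC.
by rewrite leq_pmul2r ?expn_gt0 // ltnn.
Qed.

End Counting.

End ProjectiveNullstellensatz.

Lemma sys_zero_closed (E : fieldType) :
  (forall p : {poly E}, (1 < size p)%N -> exists z, root p z) -> sys_zero 0 E.
Proof.
move=> clE d r I f d0 Hf; rewrite expn0 muln1 => lt.
have /choice [p Hp] : forall a, exists p : {mpoly E[#|I|]}, p \is d.-homog /\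
    forall x, f a x = p.@[fun k => x (enum_val k)].
  by move=> a; have [p ? ?] := Hf a; exists p.
have hp a : p a \is d.-homog by have [] := Hp a.
have [|x [[i xi] Hx]] := relevant_point clE (gen_ideal_ideal p) (gen_ideal_graded hp)
  (gen_ideal_relevant d0 hp lt).
  exact: leq_ltn_trans lt.
exists (fun j => x (enum_rank j)); split; first by exists (enum_val i); rewrite enum_valK.
move=> a; have [_ ->] := Hp a; rewrite -[RHS](Hx d (p a) (hp a) (gen_ideal_mem p a)).
by apply: meval_eq => k; rewrite enum_valK.
Qed.

(** Over an algebraically closed field even level 0 holds; otherwise an anisotropic norm form exists
    and Nagata's argument applies. *)
Lemma Cfield_sys_zero m (E : fieldType) : Cfield m E -> sys_zero m E.
Proof.
move=> Cm; have [clE|] := pselect (forall p : {poly E}, (1 < size p)%N -> exists z, root p z).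
  exact: sys_zero_le (sys_zero_closed clE).
move=> /existsNP [p /not_implyP [p1 pr]].
have [|e e1 ae] := no_root_aniso p1.
  by move=> z; apply/negP => pz; apply: pr; exists z.
exact: nagata_sys_zero Cm e1 ae.
Qed.

(** * Finitely generated extensions *)

Section Inclusion.

Variables (F : fieldType) (S T : F -> Prop).
Hypothesis ST : forall x : gfield S, genfield T (gval x).

Local Notation gincl := (corestrict ST).

Lemma gval_horner_corestrict p z :
  gval ((map_poly gincl p).[z]) = (map_poly (@gval F S) p).[gval z].
Proof.
by rewrite -horner_map -map_poly_comp.
Qed.

Lemma corestrict_algebraic z : acl S (gval z) -> algebraicOver gincl z.
Proof.
move=> [p p0 pz]; exists p => //; apply/eqP/(fmorph_inj (@gval F T)).
by rewrite /= gval_horner_corestrict; apply/eqP.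
Qed.

End Inclusion.

Lemma polyOver_gval (F : fieldType) (S : F -> Prop) (a : {poly F}) :
  a \is a polyOver (genfield_pred S) -> exists a', map_poly (@gval F S) a' = a.
Proof.
move=> /polyOverP aS; exists (\poly_(i < size a) GField (aS i)).
apply/polyP => i; rewrite coef_map coef_poly; case: ltnP => [_ //|sz].
by rewrite [RHS]nth_default.
Qed.

Section Image.

Variables (L F : fieldType) (i : {rmorphism L -> F}).

Lemma genfield_im z : genfield (im i) z -> im i z.
Proof.
elim=> {z} [//||x y _ [a ->] _ [b ->]|x y _ [a ->] _ [b ->]].
- by exists 1; rewrite rmorph1.
- by exists (a - b); rewrite rmorphB.
- by exists (a / b); rewrite fmorph_div.
Qed.

Lemma sys_zero_image m : sys_zero m L -> sys_zero m (gfield (im i)).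
Proof.
have iS a : genfield (im i) (i a) by apply: genfield_mem; exists a.
move=> SL; apply: (sys_zero_algebraic (phi := corestrict iS)) SL _ => z.
have /genfieldP/genfield_im [a za] := gvalP z.
by have -> : z = corestrict iS a; [exact: val_inj|exact: algebraic_id].
Qed.

End Image.

(** An algebraic [w] keeps the level [m]; a transcendental one raises it by one. *)
Lemma sys_zero_adjoin (F : fieldType) (S : F -> Prop) w m :
  sys_zero m (gfield S) -> sys_zero m.+1 (gfield (adjoin S w)).
Proof.
have ST (x : gfield S) : genfield (adjoin S w) (gval x).
  by have /genfieldP := gvalP x; apply: genfield_sub => y Sy; apply: genfield_mem; left.
move=> SS; have [Sw|Sw] := pselect (acl S w).
  apply: sys_zero_le (leqnSn m) _.
  apply: (sys_zero_algebraic (phi := corestrict ST)) SS _ => z.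
  apply: corestrict_algebraic; have /genfieldP := gvalP z.
  by apply: genfield_sub_acl => y [/acl_mem|->].
have Hw : w \in genfield_pred (adjoin S w) by apply/genfieldP/genfield_mem; right.
apply: (@sys_zero_transcendental _ _ (corestrict ST) (GField Hw)) SS => [p p0|z].
  apply/eqP => pw; apply: Sw; exists p => //; apply/rootP.
  by have := congr1 (@gval F _) pw; rewrite /= gval_horner_corestrict.
have /genfieldP/genfield_frac [a [b [Ha Hb b0 zE]]] := gvalP z.
have [a' aE] := polyOver_gval Ha; have [b' bE] := polyOver_gval Hb.
exists a', b'; split.
  apply: contraNneq b0 => b0; have := congr1 (@gval F _) b0.
  by rewrite /= gval_horner_corestrict bE => /eqP.
apply: val_inj; rewrite [LHS]zE.
rewrite -[RHS]/(@gval F _ _) fmorph_div /=.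
by rewrite !gval_horner_corestrict aE bE.
Qed.

Lemma sys_zero_adjoin_seq (F : fieldType) (S : F -> Prop) ws m :
  sys_zero m (gfield S) -> (forall z : F, acl (adjoin_seq S ws) z) ->
  sys_zero (m + size ws) F.
Proof.
elim: ws S m => [|w ws IH] S m SS Hz.
  rewrite addn0; apply: (sys_zero_algebraic (phi := @gval F S)) SS _ => z.
  by apply: acl_sub (Hz z) => y [].
rewrite /= addnS -addSn; apply: (IH (adjoin S w)); first exact: sys_zero_adjoin.
move=> z; apply: acl_sub (Hz z) => y [Sy|]; first by left; left.
by rewrite inE => /orP [/eqP ->|yw]; [left; right|right].
Qed.

(** The elements of [ws] are adjoined one at a time to the image of [L]; what remains is
    algebraic. *)
Lemma Cfield_extension (L M : fieldType) (i : {rmorphism L -> M}) ws m :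
  Cfield m L -> (forall z, acl (adjoin_seq (im i) ws) z) ->
  Cfield (m + size ws) M.
Proof.
move=> CL Hz; apply: sys_zero_Cfield; apply: sys_zero_adjoin_seq Hz.
exact/sys_zero_image/Cfield_sys_zero.
Qed.

(** * Splitting fields *)

Lemma root_extension (F : fieldType) (p : {poly F}) : (1 < size p)%N ->
  exists (F' : fieldType) (b : {rmorphism F -> F'}) (z : F'), root (map_poly b p) z.
Proof.
move=> p1.
pose Q n := `[< exists q : {poly F}, [/\ size q = n, (1 < size q)%N & q %| p] >].
have exQ : exists n, Q n by exists (size p); apply/asboolP; exists p.
case: (ex_minnP exQ) => n /asboolP [q [<- q1 qp]] min.
have irr : irreducible_poly q.
  split=> // r r1 rq; have q0 : q != 0 by rewrite -size_poly_eq0 -lt0n ltnW.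
  rewrite -dvdp_size_eqp // eqn_leq dvdp_leq //=.
  apply: min; apply/asboolP; exists r; split=> //; last exact: dvdp_trans qp.
  rewrite ltn_neqAle eq_sym r1 lt0n size_poly_eq0.
  by apply: contraNneq q0 => r0; move: rq; rewrite r0 dvd0p.
have [E1 _ [z qz _]] := irredp_FAdjoin irr.
exists E1, (in_alg E1), z; case/dvdpP: qp => r ->.
by rewrite rmorphM rootM qz orbT.
Qed.

Section CommutantSplitting.

Variables (K E : fieldType) (phi : {rmorphism K -> E}) (A : falgType K) (n : nat).
Hypotheses (csA : central_simple A) (dA : has_degree A n).

(** A commutant reduced to the scalars has dimension 1, and then [intertwines_dim] reads
    [n ^ 2 = k ^ 2]. *)
Lemma nonscalar_commutant k (r : A -> 'M[E]_k) : is_rep phi r -> (0 < k)%N ->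
  k <> n -> exists C, ~~ is_scalar_mx C /\ forall x, r x *m C = C *m r x.
Proof.
move=> rr k0 kn; apply: contrapT => Hno.
pose R (_ : 'I_1) := r.
have qR : is_qrep phi R by split=> // a b x y; rewrite (ord1 a) (ord1 b) eqxx.
have sc C : intertwines R R 1 C -> exists c, C = c%:M.
  move=> HC; apply/is_scalar_mxP; apply: contraT => nC; case: Hno.
  by exists C; split=> // x; apply: (HC ord0).
have [m [X bX]] := intertwines_basis R R.
have := intertwines_dim csA qR qR bX; rewrite card_ord expn1 dA => dm.
have [PX sX fX] := bX.
have m1 : m = 1%N.
  apply/eqP; rewrite eqn_leq; apply/andP; split.
    rewrite -[m]card_ord -[X in (_ <= X)%N](card_ord 1).
    apply: (free_fam_le fX (X' := fun _ : 'I_1 => 1%:M)) => j.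
    have [c ->] := sc _ (PX j).
    by exists (fun=> c); rewrite big_ord1 scalemx1.
  by case: (posnP m) dm => // ->; rewrite muln0 => /esym/eqP; rewrite muln_eq0 orbb => /eqP k00; rewrite k00 in k0.
move: dm; rewrite m1 muln1 mulnn => /eqP; rewrite eqn_exp2r // => /eqP nk.
by apply: kn.
Qed.

End CommutantSplitting.

(** Descent on the dimension, from the regular representation: a nonscalar commuting matrix [C]
    acquires an eigenvalue [z] in an extension, and the kernel of [C - z] is a smaller module. The
    splitting field is kept inside an extension [F'] of [F], where modules over it and over [F] can
    be compared. *)
Lemma splitting_extension (K F : fieldType) (j : {rmorphism K -> F})
    (A : falgType K) n : central_simple A -> has_degree A n ->
  exists (F' : fieldType) (b : {rmorphism F -> F'}) (T : F' -> Prop)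
    (jT : forall x, genfield T ((b \o j) x)),
    (forall z, T z -> acl (im (b \o j)) z) /\
    exists r : A -> 'M[gfield T]_n, is_rep (corestrict jT) r.
Proof.
move=> csA dA.
suff main k : forall (F' : fieldType) (b : {rmorphism F -> F'}) (T : F' -> Prop)
    (jT : forall x, genfield T ((b \o j) x)),
    (forall z, T z -> acl (im (b \o j)) z) -> (0 < k)%N ->
    (exists r : A -> 'M[gfield T]_k, is_rep (corestrict jT) r) ->
  exists (F' : fieldType) (b : {rmorphism F -> F'}) (T : F' -> Prop)
    (jT : forall x, genfield T ((b \o j) x)),
    (forall z, T z -> acl (im (b \o j)) z) /\
    exists r : A -> 'M[gfield T]_n, is_rep (corestrict jT) r.
  have jT x : genfield (im (idfun \o j)) ((idfun \o j) x).
    by apply: genfield_mem; exists x.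
  apply: (main (\dim {:A}) F idfun (im (idfun \o j)) jT).
  - by move=> z; apply: acl_mem.
  - exact: dim_alg_gt0.
  exists (fun x => \matrix_(a, c) corestrict jT (crd c (bas a * x))); split.
  - by move=> x y; apply/matrixP => a c; rewrite !mxE mulrDr /crd linearD rmorphD.
  - move=> d x; apply/matrixP => a c; rewrite !mxE -scalerAr /crd linearZ.
    by rewrite -rmorphM.
  - by apply/matrixP => a c; rewrite !mxE mulr1 crd_bas rmorph_nat eq_sym.
  - move=> x y; apply/matrixP => a c; rewrite !mxE mulrA -crd_mull rmorph_sum.
    by apply: eq_bigr => l _; rewrite !mxE rmorphM.
have [d] := ubnP k; elim: d k => // d IH k; rewrite ltnS => kd.
move=> F' b T jT Talg k0 [r rr].
have [kn|kn] := eqVneq k n.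
  by subst k; exists F', b, T, jT; split=> //; exists r.
have [C [nC HC]] := nonscalar_commutant csA dA rr k0 (elimN eqP kn).
pose p := char_poly C.
have [|F2 [b2 [z pz]]] := root_extension (p := map_poly (@gval _ T) p).
  by rewrite size_map_poly size_char_poly ltnS.
pose b' : {rmorphism F -> F2} := b2 \o b.
pose T' : F2 -> Prop := fun y => (exists2 x, genfield T x & y = b2 x) \/ y = z.
have gT (x : gfield T) : genfield T' ((b2 \o @gval _ T) x).
  by apply: genfield_mem; left; exists (gval x) => //; apply/genfieldP/gvalP.
have jT' x : genfield T' ((b' \o j) x).
  by apply: genfield_mem; left; exists (b (j x)) => //; apply: jT.
pose psi : {rmorphism gfield T -> gfield T'} := corestrict gT.
have b2alg x : genfield T x -> acl (im (b' \o j)) (b2 x).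
  move=> Tx; apply: (@acl_map _ _ b2 (im (b \o j))); last exact: genfield_sub_acl Tx.
  by move=> _ [y ->]; apply: acl_mem; exists y.
have Talg' y : T' y -> acl (im (b' \o j)) y.
  move=> [[x Tx ->]|->]; first exact: b2alg.
  apply: (@acl_root _ _ (map_poly b2 (map_poly (@gval _ T) p))) pz.
    by rewrite !map_poly_eq0 monic_neq0 // char_poly_monic.
  by move=> i; rewrite !coef_map /=; apply: b2alg; apply/genfieldP/gvalP.
have zT' : genfield T' z by apply: genfield_mem; right.
pose w : gfield T' := GField (introT (genfieldP T' z) zT').
have pw : root (char_poly (map_mx psi C)) w.
  rewrite -map_char_poly; apply/eqP/(fmorph_inj (@gval _ T')).
  rewrite rmorph0 -horner_map /= -map_poly_comp; move/eqP: pz.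
  by rewrite -map_poly_comp.
pose Y := map_mx psi C - w%:M.
have Ysing : (\rank Y < k)%N.
  rewrite -eigenvalue_root_char in pw; have /eigenvalueP [v vY v0] := pw.
  rewrite ltn_neqAle rank_leq_row andbT; apply: contraNN v0 => fY.
  apply/eqP/(row_free_inj fY); rewrite mul0mx mulmxBr vY mul_mx_scalar.
  by rewrite subrr.
have Y0 : (0 < \rank Y)%N.
  rewrite lt0n mxrank_eq0; apply: contraNN nC; rewrite subr_eq0 => /eqP CE.
  apply/is_scalar_mxP; exists (C (Ordinal k0) (Ordinal k0)).
  apply/matrixP => i l; apply: (fmorph_inj psi).
  have H i' l' : psi (C i' l') = (w%:M : 'M_k) i' l' by rewrite -CE mxE.
  by rewrite mxE rmorphMn /= !H !mxE eqxx.
pose r' x := map_mx psi (r x).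
have rr' : is_rep (corestrict jT') r'.
  by apply: (is_rep_map (psi := psi) _ rr) => x; apply: val_inj.
pose R (_ : 'I_1) := r'.
have qR : is_qrep (corestrict jT') R by split=> // a c x y; rewrite (ord1 a) (ord1 c) eqxx.
have HY : intertwines R R 1 Y.
  move=> a _ x; rewrite /R /r' /Y mulmxBr mulmxBl -!map_mxM HC.
  by rewrite scalar_mxC.
have [S qS] := kernel_rep qR HY.
apply: (IH (k - \rank Y)%N _ F2 b' T' jT' Talg').
- by apply: leq_trans kd; rewrite ltn_subrL k0 Y0.
- by rewrite subn_gt0.
- by exists (S ord0); apply: (qrep_rep qS).
Qed.

(** * Tensor products and scalar extension *)

(** Algebra morphisms that are linear along [phi]; they encode maps out of a scalar extension and
    compose across several fields. *)
Record is_shom (K E : fieldType) (phi : {rmorphism K -> E}) (A : algType K)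
    (C : algType E) (f : A -> C) : Prop := IsShom {
  shomD : {morph f : x y / x + y >-> x + y};
  shomZ : forall c x, f (c *: x) = phi c *: f x;
  shom1 : f 1 = 1;
  shomM : {morph f : x y / x * y >-> x * y}
}.

Section ShomTheory.

Variables (K E : fieldType) (phi : {rmorphism K -> E}) (A : algType K) (C : algType E).
Variable f : A -> C.
Hypothesis hf : is_shom phi f.

Lemma shom0 : f 0 = 0.
Proof. by rewrite -(scale0r 0) (shomZ hf) rmorph0 scale0r. Qed.

Lemma shom_sum (I : Type) (s : seq I) (P : pred I) F :
  f (\sum_(i <- s | P i) F i) = \sum_(i <- s | P i) f (F i).
Proof. by apply: (big_morph f); [exact: (shomD hf)|exact: shom0]. Qed.

Lemma shomB x y : f (x - y) = f x - f y.
Proof. by rewrite (shomD hf) -scaleN1r (shomZ hf) rmorphN1 scaleN1r. Qed.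

End ShomTheory.

Lemma shom_comp (K E E2 : fieldType) (phi : {rmorphism K -> E}) (psi : {rmorphism E -> E2})
  (chi : {rmorphism K -> E2}) (A : algType K) (B : algType E) (C : algType E2)
  (f : A -> B) (g : B -> C) : (forall x, chi x = psi (phi x)) ->
  is_shom phi f -> is_shom psi g -> is_shom chi (g \o f).
Proof.
move=> chiE hf hg; split=> [x y|c x||x y] /=.
- by rewrite (shomD hf) (shomD hg).
- by rewrite (shomZ hf) (shomZ hg) chiE.
- by rewrite (shom1 hf) (shom1 hg).
- by rewrite (shomM hf) (shomM hg).
Qed.

Lemma lrmorphism_shom (K : fieldType) (A B : algType K) (f : {lrmorphism A -> B}) :
  is_shom idfun f.
Proof.
by split=> [x y|c x||x y]; rewrite ?rmorphD ?linearZ ?rmorph1 ?rmorphM.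
Qed.

Lemma shom_rep (K E : fieldType) (phi : {rmorphism K -> E}) (A : falgType K) k
  (r : A -> 'M[E]_k.+1) : is_rep phi r <-> is_shom phi r.
Proof. by split=> - [? ? ? ?]; split. Qed.

Section TensorLift.

Variables (K : fieldType) (A B : falgType K).

Lemma tensor_expand (w : tensor A B) : w = \sum_k w k *: (tens (bas k.1) (bas k.2) : tensor A B).
Proof.
apply/ffunP => l; rewrite sum_ffunE (bigD1 l) //= big1 ?addr0 => [|k kl].
  by rewrite !ffunE !crd_bas !eqxx mulr1 [RHS]mulr1.
rewrite !ffunE !crd_bas -natrM mulnb -xpair_eqE -!surjective_pairing.
by rewrite eq_sym (negbTE kl) scaler0.
Qed.

Lemma tensDl (u u' : A) (v : B) :
  (tens (u + u') v : tensor A B) = (tens u v : tensor A B) + tens u' v.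
Proof. by apply/ffunP => k; rewrite !ffunE /crd linearD mulrDl. Qed.

Lemma tensDr (u : A) (v v' : B) :
  (tens u (v + v') : tensor A B) = (tens u v : tensor A B) + tens u v'.
Proof. by apply/ffunP => k; rewrite !ffunE /crd linearD mulrDr. Qed.

Lemma tensZl c (u : A) (v : B) :
  (tens (c *: u) v : tensor A B) = c *: (tens u v : tensor A B).
Proof. by apply/ffunP => k; rewrite !ffunE /crd linearZ -mulrA. Qed.

Lemma tensZr c (u : A) (v : B) :
  (tens u (c *: v) : tensor A B) = c *: (tens u v : tensor A B).
Proof. by apply/ffunP => k; rewrite !ffunE /crd linearZ mulrCA. Qed.

Lemma tens1 : (tens 1 1 : tensor A B) = 1.
Proof. by []. Qed.

Definition tensl (u : A) : tensor A B := tens u 1.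
Definition tensr (v : B) : tensor A B := tens 1 v.

Lemma tensl_shom : is_shom idfun tensl.
Proof.
split=> [x y|c x||x y]; rewrite /tensl ?tensDl ?tensZl //.
by rewrite -tensM mulr1.
Qed.

Lemma tensr_shom : is_shom idfun tensr.
Proof.
split=> [x y|c x||x y]; rewrite /tensr ?tensDr ?tensZr //.
by rewrite -tensM mulr1.
Qed.

Lemma tens_comm u v : tensl u * tensr v = tensr v * tensl u.
Proof. by rewrite /tensl /tensr -!tensM !mulr1 !mul1r. Qed.

Lemma tens_mul u v : tensl u * tensr v = tens u v.
Proof. by rewrite /tensl /tensr -!tensM !mulr1 !mul1r. Qed.

Variables (E : fieldType) (phi : {rmorphism K -> E}) (C : algType E).
Variables (f : A -> C) (g : B -> C).
Hypotheses (hf : is_shom phi f) (hg : is_shom phi g).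
Hypothesis fg : forall x y, f x * g y = g y * f x.

Definition tensor_lift (w : tensor A B) : C :=
  \sum_k phi (w k) *: (f (bas k.1) * g (bas k.2)).

Lemma tensor_liftD : {morph tensor_lift : x y / x + y >-> x + y}.
Proof.
move=> x y; rewrite /tensor_lift -big_split /=; apply: eq_bigr => k _.
by rewrite ffunE rmorphD scalerDl.
Qed.

Lemma tensor_liftZ c x : tensor_lift (c *: x) = phi c *: tensor_lift x.
Proof.
rewrite /tensor_lift scaler_sumr; apply: eq_bigr => k _.
by rewrite ffunE rmorphM scalerA.
Qed.

Lemma tensor_lift_sum (I : Type) (s : seq I) (P : pred I) F :
  tensor_lift (\sum_(i <- s | P i) F i) = \sum_(i <- s | P i) tensor_lift (F i).
Proof.
apply: (big_morph tensor_lift); first exact: tensor_liftD.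
by rewrite -(scale0r 0) tensor_liftZ rmorph0 scale0r.
Qed.

Lemma tensor_lift_tens u v : tensor_lift (tens u v) = f u * g v.
Proof.
rewrite [u in RHS]crd_sum [v in RHS]crd_sum (shom_sum hf) (shom_sum hg).
rewrite big_distrlr /= pair_bigA /=; apply: eq_bigr => k _.
rewrite ffunE rmorphM (shomZ hf) (shomZ hg).
by rewrite -scalerAr -scalerAl scalerA mulrC.
Qed.

Lemma tensor_lift_shom : is_shom phi tensor_lift.
Proof.
split=> [||| x y]; [exact: tensor_liftD|exact: tensor_liftZ| |].
  by rewrite -tens1 tensor_lift_tens (shom1 hf) (shom1 hg) mulr1.
rewrite table_mulE tensor_lift_sum {2 3}/tensor_lift mulr_suml; apply: eq_bigr => i _.
rewrite tensor_lift_sum mulr_sumr; apply: eq_bigr => j _.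
rewrite tensor_liftZ -[st_mul _ i j]/(tens (bas i.1 * bas j.1) (bas i.2 * bas j.2)).
rewrite tensor_lift_tens (shomM hf) (shomM hg) rmorphM -scalerAl -scalerAr scalerA.
congr (_ *: _); rewrite -!mulrA; congr (_ * _).
by rewrite !mulrA fg.
Qed.

End TensorLift.

Section ScalarExtensionLift.

Variables (K F : fieldType) (phi : {rmorphism K -> F}) (A : falgType K).

Lemma ext_shom : is_shom phi (ext phi (A := A) : A -> scalar_ext phi A).
Proof.
split=> [x y|c x||x y] //; last exact: extM.
  by apply/ffunP => k; rewrite !ffunE /crd linearD rmorphD.
by apply/ffunP => k; rewrite !ffunE /crd linearZ rmorphM.
Qed.

Lemma ext_expand (w : scalar_ext phi A) : w = \sum_k w k *: (ext phi (bas k) : scalar_ext phi A).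
Proof.
apply/ffunP => l; rewrite sum_ffunE (bigD1 l) //= big1 ?addr0 => [|k kl].
  by rewrite !ffunE !crd_bas !eqxx rmorph1 [RHS]mulr1.
by rewrite !ffunE !crd_bas eq_sym (negbTE kl) rmorph0 scaler0.
Qed.

Variables (E : fieldType) (psi : {rmorphism F -> E}) (chi : {rmorphism K -> E}).
Variables (C : algType E) (f : A -> C).
Hypotheses (chiE : forall x, chi x = psi (phi x)) (hf : is_shom chi f).

Definition ext_lift (w : scalar_ext phi A) : C := \sum_k psi (w k) *: f (bas k).

Lemma ext_liftD : {morph ext_lift : x y / x + y >-> x + y}.
Proof.
move=> x y; rewrite /ext_lift -big_split /=; apply: eq_bigr => k _.
by rewrite ffunE rmorphD scalerDl.
Qed.

Lemma ext_liftZ c x : ext_lift (c *: x) = psi c *: ext_lift x.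
Proof.
rewrite /ext_lift scaler_sumr; apply: eq_bigr => k _.
by rewrite ffunE rmorphM scalerA.
Qed.

Lemma ext_lift_sum (I : Type) (s : seq I) (P : pred I) G :
  ext_lift (\sum_(i <- s | P i) G i) = \sum_(i <- s | P i) ext_lift (G i).
Proof.
apply: (big_morph ext_lift); first exact: ext_liftD.
by rewrite -(scale0r 0) ext_liftZ rmorph0 scale0r.
Qed.

Lemma ext_lift_ext u : ext_lift (ext phi u) = f u.
Proof.
rewrite [u in RHS]crd_sum (shom_sum hf); apply: eq_bigr => k _.
by rewrite ffunE (shomZ hf) chiE.
Qed.

Lemma ext_lift_shom : is_shom psi ext_lift.
Proof.
split=> [||| x y]; [exact: ext_liftD|exact: ext_liftZ| |].
  by rewrite -[1]/(ext phi 1 : scalar_ext phi A) ext_lift_ext (shom1 hf).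
rewrite table_mulE ext_lift_sum {2 3}/ext_lift mulr_suml; apply: eq_bigr => i _.
rewrite ext_lift_sum mulr_sumr; apply: eq_bigr => j _.
rewrite ext_liftZ -[st_mul _ i j]/(ext phi (bas i * bas j)).
by rewrite ext_lift_ext (shomM hf) rmorphM -scalerAl -scalerAr scalerA.
Qed.

End ScalarExtensionLift.

(** * Central simplicity of tensor products and scalar extensions *)

Section CentralSimpleCriterion.

Variables (F : fieldType) (A : falgType F) (J : finType) (co : J -> A -> F) (e : J -> A).
Hypothesis coE : forall x, x = \sum_j co j x *: e j.
Hypothesis sep : forall j, exists l, forall x, sandwich l x = co j x *: 1.

(** A converse to [sandwich_crd]. A sandwich operator with scalar values brings a suitable element
    of a nonzero ideal to a nonzero scalar; for central [z] it satisfies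
    [sandwich l z = sandwich l 1 * z], which makes [z] a scalar. *)
Lemma central_simple_criterion : central_simple A.
Proof.
have co0 x : x != 0 -> exists j, co j x != 0.
  move=> x0; apply/existsP; apply: contraNT x0; rewrite negb_exists => /forallP H.
  by rewrite [x]coE big1 // => j _; have := H j; rewrite negbK => /eqP ->; rewrite scale0r.
split.
  apply/eqP; rewrite eqEsubv; apply/andP; split; last first.
    apply/subvP => _ /vlineP [c ->]; rewrite memv_cap memvf /=; apply/centvP => v _.
    by rewrite -scalerAl -scalerAr mul1r mulr1.
  apply/subvP => z; rewrite memv_cap => /andP [_ /centvP zC].
  have [j cj] := co0 _ (oner_neq0 A); have [l Hl] := sep j.
  have zl : sandwich l z = sandwich l 1 * z.
    rewrite /sandwich mulr_suml; apply: eq_bigr => p _.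
    by rewrite mulr1 -!mulrA -(zC _ (memvf _)).
  apply/vlineP; exists ((co j 1)^-1 * co j z).
  rewrite -scalerA -Hl zl Hl -scalerAl mul1r scalerA mulVf // scale1r //.
move=> I /andP [/prodvP IL /prodvP IR].
have [->|I0] := eqVneq I 0%VS; [by left|right].
apply/eqP; rewrite eqEsubv subvf /=; apply/subvP => y _.
have [x xI x0] : exists2 x, x \in I & x != 0.
  by exists (vpick I); rewrite ?memv_pick // vpick0.
have [j cj] := co0 _ x0; have [l Hl] := sep j.
have : sandwich l x \in I.
  by rewrite /sandwich memv_suml // => p _; apply: IR (memvf _); apply: IL (memvf _) _.
rewrite Hl => /(memvZ (co j x)^-1); rewrite scalerA mulVf // scale1r => I1.
by rewrite -[y]mulr1; apply: IL => //; apply: memvf.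
Qed.

End CentralSimpleCriterion.

Lemma shom_sandwich (K E : fieldType) (phi : {rmorphism K -> E}) (A : falgType K)
    (C : falgType E) (f : A -> C) l x : is_shom phi f ->
  sandwich [seq (f p.1, f p.2) | p <- l] (f x) = f (sandwich l x).
Proof.
move=> hf; rewrite /sandwich big_map (shom_sum hf); apply: eq_bigr => p _.
by rewrite !(shomM hf).
Qed.

Lemma ext_csa (K F : fieldType) (phi : {rmorphism K -> F}) (A : falgType K) :
  central_simple A -> central_simple (scalar_ext phi A).
Proof.
move=> csA; pose e k : scalar_ext phi A := ext phi (bas k).
apply: (@central_simple_criterion F (scalar_ext phi A) _ (fun k w => w k) e).
  exact: ext_expand.
move=> j; have [l Hl] := sandwich_crd csA j.
exists [seq (ext phi p.1 : scalar_ext phi A, ext phi p.2 : scalar_ext phi A) | p <- l] => w.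
have hS := ext_shom phi A.
have -> : sandwich [seq (ext phi p.1 : scalar_ext phi A, ext phi p.2 : scalar_ext phi A) | p <- l] w
  = \sum_k w k *: ext phi (sandwich l (bas k)).
  rewrite [w in LHS]ext_expand /sandwich.
  under eq_bigr do rewrite mulr_sumr mulr_suml.
  rewrite exchange_big /=; apply: eq_bigr => k _.
  rewrite -(shom_sandwich l (bas k) hS) /sandwich scaler_sumr.
  by apply: eq_bigr => p _; rewrite -scalerAr -scalerAl.
rewrite (bigD1 j) //= Hl crd_bas eqxx scale1r (shom1 hS) big1 ?addr0 // => k kj.
by rewrite Hl crd_bas eq_sym (negbTE kj) scale0r (shom0 hS) scaler0.
Qed.

Lemma tensor_csa (K : fieldType) (A B : falgType K) :
  central_simple A -> central_simple B -> central_simple (tensor A B).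
Proof.
move=> csA csB; pose e k : tensor A B := tens (bas k.1) (bas k.2).
apply: (@central_simple_criterion K (tensor A B) _ (fun k w => w k) e).
  exact: tensor_expand.
move=> [i j]; have [l Hl] := sandwich_crd csA i; have [m Hm] := sandwich_crd csB j.
pose l' := [seq (tensl B p.1, tensl B p.2) | p <- l].
pose m' := [seq (tensr A p.1, tensr A p.2) | p <- m].
exists (comp_pairs l' m') => w; rewrite sandwich_comp.
have sw_sum (D : falgType K) (s : seq (D * D)) (T : finType) (G : T -> D) :
    sandwich s (\sum_k G k) = \sum_k sandwich s (G k).
  apply: (big_morph (sandwich s)); first exact: sandwichD.
  by have := sandwichZ s 0 0; rewrite !scale0r.
have H u v : sandwich l' (sandwich m' (tens u v)) = tens (sandwich l u) (sandwich m v).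
  have -> : sandwich m' (tens u v) = tens u (sandwich m v).
    rewrite -!tens_mul -[tensr A (sandwich m v)](shom_sandwich _ _ (tensr_shom A B)).
    rewrite /sandwich mulr_sumr !big_map; apply: eq_bigr => p _ /=.
    by rewrite !mulrA -tens_comm.
  rewrite -!tens_mul -(shom_sandwich _ _ (tensl_shom A B)).
  rewrite /sandwich mulr_suml !big_map; apply: eq_bigr => p _ /=.
  by rewrite -!mulrA -tens_comm.
rewrite [w in LHS]tensor_expand sw_sum sw_sum.
under eq_bigr do rewrite !sandwichZ H Hl Hm.
rewrite (bigD1 (i, j)) //= !crd_bas !eqxx !scale1r big1 ?addr0 // => k kij.
rewrite !crd_bas tensZl tensZr.
case: eqP => [ik|_]; last by rewrite scale0r scaler0.
case: eqP => [jk|_]; last by rewrite scale0r !scaler0.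
by case/eqP: kij; rewrite [k]surjective_pairing -ik -jk.
Qed.

Lemma base_csa (K : fieldType) : central_simple (K^o : falgType K).
Proof.
apply: (@central_simple_criterion K K^o 'I_1 (fun _ x => x) (fun=> 1)).
  by move=> x; rewrite big_ord1 [RHS]mulr1.
move=> _; exists [:: (1, 1)] => x.
by rewrite /sandwich big_seq1 /= mul1r mulr1 [RHS]mulr1.
Qed.

Lemma pow_csa (K : fieldType) (A : falgType K) q :
  central_simple A -> central_simple (tensor_pow A q).
Proof.
by move=> csA; elim: q => [|q IH]; [exact: base_csa|apply: tensor_csa].
Qed.

Lemma dim_ffun_alg (K : fieldType) (I : finType) (c : structure_table K I) :
  \dim {: (table_alg c : falgType K)} = #|I|.
Proof. by rewrite dimvf /dim /= muln1. Qed.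

Lemma dim_tensor (K : fieldType) (A B : falgType K) :
  \dim {:tensor A B} = (\dim {:A} * \dim {:B})%N.
Proof. by rewrite dim_ffun_alg card_prod !card_ord. Qed.

Lemma dim_ext (K F : fieldType) (phi : {rmorphism K -> F}) (A : falgType K) :
  \dim {:scalar_ext phi A} = \dim {:A}.
Proof. by rewrite dim_ffun_alg card_ord. Qed.

Lemma dim_base (K : fieldType) : \dim {: (K^o : falgType K)} = 1%N.
Proof. by rewrite dimvf. Qed.

Lemma dim_pow (K : fieldType) (A : falgType K) q :
  \dim {:tensor_pow A q} = (\dim {:A} ^ q)%N.
Proof.
elim: q => [|q IH]; first exact: dim_base.
by rewrite /= dim_tensor IH expnS.
Qed.

Lemma dim_mx (K : fieldType) k : \dim {: ('M[K]_k.+1 : falgType K)} = (k.+1 * k.+1)%N.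
Proof. by rewrite dimvf. Qed.

Lemma shom_lrmorphism (F : fieldType) (A B : algType F) (f : A -> B) :
  is_shom idfun f -> exists h : {lrmorphism A -> B}, h =1 f.
Proof.
move=> hf.
have Hl : linear f by move=> c x y; rewrite (shomD hf) (shomZ hf).
have Hm : monoid_morphism f by split; [exact: (shom1 hf)|exact: (shomM hf)].
pose fl := GRing.isLinear.Build _ _ _ _ f Hl.
pose fm := GRing.isMonoidMorphism.Build _ _ f Hm.
pose h : {lrmorphism A -> B} := HB.pack f fl fm.
by exists h.
Qed.

Lemma alg_iso_inj (F : fieldType) (A B : falgType F) (f : A -> B) :
  is_shom idfun f -> injective f -> \dim {:A} = \dim {:B} -> alg_iso A B.
Proof.
move=> hf fi dAB; have [h hE] := shom_lrmorphism hf; exists h.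
pose l := linfun h.
have kl : lker l == 0%VS.
  by apply/lker0P => x y; rewrite !lfunE /= !hE => /fi.
have sl : limg l = fullv.
  by apply/eqP; rewrite eqEdim subvf /= (limg_dim_eq _) ?dAB // (eqP kl) capv0.
exists (l^-1)%VF => x; first by rewrite -[h x](lfunE h) lker0_lfunK.
by rewrite -[h _](lfunE h) limg_lfunVK // sl memvf.
Qed.

Lemma alg_iso_shom (F : fieldType) (A B : falgType F) : alg_iso A B ->
  exists f : A -> B, is_shom idfun f /\ bijective f.
Proof. by move=> [h bh]; exists h; split; first exact: lrmorphism_shom. Qed.

Lemma alg_iso_dim (F : fieldType) (A B : falgType F) : alg_iso A B ->
  \dim {:A} = \dim {:B}.
Proof.
move=> [h [g hK gK]]; pose l := linfun h.
have kl : lker l == 0%VS.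
  by apply/lker0P => x y; rewrite !lfunE /=; exact: (can_inj hK).
have <- : limg l = fullv.
  apply/eqP; rewrite eqEsubv subvf /=; apply/subvP => y _.
  by rewrite -[y]gK -[h _](lfunE h) memv_img // memvf.
by rewrite limg_dim_eq // (eqP kl) capv0.
Qed.

Lemma alg_iso_sym (F : fieldType) (A B : falgType F) : alg_iso A B -> alg_iso B A.
Proof.
move=> AB; have dAB := alg_iso_dim AB; have [h [g hK gK]] := AB.
have hg : is_shom idfun g.
  have hi := can_inj hK.
  split=> [x y|c x||x y]; apply: hi; rewrite ?rmorphD ?linearZ ?rmorph1 ?rmorphM /= ?gK //.
exact: alg_iso_inj hg (can_inj gK) (esym dAB).
Qed.

Lemma alg_iso_trans (F : fieldType) (A B C : falgType F) :
  alg_iso A B -> alg_iso B C -> alg_iso A C.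
Proof.
move=> AB BC; have [f [hf bf]] := alg_iso_shom AB; have [g [hg bg]] := alg_iso_shom BC.
apply: (alg_iso_inj (f := g \o f)).
- exact: shom_comp hf hg.
- exact: inj_comp (bij_inj bg) (bij_inj bf).
- by rewrite (alg_iso_dim AB) (alg_iso_dim BC).
Qed.

Lemma csa_shom_inj (K : fieldType) (E : fieldType) (phi : {rmorphism K -> E})
    (A : falgType K) (C : algType E) (f : A -> C) :
  central_simple A -> is_shom phi f -> injective f.
Proof.
move=> csA hf x y fxy; apply/eqP; rewrite -subr_eq0; apply: contraT => xy0.
have [l Hl] := sandwich_to1 csA xy0.
have : f (sandwich l (x - y)) = 0.
  rewrite /sandwich (shom_sum hf) big1 // => p _.
  by rewrite !(shomM hf) (shomB hf) fxy subrr mulr0 mul0r.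
by rewrite Hl (shom1 hf) => /eqP; rewrite oner_eq0.
Qed.

Lemma csa_rep_free (K : fieldType) (E : fieldType) (phi : {rmorphism K -> E})
    (A : falgType K) k (r : A -> 'M[E]_k) :
  central_simple A -> is_rep phi r -> (0 < k)%N -> free_fam (fun i => r (bas i)).
Proof.
move=> csA rr k0 c cS i; have [l Hl] := sandwich_crd csA i.
have : \sum_(p <- l) r p.1 *m (\sum_j c j *: r (bas j)) *m r p.2 = (c i)%:M.
  transitivity (\sum_j c j *: r (sandwich l (bas j))).
    under [RHS]eq_bigr do rewrite /sandwich (rep_sum _ _ _ rr) scaler_sumr.
    rewrite [RHS]exchange_big /=; apply: eq_bigr => p _.
    rewrite mulmx_sumr mulmx_suml; apply: eq_bigr => j _.
    by rewrite !(repM rr) -scalemxAr -scalemxAl.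
  rewrite (bigD1 i) //= Hl crd_bas eqxx scale1r (rep1 rr) big1 => [|j ji].
    by rewrite addr0 scalemx1.
  by rewrite Hl crd_bas eq_sym (negbTE ji) scale0r (rep0 rr) scaler0.
rewrite cS big1 => [|p _]; last by rewrite mulmx0 mul0mx.
by move=> /matrixP/(_ (Ordinal k0) (Ordinal k0)); rewrite !mxE eqxx mulr1n.
Qed.

(** * Tensor powers and Brauer equivalence under base change *)

Section PowerSlots.

Variables (K : fieldType) (A : falgType K).

Fixpoint slot q : 'I_q -> A -> tensor_pow A q :=
  match q return 'I_q -> A -> tensor_pow A q with
  | 0 => fun _ _ => 1
  | q'.+1 => fun a x => if unlift ord0 a is Some b
      then tensr A (slot b x) else tensl (tensor_pow A q') x
  end.

Variables (E : fieldType) (phi : {rmorphism K -> E}).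

Lemma slot_lift q (C : algType E) (R : 'I_q -> A -> C) :
  (forall a, is_shom phi (R a)) ->
  (forall a b x y, a != b -> R a x * R b y = R b y * R a x) ->
  exists P : tensor_pow A q -> C, is_shom phi P /\ forall a x, P (slot a x) = R a x.
Proof.
move=> HR HC.
(* The induction also carries that values of [P] commute with whatever commutes with all values of
   [R]; adding a tensor factor uses this. *)
suff [P [hP [PR _]]] : exists P : tensor_pow A q -> C, is_shom phi P /\
    (forall a x, P (slot a x) = R a x) /\
    forall z, (forall a x, R a x * z = z * R a x) -> forall w, P w * z = z * P w.
  by exists P.
elim: q R HR HC => [|q IH] R HR HC.
  exists (fun w => phi w *: 1); split; last first.
    by split=> [[]//|z _ w]; rewrite -scalerAl -scalerAr mul1r mulr1.
  split=> [x y|c x||x y]; rewrite ?rmorphD ?scalerDl ?rmorph1 ?scale1r //.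
    by rewrite rmorphM scalerA.
  by rewrite rmorphM -scalerAl mul1r scalerA.
have [||P [hP [PR PC]]] := IH (fun b => R (lift ord0 b)).
- by move=> b; apply: HR.
- by move=> a b x y ab; apply: HC; rewrite (inj_eq lift_inj).
have fg x y : R ord0 x * P y = P y * R ord0 x.
  by rewrite PC // => a z; apply: HC; rewrite eq_sym neq_lift.
exists (tensor_lift phi (R ord0) P); split; first exact: tensor_lift_shom (HR ord0) hP fg.
split=> [a x|z Hz w].
  rewrite /=; case: unliftP => [b|] ->.
    by rewrite (tensor_lift_tens (HR ord0) hP) (shom1 (HR ord0)) mul1r PR.
  by rewrite (tensor_lift_tens (HR ord0) hP) (shom1 hP) mulr1.
rewrite /tensor_lift mulr_suml mulr_sumr; apply: eq_bigr => k _.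
rewrite -scalerAl -scalerAr -mulrA PC; last by move=> a x; apply: Hz.
by rewrite mulrA Hz mulrA.
Qed.

Lemma qrep_pow_rep q k (R : 'I_q -> A -> 'M[E]_k) : is_qrep phi R ->
  exists r : tensor_pow A q -> 'M[E]_k, is_rep phi r /\ forall a x, r (slot a x) = R a x.
Proof.
case: k R => [|k] R qR.
  exists (fun _ => 0); split; first split=> [x y|c x||x y]; try by apply/matrixP; case.
  by move=> a x; apply/matrixP; case.
have [|a b x y ab|P [hP PR]] := @slot_lift q 'M[E]_k.+1 R.
- by move=> a; apply/shom_rep; apply: qrep_rep.
- exact: (qrep_comm qR).
by exists P; split=> //; apply/shom_rep.
Qed.

End PowerSlots.

Lemma alg_iso_refl (F : fieldType) (A : falgType F) : alg_iso A A.
Proof. by apply: (@alg_iso_inj F A A id) => //; split. Qed.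

Lemma shom_ext_eq (K F : fieldType) (phi : {rmorphism K -> F}) (A : falgType K)
    (C : algType F) (f g : scalar_ext phi A -> C) :
  is_shom idfun f -> is_shom idfun g ->
  (forall u, f (ext phi u) = g (ext phi u)) -> f =1 g.
Proof.
move=> hf hg fg w; rewrite [w]ext_expand (shom_sum hf) (shom_sum hg).
by apply: eq_bigr => k _; rewrite (shomZ hf) (shomZ hg) fg.
Qed.

Lemma shom_tensor_eq (K E : fieldType) (phi : {rmorphism K -> E}) (A B : falgType K)
    (C : algType E) (f g : tensor A B -> C) :
  is_shom phi f -> is_shom phi g ->
  (forall u v, f (tens u v) = g (tens u v)) -> f =1 g.
Proof.
move=> hf hg fg w; rewrite [w]tensor_expand (shom_sum hf) (shom_sum hg).
by apply: eq_bigr => k _; rewrite (shomZ hf) (shomZ hg) fg.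
Qed.

Lemma shom_id (K : fieldType) (A : algType K) : is_shom idfun (id : A -> A).
Proof. by split. Qed.

Lemma shom_comp_id (K E : fieldType) (phi : {rmorphism K -> E})
    (A B : algType K) (C : algType E) (f : A -> B) (g : B -> C) :
  is_shom idfun f -> is_shom phi g -> is_shom phi (g \o f).
Proof. exact: shom_comp. Qed.

Lemma shom_id_comp (K E : fieldType) (phi : {rmorphism K -> E})
    (A : algType K) (B C : algType E) (f : A -> B) (g : B -> C) :
  is_shom phi f -> is_shom idfun g -> is_shom phi (g \o f).
Proof. exact: shom_comp. Qed.

Lemma shom_inverse (F : fieldType) (A B : algType F) (f : A -> B) (g : B -> A) :
  is_shom idfun f -> cancel f g -> cancel g f -> is_shom idfun g.
Proof.
move=> hf fK gK; have fi := can_inj fK.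
by split=> [x y|c x||x y]; apply: fi;
  rewrite ?(shomD hf) ?(shomZ hf) ?(shom1 hf) ?(shomM hf) !gK.
Qed.

Lemma ext_lift_id_shom (K F : fieldType) (phi : {rmorphism K -> F}) (A : falgType K)
    (C : algType F) (f : A -> C) : is_shom phi f ->
  is_shom idfun (ext_lift idfun f : scalar_ext phi A -> C).
Proof. exact: ext_lift_shom. Qed.

Lemma ext_lift_id_ext (K F : fieldType) (phi : {rmorphism K -> F}) (A : falgType K)
    (C : algType F) (f : A -> C) : is_shom phi f ->
  forall u, ext_lift idfun f (ext phi u : scalar_ext phi A) = f u.
Proof. exact: ext_lift_ext. Qed.

Lemma alg_iso_cancel (F : fieldType) (A B : falgType F) (f : A -> B) (g : B -> A) :
  is_shom idfun f -> cancel f g -> \dim {:A} = \dim {:B} -> alg_iso A B.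
Proof. by move=> hf fK; apply: alg_iso_inj hf (can_inj fK). Qed.

Lemma tensor_iso (F : fieldType) (A A' B B' : falgType F) :
  alg_iso A A' -> alg_iso B B' -> alg_iso (tensor A B) (tensor A' B').
Proof.
move=> /[dup] /alg_iso_shom [f [hf [f' fK f'K]]] AA.
move=> /[dup] /alg_iso_shom [g [hg [g' gK g'K]]] BB.
have hf' := shom_inverse hf fK f'K.
have hg' := shom_inverse hg gK g'K.
have H1 := shom_comp_id hf (tensl_shom A' B').
have H2 := shom_comp_id hg (tensr_shom A' B').
have C1 x y := tens_comm (f x) (g y).
have H1' := shom_comp_id hf' (tensl_shom A B).
have H2' := shom_comp_id hg' (tensr_shom A B).
have C1' x y := tens_comm (f' x) (g' y).
have h := tensor_lift_shom H1 H2 C1; have h' := tensor_lift_shom H1' H2' C1'.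
set k := tensor_lift _ _ _ in h; set k' := tensor_lift _ _ _ in h'.
apply: (alg_iso_cancel h (g := k')).
  apply: (shom_tensor_eq (shom_comp_id h h') (shom_id _)) => u v /=.
  rewrite /k (tensor_lift_tens H1 H2) (shomM h') /= /tensl /tensr.
  rewrite /k' !(tensor_lift_tens H1' H2') /= !fK !gK.
  by rewrite (shom1 hf') (shom1 hg') /tensl /tensr -!tensM !mulr1 !mul1r.
by rewrite !dim_tensor (alg_iso_dim AA) (alg_iso_dim BB).
Qed.

Lemma tensor_pow_iso (F : fieldType) (A B : falgType F) q :
  alg_iso A B -> alg_iso (tensor_pow A q) (tensor_pow B q).
Proof.
by move=> AB; elim: q => [|q IH]; [exact: alg_iso_refl|exact: tensor_iso].
Qed.

Lemma tensor_base_l (F : fieldType) (A : falgType F) : alg_iso (tensor F^o A) A.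
Proof.
pose f (c : F^o) : A := (c : F) *: 1.
have hf : is_shom idfun f.
  split=> [x y|c x||x y]; rewrite /f ?scalerDl ?scale1r //.
    by rewrite scalerA.
  by rewrite -scalerAl mul1r scalerA.
have C x y : f x * y = y * f x by rewrite -scalerAl -scalerAr mul1r mulr1.
have h := tensor_lift_shom hf (shom_id A) C.
set k := tensor_lift _ _ _ in h.
apply: (@alg_iso_cancel F (tensor F^o A) A k (@tensr F F^o A)) => //; last by rewrite dim_tensor dim_base mul1n.
apply: (shom_tensor_eq (shom_comp_id h (tensr_shom _ _)) (shom_id _)) => u v /=.
rewrite /k (tensor_lift_tens hf (shom_id A)) /f -scalerAl mul1r /tensr tensZr -tensZl.
by congr tens; rewrite [LHS]mulr1.
Qed.

Lemma tensor_mx1_r (F : fieldType) (A : falgType F) : alg_iso (tensor A 'M[F]_1) A.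
Proof.
pose f (c : 'M[F]_1) : A := c ord0 ord0 *: 1.
have hf : is_shom idfun f.
  split=> [x y|c x||x y]; rewrite /f ?mxE ?scalerDl ?scale1r //.
    by rewrite scalerA.
  by rewrite big_ord1 -scalerAl mul1r scalerA.
have C x y : x * f y = f y * x by rewrite -scalerAl -scalerAr mul1r mulr1.
have h := tensor_lift_shom (shom_id A) hf C.
set k := tensor_lift _ _ _ in h.
apply: (@alg_iso_cancel F (tensor A 'M[F]_1) A k (@tensl _ A 'M[F]_1)) => //; last by rewrite dim_tensor dim_mx !muln1.
apply: (shom_tensor_eq (shom_comp_id h (tensl_shom _ _)) (shom_id _)) => u v /=.
rewrite /k (tensor_lift_tens (shom_id A) hf) /f -scalerAr mulr1 /tensl tensZl -tensZr.
by congr tens; rewrite {2}[v]mx11_scalar scalemx1.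
Qed.

Lemma brauer_equiv_iso (F : fieldType) (A A' B B' : falgType F) :
  alg_iso A A' -> alg_iso B B' -> brauer_equiv A B -> brauer_equiv A' B'.
Proof.
move=> AA BB [k [l AB]]; exists k, l.
apply: alg_iso_trans (tensor_iso BB (alg_iso_refl _)).
exact: alg_iso_trans (alg_iso_sym (tensor_iso AA (alg_iso_refl _))) AB.
Qed.

Lemma brauer_equiv_split (F : fieldType) (A : falgType F) k :
  alg_iso A 'M[F]_k.+1 -> brauer_equiv A F^o.
Proof.
move=> AM; exists 0%N, k; apply: alg_iso_trans (tensor_mx1_r _) _.
exact: alg_iso_trans AM (alg_iso_sym (tensor_base_l _)).
Qed.

Section BaseChange.

Variables (K F : fieldType) (phi : {rmorphism K -> F}).
Implicit Types A B : falgType K.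

Lemma ext_iso A B : alg_iso A B -> alg_iso (scalar_ext phi A) (scalar_ext phi B).
Proof.
move=> /[dup] AB /alg_iso_shom [f [hf [g fK gK]]].
have hg := shom_inverse hf fK gK.
have H := shom_comp_id hf (ext_shom phi B); have H' := shom_comp_id hg (ext_shom phi A).
have h := ext_lift_id_shom H.
have h' := ext_lift_id_shom H'.
apply: (alg_iso_cancel h (g := ext_lift idfun (ext phi (A := A) \o g : B -> scalar_ext phi A))).
  apply: (shom_ext_eq (shom_comp_id h h') (shom_id _)) => u /=.
  rewrite (ext_lift_id_ext H) /=.
  by rewrite (ext_lift_id_ext H') /= fK.
by rewrite !dim_ext (alg_iso_dim AB).
Qed.

Lemma ext_tensor A B :
  alg_iso (scalar_ext phi (tensor A B)) (tensor (scalar_ext phi A) (scalar_ext phi B)).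
Proof.
set A1 := scalar_ext phi A; set B1 := scalar_ext phi B.
have E1 := shom_id_comp (ext_shom phi A) (tensl_shom A1 B1).
have E2 := shom_id_comp (ext_shom phi B) (tensr_shom A1 B1).
have C x y := tens_comm (ext phi x : A1) (ext phi y : B1).
have H := tensor_lift_shom E1 E2 C.
have h := ext_lift_id_shom H.
have G1 := shom_comp_id (tensl_shom A B) (ext_shom phi (tensor A B)).
have G2 := shom_comp_id (tensr_shom A B) (ext_shom phi (tensor A B)).
have g1 := ext_lift_id_shom G1.
have g2 := ext_lift_id_shom G2.
set G1f := ext_lift _ _ in g1; set G2f := ext_lift _ _ in g2.
have CG x y : G1f x * G2f y = G2f y * G1f x.
  rewrite [x]ext_expand [y]ext_expand (shom_sum g1) (shom_sum g2) !big_distrlr /=.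
  rewrite exchange_big /=; apply: eq_bigr => i _; apply: eq_bigr => k _.
  rewrite !(shomZ g1) !(shomZ g2) -!scalerAl -!scalerAr !scalerA mulrC.
  rewrite /G1f /G2f (ext_lift_id_ext G1).
  rewrite (ext_lift_id_ext G2) /=.
  by rewrite -!extM tens_comm.
have h' := tensor_lift_shom g1 g2 CG.
apply: (alg_iso_cancel h (g := tensor_lift idfun G1f G2f)); last first.
  by rewrite dim_tensor !dim_ext dim_tensor.
apply: (shom_ext_eq (shom_comp_id h h') (shom_id _)).
have U := shom_id_comp (shom_id_comp (ext_shom phi (tensor A B)) h) h'.
apply: (shom_tensor_eq U (ext_shom phi (tensor A B))) => u v /=.
rewrite (ext_lift_id_ext H) (tensor_lift_tens E1 E2) /=.
rewrite (shomM h') /tensl /tensr !(tensor_lift_tens g1 g2) (shom1 g1) (shom1 g2).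
rewrite mulr1 mul1r /G1f /G2f (ext_lift_id_ext G1).
rewrite (ext_lift_id_ext G2) /= -extM.
by rewrite tens_mul.
Qed.

Lemma ext_base : alg_iso (scalar_ext phi K^o) F^o.
Proof.
have H : is_shom phi (phi : K^o -> F^o).
  by split=> [x y|c x||x y]; rewrite ?rmorphD ?rmorph1 ?rmorphM.
have h := ext_lift_id_shom H.
apply: (alg_iso_cancel h (g := fun c : F^o => (c : F) *: 1)); last first.
  by rewrite dim_ext !dim_base.
pose f (c : F^o) : scalar_ext phi K^o := (c : F) *: 1.
have hf : is_shom idfun f.
  split=> [x y|c x||x y]; rewrite /f ?scalerDl ?scale1r //.
    by rewrite scalerA.
  by rewrite -scalerAl mul1r scalerA.
apply: (shom_ext_eq (shom_comp_id h hf) (shom_id _)) => u /=.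
rewrite (ext_lift_id_ext H) /f.
by rewrite -(shom1 (ext_shom phi K^o)) -(shomZ (ext_shom phi K^o)) [_ *: 1]mulr1.
Qed.

Lemma map_mx_shom k : is_shom phi (map_mx phi : 'M[K]_k.+1 -> 'M[F]_k.+1).
Proof.
split=> [x y|c x||x y]; [exact: map_mxD|exact: map_mxZ|exact: map_mx1|exact: map_mxM].
Qed.

Lemma ext_mx k : alg_iso (scalar_ext phi 'M[K]_k.+1) 'M[F]_k.+1.
Proof.
have H := map_mx_shom k.
have h := ext_lift_id_shom H.
pose g (Y : 'M[F]_k.+1) : scalar_ext phi 'M[K]_k.+1 :=
  \sum_i \sum_l Y i l *: (ext phi (delta_mx i l) : scalar_ext phi 'M[K]_k.+1).
apply: (alg_iso_cancel h (g := g)); last by rewrite dim_ext !dim_mx.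
move=> w; rewrite {1}[w]ext_expand (shom_sum h).
transitivity (\sum_i w i *: g (map_mx phi (bas i))).
  rewrite {1}/g.
  transitivity (\sum_i0 \sum_l \sum_i w i *: (map_mx phi (bas i) i0 l *:
      (ext phi (delta_mx i0 l) : scalar_ext phi 'M[K]_k.+1))).
    apply: eq_bigr => i0 _; apply: eq_bigr => l _; rewrite summxE scaler_suml.
    apply: eq_bigr => i _; rewrite (shomZ h) (ext_lift_id_ext H).
    by rewrite mxE scalerA.
  under eq_bigr do rewrite exchange_big /=.
  rewrite exchange_big /=; apply: eq_bigr => i _; rewrite /g scaler_sumr.
  by apply: eq_bigr => i0 _; rewrite scaler_sumr.
rewrite [RHS]ext_expand; apply: eq_bigr => i _; congr (_ *: _).
have S := ext_shom phi 'M[K]_k.+1.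
rewrite [bas i in RHS]matrix_sum_delta /g (shom_sum S); apply: eq_bigr => a _.
by rewrite (shom_sum S); apply: eq_bigr => c _; rewrite (shomZ S) mxE.
Qed.

Lemma ext_pow A q :
  alg_iso (scalar_ext phi (tensor_pow A q)) (tensor_pow (scalar_ext phi A) q).
Proof.
elim: q => [|q IH]; first exact: ext_base.
exact: alg_iso_trans (ext_tensor _ _) (tensor_iso (alg_iso_refl _) IH).
Qed.

Lemma brauer_equiv_ext A B : brauer_equiv A B ->
  brauer_equiv (scalar_ext phi A) (scalar_ext phi B).
Proof.
move=> [k [l AB]]; exists k, l.
have H C r : alg_iso (scalar_ext phi (tensor C 'M[K]_r.+1))
    (tensor (scalar_ext phi C) 'M[F]_r.+1).
  exact: alg_iso_trans (ext_tensor _ _) (tensor_iso (alg_iso_refl _) (ext_mx r)).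
exact: alg_iso_trans (alg_iso_sym (H A k)) (alg_iso_trans (ext_iso AB) (H B l)).
Qed.

End BaseChange.

Lemma ext_ext (K E F : fieldType) (phi : {rmorphism K -> E}) (psi : {rmorphism E -> F})
    (chi : {rmorphism K -> F}) (A : falgType K) : (forall x, chi x = psi (phi x)) ->
  alg_iso (scalar_ext psi (scalar_ext phi A)) (scalar_ext chi A).
Proof.
move=> chiE; set B := scalar_ext phi A.
have H1 := ext_shom chi A.
have H2 := ext_lift_shom chiE H1.
have h := ext_lift_id_shom H2.
have G := shom_comp chiE (ext_shom phi A) (ext_shom psi B).
have g := ext_lift_id_shom G.
apply: (alg_iso_cancel h (g := ext_lift idfun (ext psi (A := B) \o ext phi (A := A) : A -> scalar_ext psi B))); last first.
  by rewrite !dim_ext.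
apply: (shom_ext_eq (shom_comp_id h g) (shom_id _)) => u /=.
have : forall u : B, ext_lift idfun (ext psi (A := B) \o ext phi (A := A) : A -> scalar_ext psi B)
   (ext_lift psi (ext chi (A := A) : A -> scalar_ext chi A) u) = ext psi u.
  move=> w; rewrite [w]ext_expand (shom_sum H2) (shom_sum g) (shom_sum (ext_shom psi B)).
  apply: eq_bigr => k _; rewrite (shomZ H2) (shomZ g) (shomZ (ext_shom psi B)).
  by rewrite (ext_lift_ext chiE H1) (ext_lift_id_ext G).
by move=> E1; rewrite (ext_lift_id_ext H2) E1.
Qed.

(** The row space of the image [e ord0 ord0] of a matrix unit is stable under [A], since [A]
    commutes with the matrix units. The full space, of dimension [n * k.+1], contains [k.+1]
    independent copies of it, so its dimension is at most [n], and it is a multiple of [n]. *)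
Lemma split_rep (F : fieldType) (A : falgType F) n : central_simple A ->
  has_degree A n -> brauer_equiv A F^o -> exists r : A -> 'M[F]_n, is_rep idfun r.
Proof.
move=> csA dA [k [l AM]]; have {}AM := alg_iso_trans AM (tensor_base_l _).
have dk : (n * k.+1 = l.+1)%N.
  apply/eqP; rewrite -eqn_sqr expnMn -dA -!mulnn -!(dim_mx F) -dim_tensor.
  by rewrite (alg_iso_dim AM).
have [f [hf _]] := alg_iso_shom AM.
have hr := shom_comp_id (tensl_shom A 'M[F]_k.+1) hf.
have he := shom_comp_id (tensr_shom A 'M[F]_k.+1) hf.
set r : A -> 'M[F]_l.+1 := _ \o _ in hr.
pose e a b := f (tensr A (delta_mx a b)).
have eM a b c d : e a b *m e c d = (b == c)%:R *: e a d.
  rewrite -[LHS](shomM he) -[_ * _]/(delta_mx a b *m delta_mx c d) mul_delta_mx_cond.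
  by rewrite -scaler_nat (shomZ he).
have eM1 a b d : e a b *m e b d = e a d by rewrite eM eqxx scale1r.
have re x a b : r x *m e a b = e a b *m r x.
  by rewrite -[LHS](shomM hf) -[RHS](shomM hf) tens_comm.
have e0 : e ord0 ord0 != 0.
  apply/eqP => e0; have : (1 : 'M[F]_l.+1) == 0; last by rewrite oner_eq0.
  rewrite -(shom1 he) -[1]/(1%:M : 'M_k.+1) mx1_sum_delta (shom_sum he) big1 // => i _.
  by rewrite -[LHS]/(e i i) -(eM1 i ord0 i) -(eM1 i ord0 ord0) e0 mulmx0 mul0mx.
pose P := row_base (e ord0 ord0).
have PE : (P <= e ord0 ord0)%MS by rewrite eq_row_base.
have Pe : P *m e ord0 ord0 = P.
  by have /submxP [Z ->] := PE; rewrite -mulmxA eM eqxx scale1r.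
have rr : is_rep idfun r by apply/shom_rep.
have [|a x|T /qrep_rep/(_ ord0) rT] := subrep_exists (rep_qrep1 rr) (B := P).
- by rewrite /P row_base_free.
- rewrite -[P in (_ <= P)%MS]/P eq_row_base -Pe -mulmxA -re.
  by rewrite mulmxA submxMl.
have := rep_dim_dvd csA dA (rep_qrep1 rT); rewrite expn1 => nd.
suff rn : (\rank (e ord0 ord0) <= n)%N.
  have -> : n = \rank (e ord0 ord0).
    by apply/eqP; rewrite eqn_leq rn dvdn_leq // lt0n mxrank_eq0.
  by exists (T ord0).
rewrite -(leq_pmul2r (ltn0Sn k)) dk mulnC.
pose X (ia : 'I_k.+1 * 'I_(\rank (e ord0 ord0))) := row ia.2 P *m e ord0 ia.1.
have fX : free_fam X.
  move=> c c0 [i a]; pose u := \sum_b c (i, b) *: row b P.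
  have : u = 0.
    transitivity ((\sum_ia c ia *: X ia) *m e i ord0); last by rewrite c0 mul0mx.
    rewrite mulmx_suml.
    transitivity (\sum_i0 \sum_b c (i0, b) *: X (i0, b) *m e i ord0); last first.
      by rewrite pair_bigA /=; apply: eq_bigr => -[].
    rewrite (bigD1 i) //= [X in _ + X]big1 ?addr0 => [|i0 i0i].
      apply: eq_bigr => b _; rewrite -scalemxAl -mulmxA eM eqxx scale1r.
      by rewrite -row_mul Pe.
    apply: big1 => b _; rewrite -scalemxAl -mulmxA eM (negbTE i0i) scale0r.
    by rewrite mulmx0 scaler0.
  have -> : u = (\row_b c (i, b)) *m P.
    by rewrite mulmx_sum_row; apply: eq_bigr => b _; rewrite mxE.
  move=> uP; have : (\row_b c (i, b)) = 0.
    apply: (row_free_inj (row_base_free (e ord0 ord0))).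
    by rewrite mul0mx.
  by move=> /rowP/(_ a); rewrite !mxE.
have [_ sD _] := delta_basis F 1 l.+1.
have := free_fam_le fX (fun j => sD _ I).
by rewrite !card_prod !card_ord mul1n.
Qed.

Section PowerSplitting.

Variables (K E : fieldType) (phi : {rmorphism K -> E}) (A : falgType K) (q n : nat).
Hypotheses (csA : central_simple A) (dA : has_degree A n).

Lemma pow_ext_degree : has_degree (tensor_pow (scalar_ext phi A) q) (n ^ q).
Proof. by rewrite /has_degree dim_pow dim_ext dA -!expnM mulnC. Qed.

Lemma rep_of_brauer_trivial : brauer_equiv (tensor_pow (scalar_ext phi A) q) E^o ->
  exists r : tensor_pow A q -> 'M[E]_(n ^ q), is_rep phi r.
Proof.
move/(split_rep (pow_csa q (ext_csa phi csA)) pow_ext_degree) => [r rr].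
have [f [hf _]] := alg_iso_shom (ext_pow phi A q).
have hg := shom_id_comp (ext_shom phi (tensor_pow A q)) hf.
set g := _ \o _ in hg; exists (fun x => r (g x)).
split=> [x y|c x||x y].
- by rewrite (shomD hg) (repD rr).
- by rewrite (shomZ hg) (repZ rr).
- by rewrite (shom1 hg) (rep1 rr).
- by rewrite (shomM hg) (repM rr).
Qed.

(** The representation extends to the scalar extension of the tensor power, is injective by
    simplicity, and both algebras have dimension [(n ^ q) ^ 2]. *)
Lemma brauer_trivial_of_rep (r : tensor_pow A q -> 'M[E]_(n ^ q)) :
  (0 < n)%N -> is_rep phi r -> brauer_equiv (tensor_pow (scalar_ext phi A) q) E^o.
Proof.
move=> n0 rr; have /prednK eN : (0 < n ^ q)%N by rewrite expn_gt0 n0.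
have [r' rr'] : exists r' : tensor_pow A q -> 'M[E]_((n ^ q).-1.+1), is_rep phi r'.
  by rewrite eN; exists r.
have /shom_rep hr := rr'.
have h := ext_lift_id_shom hr.
apply: (@brauer_equiv_split _ _ (n ^ q).-1).
apply: alg_iso_trans (alg_iso_sym (ext_pow phi A q)) _.
apply: alg_iso_inj h (csa_shom_inj (ext_csa phi (pow_csa q csA)) h) _.
by rewrite dim_ext dim_mx dim_pow dA eN mulnn -!expnM mulnC.
Qed.

End PowerSplitting.

(** * The index of a tensor power *)

Section FinMatrix.

Variables (E : fieldType) (I : finType).

Definition fmx (M : I -> I -> E) : 'M[E]_#|I| :=
  \matrix_(i, j) M (enum_val i) (enum_val j).

Lemma fmxM M M' : fmx M *m fmx M' = fmx (fun f h => \sum_g M f g * M' g h).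
Proof.
apply/matrixP => i j; rewrite !mxE [RHS](reindex (@enum_val I I)) /=.
  by apply: eq_bigr => k _; rewrite !mxE.
by apply: onW_bij; apply: enum_val_bij.
Qed.

Lemma fmx_eq M M' : M =2 M' -> fmx M = fmx M'.
Proof. by move=> MM; apply/matrixP => i j; rewrite !mxE MM. Qed.

Lemma fmx1 : fmx (fun f g => (f == g)%:R) = 1%:M.
Proof. by apply/matrixP => i j; rewrite !mxE (inj_eq enum_val_inj). Qed.

End FinMatrix.

Section TensorPowerRep.

Variables (K E : fieldType) (phi : {rmorphism K -> E}) (A : falgType K) (n q : nat).
Variable r : A -> 'M[E]_n.
Hypothesis rr : is_rep phi r.

Local Notation Ix := {ffun 'I_q -> 'I_n}.

Definition agree (a : 'I_q) (f g : Ix) := [forall b, (b != a) ==> (f b == g b)].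

Definition update (a : 'I_q) (f : Ix) (z : 'I_n) : Ix :=
  [ffun b => if b == a then z else f b].

Lemma agreeP (a : 'I_q) (f g : Ix) : reflect (forall b, b != a -> f b = g b) (agree a f g).
Proof.
apply: (iffP forallP) => [H b ba|H b]; first by have := H b; rewrite ba => /eqP.
by apply/implyP => /H ->.
Qed.

Lemma sum_agree a (f : Ix) (G : Ix -> E) :
  \sum_(g | agree a f g) G g = \sum_z G (update a f z).
Proof.
rewrite (reindex_onto (update a f) (fun g => g a)) /=; last first.
  move=> g /agreeP H; apply/ffunP => b; rewrite ffunE.
  by case: eqP => [->//|/eqP /H].
apply: eq_bigl => z; rewrite ffunE !eqxx andbT.
by apply/agreeP => b /negbTE ba; rewrite ffunE ba.
Qed.

(** The action of [x] on the tensor factor [a] of the [q]-th power of the module, in the basis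
    indexed by words: only the letter [f a] changes. *)
Definition slot_mx (a : 'I_q) (x : A) : 'M[E]_#|{: Ix}| :=
  fmx (fun f g : Ix => if agree a f g then r x (f a) (g a) else 0).

Lemma slot_mxM a b x y : slot_mx a x *m slot_mx b y =
  fmx (fun f h : Ix => \sum_z r x (f a) z *
     (if agree b (update a f z) h then r y (update a f z b) (h b) else 0)).
Proof.
rewrite fmxM; apply: fmx_eq => f h.
transitivity (\sum_(g | agree a f g)
    r x (f a) (g a) * (if agree b g h then r y (g b) (h b) else 0)).
  rewrite [RHS]big_mkcond; apply: eq_bigr => g _.
  by case: ifP => //; rewrite mul0r.
by rewrite sum_agree; apply: eq_bigr => z _; rewrite ffunE eqxx.
Qed.

Lemma slot_mx_rep a : is_rep phi (slot_mx a).
Proof.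
split=> [x y|c x||x y].
- apply/matrixP => i j; rewrite !mxE (repD rr) mxE.
  by case: ifP => //; rewrite addr0.
- apply/matrixP => i j; rewrite !mxE (repZ rr) mxE.
  by case: ifP => //; rewrite mulr0.
- rewrite /slot_mx (rep1 rr) -fmx1; apply: fmx_eq => f g; rewrite mxE.
  have [->|fg] := eqVneq f g; first by rewrite eqxx; case: agreeP => // - [].
  case: agreeP => // H; case: eqP => // fga; case/eqP: fg; apply/ffunP => b.
  by have [->|/H] := eqVneq b a.
- rewrite slot_mxM; apply: fmx_eq => f h; rewrite (repM rr) mxE.
  have agu z : agree a (update a f z) h = agree a f h.
    by apply/agreeP/agreeP => H b ba; have := H b ba; rewrite ffunE (negbTE ba).
  rewrite [RHS](eq_bigr (fun z => if agree a f h then r x (f a) z * r y z (h a) else 0)).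
    by case: (agree a f h) => //; rewrite big1.
  by move=> z _; rewrite agu ffunE eqxx; case: ifP => //; rewrite mulr0.
Qed.

Definition agree2 (a b : 'I_q) (f g : Ix) := [forall c, (c != a) && (c != b) ==> (f c == g c)].

Lemma slot_mx_prod a b x y : a != b -> slot_mx a x *m slot_mx b y =
  fmx (fun f h : Ix => if agree2 a b f h then r x (f a) (h a) * r y (f b) (h b) else 0).
Proof.
move=> ab; rewrite slot_mxM; apply: fmx_eq => f h.
rewrite (bigD1 (h a)) //= big1 ?addr0 => [|z zh].
  have -> : agree b (update a f (h a)) h = agree2 a b f h.
    apply/agreeP/forallP => [H c|H c cb].
      apply/implyP => /andP [ca cb]; have := H c cb.
      by rewrite ffunE (negbTE ca) => ->.
    rewrite ffunE; case: eqP => [-> //|/eqP ca].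
    by have := H c; rewrite ca cb => /eqP.
  by rewrite ffunE eq_sym (negbTE ab); case: ifP => //; rewrite mulr0.
case: agreeP => [/(_ a ab)|_]; last by rewrite mulr0.
by rewrite ffunE eqxx => /eqP; rewrite (negbTE zh).
Qed.

Lemma slot_mx_qrep : is_qrep phi slot_mx.
Proof.
split=> [a|a b x y ab]; first exact: slot_mx_rep.
rewrite !slot_mx_prod // 1?eq_sym //; apply: fmx_eq => f h.
have -> : agree2 b a f h = agree2 a b f h by apply: eq_forallb => c; rewrite andbC.
by rewrite mulrC.
Qed.

End TensorPowerRep.

(* The Goldman element: the tensor sum_(p <- G) p.1 (x) p.2 represents the
   reduced trace as a sandwich operator, hence acts on V (x) V as the swap. *)
Section Goldman.

Variables (K : fieldType) (A : falgType K) (n : nat).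
Hypotheses (csA : central_simple A) (dA : has_degree A n) (nK : n%:R != 0 :> K).

(** The trace of left multiplication by [x], divided by [n], which is invertible in [K]. *)
Definition reduced_trace (x : A) : K := n%:R^-1 * \sum_c crd c (x * bas c).

Lemma goldman_pairs : exists G : seq (A * A), forall x, sandwich G x = reduced_trace x *: 1.
Proof.
have /choice [S HS] : forall i, exists l, forall x : A, sandwich l x = crd i x *: 1.
  exact: sandwich_crd.
exists (flatten [seq lmul_pairs (reduced_trace (bas i))%:A (S i) | i <- enum 'I_(\dim {:A})]) => x.
rewrite /sandwich big_flatten /= big_map big_enum /=.
transitivity (\sum_i (reduced_trace (bas i) * crd i x) *: (1 : A)).
  apply: eq_bigr => i _; rewrite -[LHS]/(sandwich (lmul_pairs _ (S i)) x).
  by rewrite sandwich_lmul HS -scalerAl mul1r scalerA.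
rewrite -scaler_suml; congr (_ *: _); rewrite /reduced_trace.
under eq_bigr do rewrite -mulrA mulr_suml.
rewrite -mulr_sumr exchange_big /=; congr (_ * _); apply: eq_bigr => c _.
rewrite [x in RHS]crd_sum mulr_suml /crd linear_sum /=; apply: eq_bigr => i _.
by rewrite -scalerAl linearZ /= mulrC.
Qed.

Variables (E : fieldType) (phi : {rmorphism K -> E}) (r : A -> 'M[E]_n).
Hypothesis rr : is_rep phi r.

Lemma rep_basis_span X : exists c : 'I_(\dim {:A}) -> E, X = \sum_i c i *: r (bas i).
Proof.
have n0 : (0 < n)%N by case: (posnP n) nK => // ->; rewrite eqxx.
have fr := csa_rep_free csA rr n0.
have [_ sp _] : basis_fam (fun _ : 'M[E]_n => True) (fun i => r (bas i)).
  apply: free_fam_basis => // X' _ fX'.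
  have [_ sd _] := delta_basis E n n.
  have := free_fam_le fX' (X' := fun ij : 'I_n * 'I_n => delta_mx ij.1 ij.2) (fun j => sd _ I).
  by rewrite card_prod !card_ord dA -mulnn ltnn.
by have [c ->] := sp X I; exists c.
Qed.

(** Over [E], left multiplication by [x] on [A] is conjugate to left multiplication by [r x] on
    square matrices of size [n], whose trace is [n%:R * \tr (r x)]. *)
Lemma reduced_traceE x : phi (reduced_trace x) = \tr (r x).
Proof.
have n0 : (0 < n)%N by case: (posnP n) nK => // ->; rewrite eqxx.
pose P := \matrix_i mxvec (r (bas i)) : 'M[E]_(\dim {:A}, n * n).
pose M := \matrix_(i, l) phi (crd l (x * bas i)) : 'M[E]_(\dim {:A}).
pose Lx : 'M[E]_(n * n) := lin_mx (mulmx (r x)).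
have PL : P *m Lx = M *m P.
  apply/row_matrixP => i; rewrite !row_mul rowK mul_vec_lin /= -(repM rr).
  rewrite [x * bas i in LHS]crd_sum (rep_sum _ _ _ rr) linear_sum mulmx_sum_row /=.
  by apply: eq_bigr => l _; rewrite (repZ rr) linearZ /= !mxE rowK.
have fP : row_free P.
  rewrite -kermx_eq0; apply/rowV0P => v /sub_kermxP vP; apply/rowP => j; rewrite mxE.
  apply: (csa_rep_free csA rr n0 (c := fun j => v 0 j)); apply: (can_inj mxvecK).
  rewrite linear0 -vP linear_sum mulmx_sum_row /=.
  by apply: eq_bigr => i _; rewrite linearZ rowK.
have uP : row_full P.
  by move: fP; rewrite /row_free /row_full => /eqP ->; rewrite dA mulnn.
have : \tr M = \tr Lx.
  by rewrite -[M]mulmx1 -(mulmxVp fP) mulmxA -PL -mulmxA mxtrace_mulC -mulmxA mulVpmx // mulmx1.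
have -> : \tr M = phi (\sum_c crd c (x * bas c)).
  by rewrite rmorph_sum; apply: eq_bigr => i _; rewrite mxE.
have -> : \tr Lx = n%:R * \tr (r x).
  rewrite /mxtrace (reindex (uncurry (@mxvec_index n n))) /=; last first.
    exact: (curry_mxvec_bij n n).
  transitivity (\sum_i \sum_j Lx (mxvec_index i j) (mxvec_index i j)).
    by rewrite pair_bigA; apply: eq_bigr => [[i j]] _.
  rewrite mulr_sumr; apply: eq_bigr => i _.
  transitivity (\sum_(j < n) (r x) i i); last by rewrite sumr_const card_ord mulr_natl.
  apply: eq_bigr => j _; rewrite !mxE /= vec_mx_delta mxvecE.
  rewrite mxE (bigD1 i) //= mxE !eqxx mulr1 big1 ?addr0 // => k ki.
  by rewrite mxE (negbTE ki) mulr0.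
move=> H; rewrite /reduced_trace rmorphM fmorphV rmorph_nat H mulKf //.
by rewrite -(rmorph_nat phi) fmorph_eq0.
Qed.

Variable G : seq (A * A).
Hypothesis HG : forall x, sandwich G x = reduced_trace x *: 1.

Lemma goldman_mx X : \sum_(p <- G) r p.1 *m X *m r p.2 = (\tr X)%:M.
Proof.
have [c ->] := rep_basis_span X.
under eq_bigr do rewrite mulmx_sumr mulmx_suml.
rewrite exchange_big /= linear_sum /= -scalemx1 scaler_suml; apply: eq_bigr => i _.
under eq_bigr do rewrite -scalemxAr -scalemxAl -!(repM rr).
rewrite -scaler_sumr -(rep_sum _ _ _ rr) -[\sum_(_ <- G) _]/(sandwich G (bas i)) HG.
by rewrite (repZ rr) (rep1 rr) reduced_traceE scalerA linearZ.
Qed.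

(** [goldman_mx] evaluated at matrix units; these are the entries of the swap on V (x) V. *)
Lemma goldman_entries i j k l :
  \sum_(p <- G) r p.1 i j * r p.2 k l = (i == l)%:R * (j == k)%:R.
Proof.
have /matrixP/(_ i l) := goldman_mx (delta_mx j k).
rewrite summxE !mxE => H; transitivity (\tr (delta_mx j k : 'M[E]_n) *+ (i == l)).
  rewrite -H; apply: eq_bigr => p _.
  rewrite mxE (bigD1 k) //= big1 ?addr0 => [|m mk].
    rewrite mxE (bigD1 j) //= big1 ?addr0 => [|m mj]; first by rewrite mxE !eqxx mulr1.
    by rewrite mxE (negbTE mj) mulr0.
  rewrite mxE big1 ?mul0r // => m' _.
  by rewrite mxE (negbTE mk) andbF mulr0.
rewrite mulr_natl; congr (_ *+ _).
rewrite /mxtrace (bigD1 j) //= mxE eqxx big1 ?addr0 // => m mj.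
by rewrite mxE (negbTE mj).
Qed.

Variable q : nat.
Local Notation Ix := {ffun 'I_q -> 'I_n}.

Definition permute (s : 'S_q) (f : Ix) : Ix := [ffun c => f (s c)].

Lemma goldman_swap (a b : 'I_q) : a != b ->
  \sum_(p <- G) slot_mx r a p.1 *m slot_mx r b p.2 =
  fmx (fun f h : Ix => (h == permute (tperm a b) f)%:R).
Proof.
move=> ab; transitivity (fmx (fun f h : Ix => \sum_(p <- G)
     if agree2 a b f h then r p.1 (f a) (h a) * r p.2 (f b) (h b) else 0)).
  under eq_bigr do rewrite slot_mx_prod //.
  by apply/matrixP => i j; rewrite summxE mxE; apply: eq_bigr => p _; rewrite mxE.
apply: fmx_eq => f h; have [H|] := boolP (agree2 a b f h); last first.
  rewrite big1 // => /forallPn [c]; rewrite negb_imply => /andP [/andP [ca cb] fh].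
  by case: eqP => // hE; move: fh; rewrite hE ffunE tpermD ?eqxx // eq_sym.
rewrite goldman_entries -natrM mulnb; congr (nat_of_bool _)%:R.
apply/andP/eqP => [[/eqP fh /eqP hf]|->]; last first.
  by rewrite !ffunE tpermL tpermR.
apply/ffunP => c; rewrite ffunE; case: tpermP => [->|->|/eqP ca /eqP cb].
- by rewrite hf.
- by rewrite fh.
- by move/forallP: H => /(_ c); rewrite ca cb => /eqP.
Qed.

End Goldman.

(** * Words up to permutation and the symmetric power *)

Section SortedWords.

Variables (n q : nat).
Local Notation Ix := {ffun 'I_q -> 'I_n}.

Definition word (f : Ix) : q.-tuple 'I_n := [tuple f i | i < q].
Definition unword (t : q.-tuple 'I_n) : Ix := [ffun i => tnth t i].

Definition ord_le (x y : 'I_n) := (x <= y)%N.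

Definition sorted_word (f : Ix) : q.-tuple 'I_n := [tuple of sort ord_le (word f)].

Lemma sorted_wordP f : sorted leq (map val (sorted_word f)).
Proof.
rewrite sorted_map; apply: (sort_sorted (leT := ord_le)) => x y; exact: leq_total.
Qed.

Lemma sorted_word_id (t : q.-tuple 'I_n) : sorted leq (map val t) -> sorted_word (unword t) = t.
Proof.
rewrite sorted_map => st; apply: val_inj => /=.
have -> : [seq unword t i | i <- enum 'I_q] = t.
  rewrite -[RHS]map_tnth_enum; apply: eq_map => i; exact: ffunE.
apply: sorted_sort => //; move=> x y z; exact: leq_trans.
Qed.

Lemma sorted_word_permute f g : sorted_word f = sorted_word g ->
  exists s : 'S_q, g = permute s f.
Proof.
move=> fg; have : perm_eq (word g) (word f).
  apply: perm_trans (_ : perm_eq (sorted_word g) _); first by rewrite perm_sym perm_sort.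
  by rewrite -fg perm_sort.
move=> /tuple_permP [s sE]; exists s; apply/ffunP => i; rewrite ffunE.
have -> : g i = tnth (word g) i by rewrite tnth_mktuple.
by rewrite (val_inj sE : word g = _) !tnth_mktuple.
Qed.

Lemma sorted_word_swap f a b : sorted_word (permute (tperm a b) f) = sorted_word f.
Proof.
apply: val_inj; apply/perm_sortP.
- by move=> x y; exact: leq_total.
- by move=> x y z; exact: leq_trans.
- by move=> x y /anti_leq/val_inj.
apply/tuple_permP; exists (tperm a b); congr val; apply: eq_from_tnth => i.
by rewrite !tnth_mktuple ffunE.
Qed.

Lemma swap_invariant (X : Type) (F : Ix -> X) :
  (forall a b f, a != b -> F (permute (tperm a b) f) = F f) ->
  forall s f, F (permute s f) = F f.
Proof.
move=> H s f; have [ts -> ats] := prod_tpermP s.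
elim: ts ats f => [|[a b] ts IH] /=.
  by move=> _ f; congr F; apply/ffunP => i; rewrite big_nil ffunE perm1.
move=> /andP [ab ats] f; rewrite big_cons.
have -> : permute (tperm a b * \prod_(t <- ts) tperm t.1 t.2)%g f =
    permute (tperm a b) (permute (\prod_(t <- ts) tperm t.1 t.2)%g f).
  by apply/ffunP => i; rewrite !ffunE permM.
by rewrite H // IH.
Qed.

Definition swords := {t : q.-tuple 'I_n | sorted leq (map val t)}.

Definition sword_of (f : Ix) : swords := exist _ (sorted_word f) (sorted_wordP f).

End SortedWords.

(** This is the number of monomials of degree [q] in [n.+1] variables, the dimension of the
    symmetric power. *)
Lemma card_swords n q : #|{: swords n.+1 q}| = 'C(q + n, q).
Proof. by rewrite card_sig -card_sorted_tuples cardsE. Qed.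

Section SymmetricModule.

Variables (K : fieldType) (A : falgType K) (n q : nat).
Hypotheses (csA : central_simple A) (dA : has_degree A n) (nK : n%:R != 0 :> K).
Variables (E : fieldType) (phi : {rmorphism K -> E}) (r : A -> 'M[E]_n).
Hypothesis rr : is_rep phi r.

Local Notation Ix := {ffun 'I_q -> 'I_n}.
Local Notation D := (tensor_pow A q).

Variable G : seq (A * A).
Hypothesis HG : forall x, sandwich G x = reduced_trace n x *: 1.

Definition swap_elt (a b : 'I_q) : D := \sum_(p <- G) slot a p.1 * slot b p.2.

Definition swap_invariants (y : D) : Prop := forall a b, a != b -> swap_elt a b * y = y.

Variable P : D -> 'M[E]_#|{: Ix}|.
Hypotheses (hP : is_rep phi P) (PR : forall a x, P (slot a x) = slot_mx r a x).

Let n_gt0 : (0 < n)%N.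
Proof. by case: (posnP n) nK => // ->; rewrite eqxx. Qed.

Let N_gt0 : (0 < #|{: Ix}|)%N.
Proof. by rewrite card_ffun !card_ord expn_gt0 n_gt0. Qed.

Lemma swap_elt_mx a b : a != b ->
  P (swap_elt a b) = fmx (fun f h : Ix => (h == permute (tperm a b) f)%:R).
Proof.
move=> ab; rewrite -(goldman_swap csA dA nK rr HG ab) /swap_elt (rep_sum _ _ _ hP).
by apply: eq_bigr => p _; rewrite (repM hP) !PR.
Qed.

Definition swap_system : 'M[K]_(\dim {:D}, #|{: 'I_q * 'I_q * 'I_(\dim {:D})}|) :=
  \matrix_(i, e) let: (a, b, k) := enum_val e in
    if a != b then crd k (swap_elt a b * bas i - bas i) else 0.

(** The action [h] on the span of a free family [e] is abstract because the lemma serves twice: for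
    the tensor power over [K] and for its image in matrices over [E]. *)
Lemma swap_systemE (E' : fieldType) (psi : {rmorphism K -> E'}) (V : lmodType E')
    (e : 'I_(\dim {:D}) -> V) (h : 'I_q -> 'I_q -> V -> V)
    (v : 'rV[E']_(\dim {:D})) : free_fam e ->
  (forall a b, a != b -> h a b (\sum_i v 0 i *: e i) - \sum_i v 0 i *: e i =
     \sum_i v 0 i *: \sum_k psi (crd k (swap_elt a b * bas i - bas i)) *: e k) ->
  v *m map_mx psi swap_system = 0 <->
  forall a b, a != b -> h a b (\sum_i v 0 i *: e i) = \sum_i v 0 i *: e i.
Proof.
move=> fe he.
have heE a b : a != b -> h a b (\sum_i v 0 i *: e i) - \sum_i v 0 i *: e i =
    \sum_k (\sum_i v 0 i * psi (crd k (swap_elt a b * bas i - bas i))) *: e k.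
  move=> ab; rewrite he //; under eq_bigr do rewrite scaler_sumr.
  rewrite exchange_big /=; apply: eq_bigr => k _; rewrite scaler_suml.
  by apply: eq_bigr => i _; rewrite scalerA.
split=> [/matrixP vS a b ab|H].
  apply/eqP; rewrite -subr_eq0 heE // big1 // => k _.
  have := vS 0 (enum_rank (a, b, k)); rewrite !mxE => vk.
  rewrite [X in X *: _](_ : _ = 0) ?scale0r // -[RHS]vk; apply: eq_bigr => i _.
  by rewrite !mxE enum_rankK ab.
apply/matrixP => i0 j; rewrite (ord1 i0) !mxE; case jE: (enum_val j) => [[a b] k].
under eq_bigr do rewrite !mxE jE.
case: (boolP (a != b)) => ab; last by rewrite big1 // => i _; rewrite rmorph0 mulr0.
have := heE a b ab; rewrite H // subrr => /esym H0; exact: (fe _ H0 k).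
Qed.

Lemma regular_rep (B : falgType K) :
  is_rep idfun (fun x : B => \matrix_(a, c) crd c (bas a * x)).
Proof.
split=> [x y|d x||x y]; apply/matrixP => a c; rewrite !mxE.
- by rewrite mulrDr /crd linearD.
- by rewrite -scalerAr /crd linearZ.
- by rewrite mulr1 crd_bas eq_sym.
- rewrite mulrA -crd_mull; apply: eq_bigr => l _; by rewrite !mxE.
Qed.

Lemma bas_free (B : falgType K) : free_fam (fun i => bas i : B).
Proof.
move=> c cS i; have := congr1 (crd i) cS; rewrite {1}/crd linear_sum (bigD1 i) //= big1.
  by rewrite addr0 linearZ /= -/(crd i _) crd_bas eqxx mulr1 /crd linear0.
by move=> k ki; rewrite linearZ /= -/(crd i _) crd_bas eq_sym (negbTE ki) mulr0.
Qed.

Lemma swap_invariants_coord (v : 'rV[K]_(\dim {:D})) :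
  v *m swap_system = 0 <-> swap_invariants (\sum_i v 0 i *: bas i).
Proof.
rewrite -[swap_system](map_mx_id_in (f := idfun)) //.
apply: (swap_systemE (psi := idfun) (h := fun a b y => swap_elt a b * y)).
  exact: bas_free.
move=> a b ab; rewrite mulr_sumr -sumrB; apply: eq_bigr => i _.
by rewrite -crd_sum -scalerAr scalerBr.
Qed.

(** The invariants form a right ideal, on whose coordinate rows the algebra acts by right
    multiplication. *)
Lemma swap_invariants_rep : exists R : D -> 'M[K]_(\rank (kermx swap_system)), is_rep idfun R.
Proof.
pose R (_ : 'I_1) (x : D) : 'M[K]_(\dim {:D}) := \matrix_(a, c) crd c (bas a * x).
have qR : is_qrep idfun R.
  by split=> [a|a b x y]; [exact: regular_rep|rewrite (ord1 a) (ord1 b) eqxx].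
have [|T qT] := subrep_exists qR (row_base_free (kermx swap_system)); last first.
  by exists (T ord0); apply: (qrep_rep qT).
move=> a x; rewrite !eq_row_base.
apply: submx_trans (submxMr _ (_ : _ <= kermx swap_system)%MS) _; first by rewrite eq_row_base.
apply/row_subP => i; apply/sub_kermxP/swap_invariants_coord => b c bc.
have : row i (kermx swap_system) *m swap_system = 0 by rewrite -row_mul mulmx_ker row0.
set u := row i _ => /swap_invariants_coord/(_ b c bc) Hu.
have -> : \sum_k row i (kermx swap_system *m R a x) 0 k *: bas k = (\sum_k u 0 k *: bas k) * x.
  rewrite row_mul -/u mulr_suml [RHS]crd_sum; apply: eq_bigr => k _; congr (_ *: _).
  rewrite mxE /crd linear_sum; apply: eq_bigr => l _.
  by rewrite [R a x l k]mxE -scalerAl linearZ.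
by rewrite mulrA Hu.
Qed.

Definition swap_invariants_mx (X : 'M[E]_#|{: Ix}|) : Prop :=
  forall a b, a != b -> P (swap_elt a b) *m X = X.

Lemma swap_invariants_mxE X : swap_invariants_mx X <->
  forall s f l, X (enum_rank (permute s f)) l = X (enum_rank f) l.
Proof.
have swE a b f l : a != b ->
    (P (swap_elt a b) *m X) (enum_rank f) l = X (enum_rank (permute (tperm a b) f)) l.
  move=> ab; rewrite swap_elt_mx // mxE (bigD1 (enum_rank (permute (tperm a b) f))) //=.
  rewrite mxE !enum_rankK eqxx mul1r big1 ?addr0 // => k kf.
  rewrite mxE enum_rankK; case: eqP => [ke|]; last by rewrite mul0r.
  by case/eqP: kf; rewrite -ke enum_valK.
split=> [H s f l|H a b ab].
  apply: (swap_invariant (F := fun f => X (enum_rank f) l)) => a b {}f ab.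
  by rewrite -swE // H.
by apply/matrixP => i l; rewrite -[i]enum_valK swE // H.
Qed.

Lemma swap_invariants_mx_basis : basis_fam swap_invariants_mx
  (fun tl : swords n q * 'I_#|{: Ix}| =>
     \matrix_(i, j) ((sorted_word (enum_val i) == val tl.1) && (j == tl.2))%:R).
Proof.
have val_at (c : swords n q * 'I_#|{: Ix}| -> E) f l (t : swords n q) : sorted_word f = val t ->
   (\sum_tl c tl *: \matrix_(i, j)
     ((sorted_word (enum_val i) == val tl.1) && (j == tl.2))%:R : 'M[E]_#|{: Ix}|)
      (enum_rank f) l = c (t, l).
  move=> ft; rewrite summxE (bigD1 (t, l)) //= !mxE enum_rankK ft !eqxx mulr1.
  rewrite big1 ?addr0 // => [[t' l']] tl; rewrite !mxE enum_rankK ft /=.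
  case: eqP => [/val_inj tt|_]; last by rewrite mulr0.
  case: eqP => [ll|_]; last by rewrite mulr0.
  by case/eqP: tl; rewrite tt ll.
split.
- move=> [t l]; apply/swap_invariants_mxE => s f j; rewrite !mxE !enum_rankK /=.
  congr (nat_of_bool (_ && _))%:R; congr (_ == _).
  apply: (swap_invariant (F := @sorted_word n q)) => a b {}f _.
  exact: sorted_word_swap.
- move=> X /swap_invariants_mxE HX.
  exists (fun tl => X (enum_rank (unword (val tl.1))) tl.2).
  apply/matrixP => i l; rewrite -[i]enum_valK; set f := enum_val i.
  rewrite (val_at _ _ _ (sword_of f)) //=.
  have [s ->] : exists s, f = permute s (unword (sorted_word f)).
    by apply: sorted_word_permute; rewrite sorted_word_id // sorted_wordP.
  rewrite HX; congr (X (enum_rank _) l); congr unword.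
  by rewrite (swap_invariant (F := @sorted_word n q)) ?sorted_word_id ?sorted_wordP // => *; apply: sorted_word_swap.
- move=> c cS [t l].
  have := val_at c (unword (val t)) l t (sorted_word_id (valP t)).
  by rewrite cS mxE.
Qed.

(** The rank of the system is unchanged by [phi]. Over [E] the algebra becomes the full matrix
    algebra, and a matrix is invariant when its rows depend only on the sorted word of the row
    index. *)
Lemma swap_system_dim : \rank (kermx swap_system) = (#|{: swords n q}| * n ^ q)%N.
Proof.
pose Cm := map_mx phi swap_system; pose B := row_base (kermx Cm).
have rkE : \rank (kermx swap_system) = \rank (kermx Cm).
  by rewrite !mxrank_ker mxrank_map.
pose e i := P (bas i : D).
have fe : free_fam e by apply: csa_rep_free (pow_csa q csA) hP N_gt0.
pose toE (v : 'rV[E]_(\dim {:D})) := \sum_i v 0 i *: e i.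
have kE v : v *m Cm = 0 <-> swap_invariants_mx (toE v).
  apply: (swap_systemE (h := fun a b y => P (swap_elt a b) *m y)) fe _.
  move=> a b ab; rewrite mulmx_sumr -sumrB; apply: eq_bigr => i _.
  rewrite -scalemxAr -scalerBr -(repM hP) -(repB _ _ hP); congr (_ *: _).
  rewrite [X in P X](crd_sum (_ - _)) (rep_sum _ _ _ hP).
  by apply: eq_bigr => k _; rewrite (repZ hP).
have sE X : exists v, X = toE v.
  have : basis_fam (fun _ : 'M[E]_#|{: Ix}| => True) e.
    apply: free_fam_basis => // X' _ fX'.
    have [_ sd _] := delta_basis E #|{: Ix}| #|{: Ix}|.
    have := free_fam_le fX' (X' := fun ij : 'I_#|{: Ix}| * 'I_#|{: Ix}| => delta_mx ij.1 ij.2) (fun j => sd _ I).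
    rewrite card_prod !card_ord dim_pow dA card_ffun !card_ord.
    by rewrite -expnM mulnC expnM -mulnn ltnn.
  move=> [_ /(_ X I) [c ->] _]; exists (\row_i c i).
  by apply: eq_bigr => i _; rewrite mxE.
have toEsum (m : nat) (c : 'I_m -> E) (M : 'M[E]_(m, \dim {:D})) :
    toE ((\row_j c j) *m M) = \sum_j c j *: toE (row j M).
  rewrite /toE; under [RHS]eq_bigr do rewrite scaler_sumr.
  rewrite [RHS]exchange_big /=; apply: eq_bigr => i _.
  rewrite mxE scaler_suml; apply: eq_bigr => j _.
  by rewrite !mxE scalerA.
have bE : basis_fam swap_invariants_mx (fun j => toE (row j B)).
  split.
  - move=> j; apply/kE/sub_kermxP.
    by apply: submx_trans (row_sub _ _) _; rewrite eq_row_base.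
  - move=> X; have [v ->] := sE X; move=> /kE/sub_kermxP; rewrite -(eq_row_base (kermx Cm)).
    move=> /submxP [w ->]; exists (fun j => w 0 j).
    by rewrite -toEsum; congr (toE (_ *m _)); apply/rowP => j; rewrite mxE.
  - move=> c; rewrite -toEsum => /fe H j.
    have /(row_free_inj (row_base_free _))/rowP/(_ j) : (\row_j c j) *m B = 0 *m B.
      by rewrite mul0mx; apply/rowP => i; rewrite H mxE.
    by rewrite !mxE.
have := basis_fam_card bE swap_invariants_mx_basis.
rewrite rkE card_ord => ->.
by rewrite card_prod card_ord card_ffun !card_ord.
Qed.

End SymmetricModule.

(* The elements of tensor_pow A q fixed by all Goldman elements form a right
   ideal, which becomes Hom(V^(x)q, Sym^q V) once A is split by V. *)
Lemma symmetric_power_rep (K : fieldType) (A : falgType K) n q (E : fieldType)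
    (phi : {rmorphism K -> E}) (r : A -> 'M[E]_n.+1) :
  central_simple A -> has_degree A n.+1 -> n.+1%:R != 0 :> K -> is_rep phi r ->
  exists R : tensor_pow A q -> 'M[K]_('C(q + n, q) * n.+1 ^ q), is_rep idfun R.
Proof.
move=> csA dA nK rr.
have [G HG] := goldman_pairs n.+1 csA.
have [P [hP PR]] := qrep_pow_rep (slot_mx_qrep q rr).
rewrite -card_swords -(swap_system_dim csA dA nK rr HG hP PR).
exact: swap_invariants_rep.
Qed.

Section IndexBound.

Variables (K : fieldType) (A : falgType K) (p s t : nat).
Hypotheses (pp : prime p) (s0 : (0 < s)%N) (t0 : (0 < t)%N).
Hypotheses (csA : central_simple A) (dA : has_degree A (p ^ s)) (pK : p%:R != 0 :> K).

Local Notation D := (tensor_pow A (p ^ t)).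
Local Notation N := ((p ^ s) ^ (p ^ t))%N.

Lemma pow_has_degree q n : has_degree A n -> has_degree (tensor_pow A q) (n ^ q).
Proof. by move=> dn; rewrite /has_degree dim_pow dn -!expnM mulnC. Qed.

(* The index e * N of D divides N * 'C(p ^ t + p ^ s - 1, p ^ t) by the symmetric
   power, and e is a power of p because N divides e * N divides N ^ 2. *)
Lemma small_rep (E : fieldType) (phi : {rmorphism K -> E}) (r : A -> 'M[E]_(p ^ s)) :
  is_rep phi r -> exists e (R : D -> 'M[K]_(e * N)),
   [/\ is_rep idfun R, (0 < e)%N & (e <= p ^ (s - t))%N].
Proof.
move=> rr; have csD := pow_csa (p ^ t) csA.
have pg k : (0 < p ^ k)%N by rewrite expn_gt0 prime_gt0.
have N0 : (0 < N)%N by rewrite expn_gt0 pg.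
pose Q k := `[< (0 < k)%N /\ exists R : D -> 'M[K]_k, is_rep idfun R >].
have exQ : exists k, Q k.
  exists (\dim {:D}); apply/asboolP; split; first exact: dim_alg_gt0.
  by exists (fun x => \matrix_(a, c) crd c (bas a * x)); apply: regular_rep.
case: (ex_minnP exQ) => k0 /asboolP [k0_gt0 [R0 rR0]] min.
have dvd k (R : D -> 'M[K]_k) : is_rep idfun R -> (k0 %| k)%N.
  move=> rR; apply: (min_rep_dvd csD k0_gt0 (rep_qrep1 rR0) _ (rep_qrep1 rR)).
  move=> k' R' k'0 qR'; apply: min; apply/asboolP; split=> //.
  by exists (R' ord0); apply: qrep_rep.
have /dvdnP [e eE] : (N %| k0)%N.
  by have := rep_dim_dvd csD (pow_has_degree (p ^ t) dA) (rep_qrep1 rR0); rewrite expn1.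
subst k0; exists e, R0; split=> //; first by case: e k0_gt0 {min dvd R0 rR0}.
apply: (@dvd_bin_prime_power p s t) => //.
  have psE : (p ^ s = (p ^ s).-1.+1)%N by rewrite prednK.
  have [R rR] : exists R : D -> 'M[K]_('C(p ^ t + (p ^ s).-1, p ^ t) * (p ^ s) ^ (p ^ t)), is_rep idfun R.
    move: r rr dA; rewrite psE => r rr dA'.
    apply: symmetric_power_rep csA dA' _ rr.
    by rewrite -psE natrX expf_neq0.
  by have := dvd _ _ rR; rewrite dvdn_pmul2r.
have : (e %| N)%N.
  have := dvd _ _ (regular_rep D); rewrite dim_pow dA -mulnn expnMn.
  by rewrite dvdn_pmul2r.
rewrite -expnM => /(dvdn_pfactor _ _ pp) [i _ ->]; by exists i.
Qed.

End IndexBound.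

(** * The field of definition *)

Lemma row_free_colsub (F : fieldType) N k (Y : 'M[F]_(N, k)) : row_free Y ->
  exists f : 'I_N -> 'I_k, colsub f Y \in unitmx.
Proof.
move=> fY; have fY' : row_full Y^T by rewrite /row_full mxrank_tr.
exists (fullrankfun fY'); rewrite -unitmx_tr.
have -> : (colsub (fullrankfun fY') Y)^T = rowsub (fullrankfun fY') Y^T.
  by apply/matrixP => i l; rewrite !mxE.
exact: fullrowsub_unit.
Qed.

(** The normalization forces the left factor to be the inverse of [colsub f Y]; the result is an
    invariant of the row space. *)
Lemma normalized_unique (F : fieldType) N k (f : 'I_N -> 'I_k) (Y : 'M[F]_(N, k))
    (U U' : 'M[F]_N) :
  colsub f (U *m Y) = 1%:M -> colsub f (U' *m Y) = 1%:M -> U *m Y = U' *m Y.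
Proof.
rewrite -!mulmx_colsub => UY U'Y; have YU := mulmx1C UY.
by rewrite -[U' in RHS]mulmx1 -YU mulmxA U'Y mul1mx.
Qed.

Lemma acl_genfield (F : fieldType) (S : F -> Prop) y : genfield (acl S) y -> acl S y.
Proof. exact: genfield_sub_acl. Qed.

Lemma acl_normalized (F : fieldType) (S : F -> Prop) N k (f : 'I_N -> 'I_k)
    (Y : 'M[F]_(N, k)) : (forall i l, acl S (Y i l)) ->
  forall i l, acl S ((invmx (colsub f Y) *m Y) i l).
Proof.
move=> HY; have HY' i l : Y i l \in genfield_pred (acl S).
  by apply/genfieldP/genfield_mem.
pose Y1 : 'M[gfield (acl S)]_(N, k) := \matrix_(i, l) GField (HY' i l).
have -> : Y = map_mx (@gval F _) Y1 by apply/matrixP => i l; rewrite !mxE.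
move=> i l; rewrite -map_mxsub -map_invmx -map_mxM mxE.
by apply: acl_genfield; apply/genfieldP/gvalP.
Qed.

Section FieldOfDefinition.

Variables (K F : fieldType) (j : {rmorphism K -> F}) (A : falgType K) (p s t : nat).
Hypotheses (pp : prime p) (s0 : (0 < s)%N) (t0 : (0 < t)%N).
Hypotheses (csA : central_simple A) (dA : has_degree A (p ^ s)) (pK : p%:R != 0 :> K).

Local Notation D := (tensor_pow A (p ^ t)).
Local Notation N := ((p ^ s) ^ (p ^ t))%N.

Variables (V : D -> 'M[F]_N) (rho : F).
Hypotheses (rV : is_rep j V) (rho_alg : acl (im j) rho).

Let N_gt0 : (0 < N)%N.
Proof. by rewrite !expn_gt0 prime_gt0. Qed.

Let csD : central_simple D := pow_csa (p ^ t) csA.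

Let dD : has_degree D N := pow_has_degree (p ^ t) dA.

Section NormalForm.

Variables (k : nat) (R0 : D -> 'M[K]_k) (Y : 'M[F]_(N, k)) (f : 'I_N -> 'I_k).
Hypotheses (rR0 : is_rep idfun R0) (uY : colsub f Y \in unitmx).
Hypothesis HY : forall x, V x *m Y = Y *m map_mx j (R0 x).

Let Xh := invmx (colsub f Y) *m Y.

Let colXh : colsub f Xh = 1%:M.
Proof. by rewrite -mulmx_colsub mulVmx. Qed.

Definition normal_form_gens (u : F) : Prop :=
  [\/ im j u, exists i l, u = Xh i l | u = rho].

Lemma normal_form_base x : genfield normal_form_gens (j x).
Proof. by apply: genfield_mem; constructor 1; exists x. Qed.

Local Notation M := (gfield normal_form_gens).
Local Notation jM := (corestrict normal_form_base).

(** The row space of [Xh] is a submodule of [R0] isomorphic to [V] over [F]. Coordinates with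
    respect to its rows are read off in the columns [f], so the action [tau] has entries in [M]. *)
Lemma normal_form_rep : exists R : D -> 'M[M]_N, is_rep jM R.
Proof.
have HX i l : Xh i l \in genfield_pred normal_form_gens.
  by apply/genfieldP/genfield_mem; constructor 2; exists i, l.
pose XM : 'M[M]_(N, k) := \matrix_(i, l) GField (HX i l).
have XME : map_mx (@gval F _) XM = Xh by apply/matrixP => i l; rewrite !mxE.
pose RM x := map_mx jM (R0 x).
have rRM : is_rep jM RM by apply: (is_rep_map (psi := jM) _ rR0).
have jRM x : map_mx (@gval F _) (RM x) = map_mx j (R0 x).
  by apply/matrixP => i l; rewrite !mxE.
have injM a c : injective (map_mx (@gval F normal_form_gens) : 'M_(a, c) -> 'M_(a, c)).
  by move=> B C BC; apply/matrixP => i l; have /matrixP/(_ i l) := BC; rewrite !mxE => /val_inj.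
have fXM : row_free XM.
  apply/row_freeP; exists (colsub f 1%:M); rewrite mulmx_colsub mulmx1.
  by apply: injM; rewrite map_mxsub XME colXh map_mx1.
pose tau x := colsub f (XM *m RM x).
have Htau x : XM *m RM x = tau x *m XM.
  apply: injM; rewrite !map_mxM map_mxsub map_mxM XME jRM.
  have XR : Xh *m map_mx j (R0 x) = (invmx (colsub f Y) *m V x *m colsub f Y) *m Xh.
    rewrite /Xh -!mulmxA -HY; congr (_ *m (_ *m _)).
    by rewrite mulmxA mulmxV // mul1mx.
  rewrite XR -[X in X *m Xh = _]mulmx1 -colXh; congr (_ *m _).
  by rewrite mulmx_colsub.
exists tau; have := subrep (rep_qrep1 rRM) fXM (T := fun _ => tau) (fun _ x => Htau x).
by move/qrep_rep => /(_ ord0).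
Qed.

End NormalForm.

(** Over [F'] the module [V] is isomorphic, through [W], to a module [V'] defined over an algebraic
    extension [T] of [K]. Intertwiners from [V'] to [R0] have a basis [X] of size [e] with entries
    in [T], so the submodule is described by [e] coefficients [z]. Neither [W] nor a scalar affects
    the normal form, whose entries are therefore algebraic over [K] and [e - 1] ratios of the
    coefficients. *)
Lemma field_of_definition : exists (X : F -> Prop) (jX : forall x, genfield X (j x)),
  [/\ genfield X rho, exists R : D -> 'M[gfield X]_N, is_rep (corestrict jX) R &
    exists (F' : fieldType) (b : {rmorphism F -> F'}) (zs : seq F'),
      (size zs < p ^ (s - t))%N /\
      forall u, X u -> acl (adjoin_seq (im (b \o j)) zs) (b u)].
Proof.
have [F' [b [T [jT [Talg [r rr]]]]]] := splitting_extension j csA dA.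
have [e [R0 [rR0 e0 eps]]] := small_rep pp s0 t0 csA dA pK rr.
pose E := gfield T; pose phi : {rmorphism K -> E} := corestrict jT.
have [V' rV'] : exists V' : D -> 'M[E]_N, is_rep phi V'.
  have [P [hP _]] := qrep_pow_rep (slot_mx_qrep (p ^ t) rr).
  have cE : #|{: {ffun 'I_(p ^ t) -> 'I_(p ^ s)}}| = N by rewrite card_ffun !card_ord.
  by rewrite -cE; exists P.
pose R0E x := map_mx phi (R0 x).
have rR0E : is_rep phi R0E by apply: (is_rep_map (psi := phi) _ rR0).
pose V1 (_ : 'I_1) := V'; pose R1 (_ : 'I_1) := R0E.
have qV1 := rep_qrep1 rV'; have qR1 := rep_qrep1 rR0E.
have [m [X bX]] := intertwines_basis V1 R1.
(* The dimension formula reads [N * N * m = N * (e * N)]. *)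
have me : m = e.
  have := intertwines_dim csD qV1 qR1 bX.
  rewrite card_ord expn1 dD -mulnn -mulnA => /eqP.
  by rewrite eqn_pmul2l // mulnC eqn_pmul2r // => /eqP.
subst m.
pose R0F x := map_mx j (R0 x).
have rR0F : is_rep j R0F by apply: (is_rep_map (psi := j) _ rR0).
have k0 : (0 < e * N)%N by rewrite muln_gt0 e0.
have [Y Y0 HY] := intertwines_neq0 csD (rep_qrep1 rV) (rep_qrep1 rR0F) (leqnn 1) N_gt0 k0.
have fY : row_free Y.
  exact: (@intertwines_row_free _ _ j D 1 csD N dD _ (fun=> V) _ Y (rep_qrep1 rV) HY Y0).
have [f uY] := row_free_colsub fY.
have HY' x : V x *m Y = Y *m map_mx j (R0 x) by apply: (HY ord0).
exists (normal_form_gens Y f), (normal_form_base Y f); split.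
- by apply: genfield_mem; constructor 3.
- exact: (normal_form_rep rR0 uY HY').
pose chi : {rmorphism K -> F'} := b \o j.
have rVb : is_rep chi (fun x => map_mx b (V x)) by apply: (is_rep_map _ rV).
have rV'b : is_rep chi (fun x => map_mx (@gval F' T) (V' x)) by apply: (is_rep_map _ rV').
have [W W0 HW] := intertwines_neq0 csD (rep_qrep1 rV'b) (rep_qrep1 rVb) (leqnn 1) N_gt0 N_gt0.
have uW : W \in unitmx.
  rewrite -row_free_unit.
  exact: (@intertwines_row_free _ _ chi D 1 csD N dD _ _ _ W (rep_qrep1 rV'b) HW W0).
pose Y' := W *m map_mx b Y.
have HYb : intertwines (fun _ : 'I_1 => fun x => map_mx (@gval F' T) (V' x))
    (fun _ : 'I_1 => fun x => map_mx (@gval F' T) (R0E x)) 1 Y'.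
  move=> a a1 x; rewrite /Y' mulmxA (HW ord0) // -!mulmxA -map_mxM HY' map_mxM.
  by congr (_ *m (_ *m _)); apply/matrixP => i l; rewrite !mxE.
have [_ sX _] := intertwines_basis_map (phi := phi) (psi := @gval F' T) (phi2 := chi) (fun _ => erefl) csD qV1 qR1 bX.
have [z zE] := sX _ HYb.
have Y'0 : Y' != 0.
  apply: contraNneq Y0 => Y'0; rewrite -(map_mx_eq0 b).
  by rewrite -[map_mx b Y](mulKmx uW) -/Y' Y'0 mulmx0.
have [i0 zi0] : exists i0, z i0 != 0.
  apply/existsP; apply: contraNT Y'0; rewrite negb_exists => /forallP H.
  by rewrite zE big1 // => i _; have := H i; rewrite negbK => /eqP ->; rewrite scale0r.
(* Scaling makes the coefficient at [i0] equal to 1, which leaves [e - 1] parameters. *)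
pose z' i := (z i0)^-1 * z i.
pose zs := [seq z' i | i <- rem i0 (enum 'I_e)].
exists F', b, zs; split.
  rewrite size_map size_rem ?mem_enum // -cardE card_ord.
  by case: e e0 eps {R0 rR0 R0E rR0E R1 qR1 X bX R0F rR0F k0 Y Y0 HY fY f uY HY' Y' HYb sX z zE Y'0 i0 zi0 z' zs}.
set S := adjoin_seq (im (b \o j)) zs.
have imS u : acl (im (b \o j)) u -> acl S u by apply: acl_sub => w; left.
have zS i : acl S (z' i).
  have [->|ii0] := eqVneq i i0.
    by rewrite /z' mulVf //; apply/genfield_acl/genfield1.
  apply: acl_mem; right; apply: map_f.
  by rewrite rem_filter ?enum_uniq // mem_filter /= ii0 mem_enum.
have TS (x : gfield T) : acl S (gval x).
  apply: imS; apply: genfield_sub_acl Talg _; exact/genfieldP/gvalP.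
pose W' := (z i0)^-1 *: W.
pose Y'' := W' *m map_mx b Y.
have uW' : W' \in unitmx by rewrite unitmxZ // unitfE invr_eq0.
have Y''S i l : acl S (Y'' i l).
  have -> : Y'' = \sum_k z' k *: map_mx (@gval F' T) (X k).
    rewrite /Y'' /W' -scalemxAl -/Y' zE scaler_sumr.
    by apply: eq_bigr => k _; rewrite scalerA.
  rewrite summxE; elim/big_ind: _ => [|x y Hx Hy|k _].
  - exact: algebraic0.
  - exact: algebraic_add.
  - by rewrite !mxE; apply: algebraic_mul; [exact: zS|exact: TS].
(* [Y''] and the image of [Y] differ by an invertible left factor, so they have the same normal
   form. *)
have XhE : map_mx b (invmx (colsub f Y) *m Y) = invmx (colsub f Y'') *m Y''.
  rewrite map_mxM /Y'' mulmxA; apply: (@normalized_unique _ _ _ f).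
    by rewrite -mulmx_colsub -[colsub f (map_mx b Y)]map_mxsub -map_mxM mulVmx // map_mx1.
  rewrite -mulmxA -/Y'' -mulmx_colsub mulVmx // -mulmx_colsub unitmx_mul uW'.
  by rewrite -map_mxsub map_unitmx.
move=> u [[x ->]|[i [l ->]]|->].
- by apply: imS; apply: acl_mem; exists x.
- have -> : b ((invmx (colsub f Y) *m Y) i l) = (invmx (colsub f Y'') *m Y'') i l.
    by rewrite -XhE [RHS]mxE.
  by apply: acl_normalized; exact: Y''S.
- apply: imS; apply: (@acl_map _ _ b (im j)) rho_alg.
  by move=> _ [x ->]; apply: acl_mem; exists x.
Qed.

End FieldOfDefinition.

(** * Descent and transcendence degree *)

Section Reflection.

Variables (E F : fieldType) (psi : {rmorphism E -> F}) (S : E -> Prop).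

Lemma genfield_image w : genfield (fun z => exists2 u, S u & z = psi u) w ->
  exists2 v, genfield S v & w = psi v.
Proof.
elim=> {w} [w [u Su ->]||x y _ [u Su ->] _ [v Sv ->]|x y _ [u Su ->] _ [v Sv ->]].
- by exists u => //; apply: genfield_mem.
- by exists 1; rewrite ?rmorph1 //; apply: genfield1.
- by exists (u - v); rewrite ?rmorphB //; apply: genfieldB.
- by exists (u / v); rewrite ?fmorph_div //; apply: genfield_div.
Qed.

Lemma acl_reflect u : acl (fun z => exists2 v, S v & z = psi v) (psi u) -> acl S u.
Proof.
move=> [p p0 pu].
have H k : exists v, genfield S v /\ gval p`_k = psi v.
  by have /genfieldP/genfield_image [v Sv ->] := gvalP p`_k; exists v.
have [v Hv] := choice H.
pose q := \poly_(k < size p) v k.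
have qp : map_poly psi q = map_poly (@gval F _) p.
  apply/polyP => k; rewrite !coef_map coef_poly /=; case: ltnP => kp.
    by have [_ ->] := Hv k.
  by rewrite nth_default // rmorph0.
apply: (@acl_root _ _ q).
- by rewrite -(map_poly_eq0 psi) qp map_poly_eq0.
- move=> k; rewrite coef_poly; case: ltnP => _; last exact: algebraic0.
  by apply: genfield_acl; have [] := Hv k.
- by rewrite -(fmorph_root psi) qp.
Qed.

End Reflection.

Lemma gval_seq (F : fieldType) (S : F -> Prop) cs : (forall c, c \in cs -> genfield S c) ->
  exists ws : seq (gfield S), map (@gval F S) ws = cs.
Proof.
elim: cs => [|c cs IH] H; first by exists [::].
have [|ws <-] := IH; first by move=> c' cc; apply: H; rewrite in_cons cc orbT.
by have /genfieldP Hc := H c (mem_head _ _); exists (GField Hc :: ws).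
Qed.

Lemma Cfield_le m m' (F : fieldType) : (m <= m')%N -> Cfield m F -> Cfield m' F.
Proof.
move=> mm C d N f d0 dN; apply: C => //.
by apply: leq_ltn_trans dN; rewrite leq_pexp2l.
Qed.

(* The algebraic generators zs live in a field F' containing M, but Steinitz  *)
(* exchange replaces them, and a transcendence basis of K, by elements of M.  *)
Lemma Cfield_trdeg (L K M F' : fieldType) (i : {rmorphism L -> K})
    (g : {rmorphism K -> M}) (b : {rmorphism M -> F'}) zs m d :
  Cfield m L -> has_trdeg i d ->
  (forall u, acl (adjoin_seq (im (b \o g)) zs) (b u)) -> Cfield (m + (d + size zs)) M.
Proof.
move=> CL [x tx] Hz; pose iM : {rmorphism L -> M} := g \o i.
pose ws := [seq b (g y) | y <- x] ++ zs.
have [y [u ->]|ys [sy yb Hy]] := @generating_subseq _ (im (b \o iM)) ws (im b).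
  apply: acl_trans (Hz u) => z [[a ->]|zz]; last first.
    by apply: acl_mem; right; rewrite mem_cat zz orbT.
  apply: (@acl_map _ _ (b \o g) (adjoin_seq (im i) x)); last exact: transcendence_basis_acl tx a.
  move=> w [[c ->]|wx]; apply: acl_mem; first by left; exists c.
  by right; rewrite mem_cat (map_f (fun y => b (g y))).
have [ys' ysE] : exists ys', ys = map b ys'.
  elim: ys yb {sy Hy} => [|y ys IH] yb; first by exists [::].
  have [u ->] := yb y (mem_head _ _).
  have [|ys' ->] := IH; first by move=> w wy; apply: yb; rewrite in_cons wy orbT.
  by exists (u :: ys').
apply: Cfield_le (@Cfield_extension _ _ iM ys' m CL _).
  by rewrite leq_add2l; move: sy; rewrite ysE size_cat !size_map size_tuple.
move=> u; apply: (@acl_reflect _ _ b).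
apply: acl_sub (Hy _ (ex_intro _ u erefl)) => z [[a ->]|]; rewrite ?ysE.
  by exists (iM a) => //; left; exists a.
by move=> /mapP [w wy ->]; exists w => //; right.
Qed.

(** * Descent of an algebra to a finitely generated field *)

Section Descent.

Variables (L F : fieldType) (iota : {rmorphism L -> F}) (A : falgType F).
Hypothesis csA : central_simple A.

Local Notation I := 'I_(\dim {:A}).

Let cs : seq F := [seq crd k.2 (bas k.1.1 * bas k.1.2 : A) | k <- enum {: I * I * I}] ++
  [seq crd k (1 : A) | k <- enum I].

Local Notation K := (gfield (adjoin_seq (im iota) cs)).

Let cmul_mem i j k : crd k (bas i * bas j : A) \in genfield_pred (adjoin_seq (im iota) cs).
Proof.
apply/genfieldP/genfield_mem; right; rewrite mem_cat; apply/orP; left.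
by apply/mapP; exists (i, j, k); rewrite ?mem_enum.
Qed.

Let cone_mem k : crd k (1 : A) \in genfield_pred (adjoin_seq (im iota) cs).
Proof.
apply/genfieldP/genfield_mem; right; rewrite mem_cat; apply/orP; right.
by apply: map_f; rewrite mem_enum.
Qed.

Let tmul (i j : I) : {ffun I -> K^o} := [ffun k => GField (cmul_mem i j k)].
Let tone : {ffun I -> K^o} := [ffun k => GField (cone_mem k)].

Let gval_lincomb (s : {ffun I -> K^o}) (G : I -> {ffun I -> K^o}) a :
  gval ((\sum_l s l *: G l) a) = \sum_l gval (s l) * gval (G l a).
Proof.
by rewrite sum_ffunE rmorph_sum; apply: eq_bigr => l _; rewrite ffunE rmorphM.
Qed.

Let tmulE i j k : gval (tmul i j k) = crd k (bas i * bas j).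
Proof. by rewrite ffunE. Qed.

Let toneE k : gval (tone k) = crd k 1.
Proof. by rewrite ffunE. Qed.

Let tmul_assoc i j k :
  \sum_l tmul i j l *: tmul l k = \sum_l tmul j k l *: tmul i l.
Proof.
apply/ffunP => a; apply: val_inj; rewrite [LHS]gval_lincomb [RHS]gval_lincomb.
transitivity (crd a (bas i * bas j * bas k : A)).
  by rewrite -crd_mull; apply: eq_bigr => l _; rewrite !tmulE.
by rewrite -mulrA -crd_mulr; apply: eq_bigr => l _; rewrite !tmulE.
Qed.

Let tmul_1l i : \sum_l tone l *: tmul l i = stdbasis K i.
Proof.
apply/ffunP => a; apply: val_inj; rewrite [LHS]gval_lincomb.
transitivity (crd a (1 * bas i : A)).
  by rewrite -crd_mull; apply: eq_bigr => l _; rewrite tmulE toneE.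
by rewrite mul1r crd_bas ffunE rmorph_nat.
Qed.

Let tmul_1r i : \sum_l tone l *: tmul i l = stdbasis K i.
Proof.
apply/ffunP => a; apply: val_inj; rewrite [LHS]gval_lincomb.
transitivity (crd a (bas i * 1 : A)).
  by rewrite -crd_mulr; apply: eq_bigr => l _; rewrite tmulE toneE.
by rewrite mulr1 crd_bas ffunE rmorph_nat.
Qed.

Let tone_neq0 : tone != 0.
Proof.
have [k k0] := crd1_neq0 A; apply: contraNneq k0 => /ffunP/(_ k).
by rewrite !ffunE => /(congr1 (@gval F _)) /= ->.
Qed.

Let A0 : falgType K := table_alg (StructureTable tmul_assoc tmul_1l tmul_1r tone_neq0).

Let beta (u : A0) : A := \sum_k gval (u k) *: bas k.

Let beta_shom : is_shom (@gval F _) beta.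
Proof.
split=> [x y|c x||x y].
- by rewrite /beta -big_split; apply: eq_bigr => k _; rewrite ffunE rmorphD scalerDl.
- by rewrite /beta scaler_sumr; apply: eq_bigr => k _; rewrite ffunE rmorphM scalerA.
- by rewrite [RHS]crd_sum; apply: eq_bigr => k _; rewrite ffunE.
rewrite /beta big_distrlr /=.
transitivity (\sum_k \sum_i \sum_j (gval (x i) * gval (y j) * crd k (bas i * bas j : A)) *: bas k).
  apply: eq_bigr => k _; rewrite table_mulE sum_ffunE rmorph_sum scaler_suml.
  apply: eq_bigr => i _; rewrite sum_ffunE rmorph_sum scaler_suml.
  by apply: eq_bigr => j _; rewrite !ffunE !rmorphM.
rewrite exchange_big /=; apply: eq_bigr => i _; rewrite exchange_big /=.
apply: eq_bigr => j _; rewrite -scalerAl -scalerAr scalerA.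
rewrite [bas i * bas j in RHS]crd_sum scaler_sumr; apply: eq_bigr => k _.
by rewrite scalerA.
Qed.

Let crd_beta k u : crd k (beta u) = gval (u k).
Proof.
have E i : crd k (gval (u i) *: bas i : A) = gval (u i) * (k == i)%:R.
  by rewrite -crd_bas /crd linearZ.
rewrite /beta /crd linear_sum (bigD1 k) //= [X in X + _]E eqxx mulr1.
rewrite big1 ?addr0 // => i ik.
by rewrite [LHS]E eq_sym (negbTE ik) mulr0.
Qed.

Let beta_inj : injective beta.
Proof.
by move=> u v uv; apply/ffunP => k; apply: val_inj; rewrite /= -!crd_beta uv.
Qed.

Let beta_bas k : beta (stdbasis K k) = bas k.
Proof.
rewrite /beta (bigD1 k) //= big1 ?addr0 => [|i ik].
  by rewrite ffunE eqxx scale1r.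
by rewrite ffunE (negbTE ik) scale0r.
Qed.

(** [beta] sends the standard basis of [A0] to a basis of [A], so central elements map to central
    elements. The span over [F] of the image of a nonzero ideal [J] is a nonzero ideal, hence all of
    [A], which bounds the dimension of [J] from below. *)
Let A0_csa : central_simple A0.
Proof.
have [ZA sA] := csA; split.
  apply/eqP; rewrite eqEsubv; apply/andP; split; last first.
    apply/subvP => _ /vlineP [c ->]; rewrite memv_cap memvf /=; apply/centvP => v _.
    by rewrite -scalerAl -scalerAr mul1r mulr1.
  apply/subvP => z; rewrite memv_cap => /andP [_ /centvP zC].
  have : beta z \in 'Z({:A})%VS.
    rewrite memv_cap memvf; apply/centvP => v _.
    rewrite [v]crd_sum mulr_sumr mulr_suml; apply: eq_bigr => k _.
    rewrite -scalerAr -scalerAl -beta_bas -!(shomM beta_shom).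
    by rewrite zC ?memvf.
  rewrite ZA => /vlineP [c zc]; have [k k0] := crd1_neq0 A.
  apply/vlineP; exists (z k / tone k); apply: beta_inj.
  rewrite (shomZ beta_shom) (shom1 beta_shom) zc; congr (_ *: _).
  have E : gval (z k) = c * crd k 1 by rewrite -crd_beta zc /crd linearZ.
  by rewrite [RHS](fmorph_div (@gval F _)) /= E toneE mulfK.
move=> J /andP [/prodvP JL /prodvP JR].
have [->|J0] := eqVneq J 0%VS; [by left|right].
pose J1 := <<[seq beta x | x <- vbasis J]>>%VS.
have J1P x : x \in J -> beta x \in J1.
  move=> /coord_vbasis ->; rewrite (shom_sum beta_shom); apply: memv_suml => k _.
  rewrite (shomZ beta_shom); apply/memvZ/memv_span/map_f.
  by rewrite mem_nth ?size_tuple.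
have J1ind (v : A) (P : A -> Prop) : v \in J1 ->
    (forall x y, P x -> P y -> P (x + y)) -> (forall c x, x \in J -> P (c *: beta x)) -> P v.
  move=> /(coord_span (X := in_tuple _)) -> PD PZ.
  have P0 : P 0 by rewrite -(scale0r (beta 0)); apply: PZ; rewrite mem0v.
  elim/big_ind: _ => // k _.
  have : (in_tuple [seq beta x | x <- vbasis J])`_k \in [seq beta x | x <- vbasis J].
    by apply: mem_nth; rewrite ltn_ord.
  by move=> /mapP [x xJ ->]; apply/PZ/vbasis_mem.
have JA : J1 = fullv.
  have [||//] := sA J1.
    apply/andP; split; apply/prodvP => u v.
      move=> _ vJ; apply: (J1ind _ (fun v => u * v \in J1) vJ) => [x y|c x xJ].
        by rewrite mulrDr; apply: memvD.
      rewrite -scalerAr; apply: memvZ; rewrite [u]crd_sum mulr_suml; apply: memv_suml => k _.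
      rewrite -scalerAl; apply: memvZ; rewrite -beta_bas -(shomM beta_shom).
      by apply: J1P; apply: JL; rewrite ?memvf.
    move=> uJ _; apply: (J1ind _ (fun u => u * v \in J1) uJ) => [x y|c x xJ].
      by rewrite mulrDl; apply: memvD.
    rewrite -scalerAl; apply: memvZ; rewrite [v]crd_sum mulr_sumr; apply: memv_suml => k _.
    rewrite -scalerAr; apply: memvZ; rewrite -beta_bas -(shomM beta_shom).
    by apply: J1P; apply: JR; rewrite ?memvf.
  move=> J10; have := J1P _ (memv_pick J); rewrite J10 memv0 => /eqP.
  by rewrite -(shom0 beta_shom) => /beta_inj/eqP; rewrite vpick0 (negbTE J0).
apply/eqP; rewrite eqEdim subvf /=.
have -> : \dim {:A0} = \dim {:A} by rewrite dim_ffun_alg card_ord.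
rewrite -[X in (\dim X <= _)%N]JA; apply: leq_trans (dim_span _) _.
by rewrite size_map size_tuple.
Qed.

(** The structure constants of [A] and the coordinates of 1 generate a field over [L] to which [A]
    descends. *)
Lemma descends_fin_gen : exists d (K : fieldType) (i : {rmorphism L -> K})
    (j : {rmorphism K -> F}), [/\ j \o i =1 iota, has_trdeg i d & descends j A].
Proof.
have iS a : genfield (adjoin_seq (im iota) cs) (iota a).
  by apply: genfield_mem; left; exists a.
pose i : {rmorphism L -> K} := corestrict iS.
have [|ws wsE] := @gval_seq _ (adjoin_seq (im iota) cs) cs.
  by move=> c cc; apply: genfield_mem; right.
have Hws z : acl (adjoin_seq (im i) ws) z.
  apply: (@acl_reflect _ _ (@gval F _)); have /genfieldP := gvalP z.
  move=> /genfield_acl; apply: acl_sub => w [[a ->]|wc].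
    by exists (i a) => //; left; exists a.
  have : w \in map (@gval F _) ws by rewrite wsE.
  by move=> /mapP [v vw ->]; exists v => //; right.
have [d td] := has_trdeg_exists Hws.
exists d, K, i, (@gval F _); split=> //.
exists A0; split; first exact: A0_csa.
have h := ext_lift_id_shom beta_shom.
apply: alg_iso_inj h (csa_shom_inj (ext_csa _ A0_csa) h) _.
by rewrite dim_ext dim_ffun_alg card_ord.
Qed.

Lemma ess_dimP : exists (K : fieldType) (i : {rmorphism L -> K})
    (j : {rmorphism K -> F}),
  [/\ j \o i =1 iota, has_trdeg i (ess_dim iota A) & descends j A].
Proof.
rewrite /ess_dim; case E : (least _) => [d|] /=; first by have /least_SomeP [] := E.
by have /least_NoneP none := E; have [d Hd] := descends_fin_gen; case: (none d).
Qed.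

End Descent.

(** * Symbol algebras *)

(** [T] regarded as a [K]-algebra: the universal property of a symbol algebra over [K] speaks of
    [K]-algebras only. *)
Definition restrict_scalars (K F : fieldType) (phi : {rmorphism K -> F})
  (T : algType F) : Type := T.

Section RestrictScalars.

Variables (K F : fieldType) (phi : {rmorphism K -> F}) (T : algType F).

Local Notation TK := (restrict_scalars phi T).

HB.instance Definition _ := GRing.NzRing.on TK.

Let sc (c : K) (x : TK) : TK := phi c *: (x : T).

Let scA a b v : sc a (sc b v) = sc (a * b) v.
Proof. by rewrite /sc rmorphM scalerA. Qed.

Let sc1 : left_id 1 sc.
Proof. by move=> v; rewrite /sc rmorph1 scale1r. Qed.

Let scDr : right_distributive sc +%R.
Proof. by move=> c u v; rewrite /sc scalerDr. Qed.

Let scDl v : {morph sc^~ v : a b / a + b}.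
Proof. by move=> a b; rewrite /sc rmorphD scalerDl. Qed.

HB.instance Definition _ := GRing.Zmodule_isLmodule.Build K TK scA sc1 scDr scDl.

Let scAl (a : K) (u v : TK) : a *: (u * v) = (a *: u) * v.
Proof. exact: scalerAl. Qed.

Let scAr (a : K) (u v : TK) : a *: (u * v) = u * (a *: v).
Proof. exact: scalerAr. Qed.

HB.instance Definition _ := GRing.Lmodule_isLalgebra.Build K TK scAl.
HB.instance Definition _ := GRing.Lalgebra_isAlgebra.Build K TK scAr.

Lemma restrict_scalars_shom (S : algType K) (f : S -> T) :
  @is_shom K F phi S T f <-> @is_shom K K idfun S TK f.
Proof. by split=> -[D Z O M]; split. Qed.

End RestrictScalars.

Section SymbolBaseChange.

Variables (K F : fieldType) (phi : {rmorphism K -> F}) (n : nat) (sigma : K).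

Lemma symbol_relations_shom a b (S : algType K) (T : algType F) (f : S -> T) x y :
  is_shom phi f -> symbol_relations n sigma a b x y ->
  symbol_relations n (phi sigma) (phi a) (phi b) (f x) (f y).
Proof.
move=> hf [xn yn yx].
have fX z k : f (z ^+ k) = f z ^+ k.
  by elim: k => [|k IH]; rewrite ?(shom1 hf) // !exprS (shomM hf) IH.
by split; rewrite -?fX -?(shomM hf) ?xn ?yn ?yx (shomZ hf) ?(shom1 hf) // (shomM hf).
Qed.

(** A presentation survives base change: maps over [F] from the scalar extension to [T] correspond
    to maps over [K] from [S] to [T] with restricted scalars. *)
Lemma symbol_ext (S : falgType K) : symbol n sigma S ->
  symbol n (phi sigma) (scalar_ext phi S).
Proof.
move=> [a [b [a0 b0 [x [y [rxy Hu]]]]]].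
have hS := ext_shom phi S.
exists (phi a), (phi b); split; rewrite ?fmorph_eq0 //.
exists (ext phi x), (ext phi y); split; first exact: symbol_relations_shom hS rxy.
move=> T u v ruv; pose TK := restrict_scalars phi T.
have ruv' : @symbol_relations K n sigma a b TK u v.
  have [un vn vu] := ruv; split; first exact: un; first exact: vn.
  exact: vu.
have [[h [hx hy]] uniq] := Hu TK u v ruv'; split.
  have H := proj2 (@restrict_scalars_shom K F phi T S h) (lrmorphism_shom h).
  have [g gE] := shom_lrmorphism (ext_lift_id_shom H).
  by exists g; rewrite !gE !(ext_lift_id_ext H).
move=> g g' gx gy; apply: (shom_ext_eq (lrmorphism_shom g) (lrmorphism_shom g')).
have H (e : {lrmorphism scalar_ext phi S -> T}) :
    exists e' : {lrmorphism S -> TK}, forall z, e' z = e (ext phi z).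
  have H := proj1 (@restrict_scalars_shom K F phi T S _) (shom_id_comp hS (lrmorphism_shom e)).
  by have [e' e'E] := @shom_lrmorphism K S TK _ H; exists e'.
have [e eE] := H g; have [e' e'E] := H g'.
by move=> z; rewrite -eE -e'E; apply: uniq; rewrite eE e'E.
Qed.

Lemma symbol_product_ext k (T : falgType K) : symbol_product n sigma k T ->
  exists2 T', symbol_product n (phi sigma) k T' & alg_iso (scalar_ext phi T) T'.
Proof.
elim=> {k T} [|k S T symS _ [T' pT' iT]].
  by exists F^o; [exact: SymbolProduct0|exact: ext_base].
exists (tensor (scalar_ext phi S) T'); first exact: SymbolProductS (symbol_ext symS) pT'.
exact: alg_iso_trans (ext_tensor _ _ _) (tensor_iso (alg_iso_refl _) iT).
Qed.

Lemma symbol_length_ext (A : falgType K) (B : falgType F) :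
  alg_iso (scalar_ext phi A) B ->
  ext_leq (symbol_length n (phi sigma) B) (symbol_length n sigma A).
Proof.
move=> AB; case E : (symbol_length n sigma A) => [k|]; last by case: symbol_length.
have /least_SomeP [[T [pT eT]] _] := E.
have [T' pT' iT] := symbol_product_ext pT.
have Pk : exists T, symbol_product n (phi sigma) k T /\ brauer_equiv T B.
  by exists T'; split=> //; apply: brauer_equiv_iso iT AB (brauer_equiv_ext phi eT).
case E' : (symbol_length _ _ _) => [k'|]; last first.
  by have /least_NoneP/(_ k) := E'.
by have /least_SomeP [_] := E'; apply.
Qed.

End SymbolBaseChange.

Lemma ext_leq_trans x y z : ext_leq x y -> ext_leq y z -> ext_leq x z.
Proof. by case: x y z => [x|] [y|] [z|] //=; apply: leq_trans. Qed.

Theorem theorem5p3 (p s t m : nat) (L F : fieldType)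
    (iota : {rmorphism L -> F}) (rho : F) (A : falgType F) :
  prime p -> (1 <= s)%N -> (1 <= t)%N ->
  Cfield m L ->
  (p ^ t).-primitive_root rho ->
  central_simple A ->
  exponent A = Some (p ^ t)%N ->
  has_degree A (p ^ s)%N ->
  exists (M : fieldType) (sigma : M),
    [/\ Cfield (m + ess_dim iota A + p ^ (s - t) - 1) M,
        (p ^ t).-primitive_root sigma
      & ext_leq (symbol_length (p ^ t) rho A)
                (field_symbol_length (p ^ t) sigma)].
Proof.
move=> pp s0 t0 CL prho csA eA dA.
have [K [i [j [_ tK [A' [csA' iA]]]]]] := ess_dimP iota csA.
have dA' : has_degree A' (p ^ s) by rewrite /has_degree -dA -(alg_iso_dim iA) dim_ext.
have ps0 : (0 < p ^ s)%N by rewrite expn_gt0 prime_gt0.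
have pt0 : (0 < p ^ t)%N by rewrite expn_gt0 prime_gt0.
have /least_SomeP [[_ trA] minA] := eA.
(* In characteristic [p] there would be no primitive [p ^ t]-th root of unity, as [t] is
   positive. *)
have pK : p%:R != 0 :> K.
  rewrite -(fmorph_eq0 j) rmorph_nat; apply/negP => p0.
  have pF : p \in [pchar F] by apply/andP.
  by rewrite (prim_root_pcharF prho) // dvdn_exp in pF.
(* Since [rho] is algebraic over [K], putting it into [M] leaves the transcendence degree
   unchanged. *)
have rho_alg : acl (im j) rho.
  have /prim_expr_order rhoE := prho.
  apply: (@acl_root _ _ (map_poly j ('X^(p ^ t) - 1))).
  - by rewrite map_poly_eq0 monic_neq0 // monicXnsubC.
  - by move=> k; rewrite coef_map; apply: acl_mem; exists ('X^(p ^ t) - 1)`_k.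
  - by rewrite rmorphB /= map_polyXn rmorph1 rootE hornerD hornerXn hornerN hornerC rhoE subrr.
(* The tensor power of [A'] is split by [F], because [A] has exponent [p ^ t]. *)
have [V rV] : exists V : tensor_pow A' (p ^ t) -> 'M[F]_((p ^ s) ^ (p ^ t)), is_rep j V.
  apply: rep_of_brauer_trivial csA' dA' _.
  exact: brauer_equiv_iso (tensor_pow_iso _ (alg_iso_sym iA)) (alg_iso_refl _) trA.
have [X [jX [Xrho [R rR] [F' [b [zs [szs Hzs]]]]]]] :=
  field_of_definition pp s0 t0 csA' dA' pK rV rho_alg.
have /genfieldP rhoX := Xrho; pose sigma := GField rhoX.
pose jM : {rmorphism K -> gfield X} := corestrict jX.
have iM : alg_iso (scalar_ext (@gval F X) (scalar_ext jM A')) A.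
  exact: alg_iso_trans (@ext_ext _ _ _ jM (@gval F X) j A' (fun=> erefl)) iA.
exists (gfield X), sigma; split.
(* The elements [zs] number at most [p ^ (s - t) - 1], which is what the level gains beyond [m] and
   the essential dimension. *)
- pose b' : {rmorphism gfield X -> F'} := b \o @gval F X.
  apply: Cfield_le (@Cfield_trdeg _ _ _ _ i jM b' zs m _ CL tK _).
    by rewrite -addnBA ?expn_gt0 ?prime_gt0 // -addnA !leq_add2l -ltnS subn1 prednK ?expn_gt0 ?prime_gt0.
  move=> u; apply: acl_map Hzs _; apply: genfield_acl; exact/genfieldP/gvalP.
- by rewrite -(fmorph_primitive_root (@gval F X)).
(* The representation [R] splits the tensor power over the new field; a smaller exponent there would
   persist over [F]. *)
have eM : exponent (scalar_ext jM A') = Some (p ^ t)%N.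
  apply/least_SomeP; split; first by split=> //; apply: brauer_trivial_of_rep rR.
  move=> k [k0 trk]; apply: minA; split=> //.
  apply: brauer_equiv_iso (brauer_equiv_ext (@gval F X) trk); last exact: ext_base.
  exact: alg_iso_trans (ext_pow _ _ _) (tensor_pow_iso _ iM).
apply: ext_leq_trans (symbol_length_ext _ sigma iM) _.
case E : (field_symbol_length _ _) => [l|]; last by case: symbol_length.
by have /least_SomeP [H _] := E; apply: H eM; apply: ext_csa.
Qed.
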